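(* Fix $p>4$. There exist positive constants $C_0,C_1,\varepsilon$ such that, if $J_c-\varepsilon<J<J_c$ and $\ell\in\mathbb N$ satisfies $C_0h^*\le\ell\le(C_0(J_c-J))^{-1}$, then for every $\underline s\in\{\pm1\}^{\mathbb Z^2}$ and every finite $X\subset\mathbb Z^2$, $$H_X(\underline s_X|\underline\sigma^* )\ge H_X(\underline\sigma^*_X|\underline\sigma^* )+C_1\Big(N_c+(J_c-J)^{\frac{p-2}{p-3}}\ell^2\mathcal N_B^{\rm hole}\Big)+\frac12\sum_{h\ne h^*}\sum_{i=1}^{\mathcal N_G}(e_{\rm s}(h)-e_{\rm s}(h^* ))A_h(G_i),$$ where $N_c$, $\mathcal N_B^{\rm hole}$ and the good regions $G_1,\dots,G_{\mathcal N_G}$ are those associated (with tiles of side $\ell$) to the configuration $\underline\sigma$ equal to $\underline s$ on $X$ and to $\underline\sigma^*$ on $X^c$.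
   Context: Work on $\mathbb Z^2$ with $p>4$, $J>0$. For finite $X\subset\mathbb Z^2$, $\underline\sigma_X\in\{\pm1\}^X$ and $\underline s\in\{\pm1\}^{\mathbb Z^2}$, set $H_X(\underline\sigma_X|\underline s)=-J\sum_{\langle x,y\rangle,\,x,y\in X}(\sigma_x\sigma_y-1)+\sum_{\{x,y\}\subset X}\frac{\sigma_x\sigma_y-1}{|x-y|^p}-J\sum_{x\in X,y\in X^c,|x-y|=1}(\sigma_xs_y-1)+\sum_{x\in X,y\in X^c}\frac{\sigma_xs_y-1}{|x-y|^p}$ (nearest-neighbour pairs in the first sum, unordered pairs of distinct sites in the second); $\underline s_X$ is the restriction of $\underline s$ to $X$. Let $J_c=\sum_{y_1>0,\,y_2\in\mathbb Z}\frac{y_1}{(y_1^2+y_2^2)^{p/2}}$. For $h\in\mathbb N$, $\sigma^{(h)}_x=\mathrm{sign}(\sin(\pi(x_1+1/2)/h))$ and $e_{\rm s}(h)=\frac1{2h}\sum_{x_1=0}^{2h-1}\Big[-\frac J2\sum_{y:|y-x|=1}(\sigma_x\sigma_y-1)+\frac12\sum_{y\ne x}\frac{\sigma_x\sigma_y-1}{|x-y|^p}\Big]$ with $x=(x_1,0)$, $\underline\sigma=\underline\sigma^{(h)}$. Let $h^*$ be a minimizer of $e_{\rm s}$ over $\mathbb N$, and $\underline\sigma^*=\underline\sigma^{(h^* )}$. Geometric notions for a configuration $\underline\sigma$: let $\Delta=\{x:\sigma_x=-1\}$ and $\Gamma(\Delta)$ the union of the bonds of the dual lattice separating a site of $\Delta$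 from a site of $\Delta^c$. At a dual vertex where 4 such bonds meet, deform $\Gamma(\Delta)$ slightly (''chop'' the vertex) so that the two unit squares containing a minus spin become disconnected from the vertex. The connected components of the result are the contours; corners are the points where two orthogonal portions of a contour meet (a chopped vertex yields two corners). $N_c$ is the total number of corners. Tiles: pave $\mathbb Z^2$ by squares of side $\ell$. For a tile $T$, $\Gamma_T(\Delta)$ is the set of bonds of $\Gamma(\Delta)$ separating a site of $\Delta\cap T$ from a site of $\Delta^c$. To each endpoint of each maximal straight portion of each connected component of $\Gamma_T(\Delta)$ assign $1/2$ if the endpoint is a corner and $0$ otherwise; $n_c(T)$ is the sum of these numbers. A tile contains a hole if it contains a square of side $\ell/5$ entirely contained in $\Delta$ or in $\Delta^c$. A tile is bad if $n_c(T)>0$ or it contains a hole; $\mathcal N_B^{\rm hole}$ is the number of bad tiles containing a hole. The good regions $G_1,\dots,G_{\mathcal N_G}$ are the connected components of the complement of the union of bad tiles; the contour portions inside a good region are straight with a common orientation (all vertical or all horizontal). If $G_i$ is vertically (resp. horizontally) striped, a rectangular portion of stripe of width $h$ in $G_i$ is a rectangle contained in $\Delta$ or in $\Delta^c$ whose two vertical (resp. horizontal) sides both belong to the contours in $G_i$ and are at distance $h$; $A_h(G_i)$ is the area of the union of all rectangular portions of stripe of width $h$ in $G_i$. *)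

(* Defs.v *)
From Stdlib Require Import Reals Lra Lia ZArith List Relations Classical ClassicalEpsilon.
From Coquelicot Require Import Coquelicot.
Import ListNotations.
Open Scope R_scope.

Definition site := (Z * Z)%type.

Definition config := site -> bool.

Definition sp (b : bool) : R := if b then 1 else -1.

Definition site_eqb (x y : site) : bool :=
  (Z.eqb (fst x) (fst y) && Z.eqb (snd x) (snd y))%bool.

(* strict lexicographic order: used to enumerate unordered pairs once *)
Definition lexltb (x y : site) : bool :=
  (Z.ltb (fst x) (fst y) || (Z.eqb (fst x) (fst y) && Z.ltb (snd x) (snd y)))%bool.

Definition dist2 (x y : site) : Z :=
  ((fst x - fst y) * (fst x - fst y) + (snd x - snd y) * (snd x - snd y))%Z.

Definition distp (p : R) (x y : site) : R := Rpower (IZR (dist2 x y)) (p / 2).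

Definition nnb (x y : site) : bool := Z.eqb (dist2 x y) 1.

Definition nbrs (x : site) : list site :=
  [ ((fst x + 1)%Z, snd x); ((fst x - 1)%Z, snd x);
    (fst x, (snd x + 1)%Z); (fst x, (snd x - 1)%Z) ].

Definition lsumlist {A : Type} (f : A -> R) (l : list A) : R :=
  fold_right (fun a acc => f a + acc) 0 l.

Definition zr (n : nat) : list Z :=
  map (fun k => (Z.of_nat k - Z.of_nat n)%Z) (seq 0 (2 * n + 1)).

Definition box (n : nat) : list site := list_prod (zr n) (zr n).

Definition bsum (n : nat) (f : site -> R) : R := lsumlist f (box n).

(* Lattice sum over all of Z^2, as the limit of sums over the boxes
   [-n,n]^2 (all lattice sums used below are absolutely convergent or
   have finitely many nonzero terms). *)
Definition lsum (f : site -> R) : R := real (Lim_seq (fun n => bsum n f)).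

Definition ind (P : Prop) : R :=
  if excluded_middle_informative P then 1 else 0.

Definition inX (X : list site) (x : site) : bool := existsb (site_eqb x) X.

(* X is a finite set given as a duplicate-free list; sigma is only used on X,
   s only on X^c. *)
Definition H (p J : R) (X : list site) (sigma s : config) : R :=
  - J * lsumlist (fun x => lsumlist (fun y =>
          if (lexltb x y && nnb x y)%bool
          then sp (sigma x) * sp (sigma y) - 1 else 0) X) X
  + lsumlist (fun x => lsumlist (fun y =>
          if lexltb x y
          then (sp (sigma x) * sp (sigma y) - 1) / distp p x y else 0) X) X
  - J * lsumlist (fun x => lsumlist (fun y =>
          if inX X y then 0 else sp (sigma x) * sp (s y) - 1) (nbrs x)) X
  + lsumlist (fun x => lsum (fun y =>
          if inX X y then 0 else (sp (sigma x) * sp (s y) - 1) / distp p x y)) X.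

Definition Jc (p : R) : R :=
  lsum (fun y => if Z.ltb 0 (fst y)
                 then IZR (fst y) / Rpower (IZR (fst y * fst y + snd y * snd y)) (p / 2)
                 else 0).

Definition sigma_h (h : nat) : config :=
  fun x => if Rlt_dec 0 (sin (PI * (IZR (fst x) + / 2) / INR h)) then true else false.

Definition es (p J : R) (h : nat) : R :=
  / (2 * INR h) *
  lsumlist (fun x1 : Z =>
     let x : site := (x1, 0%Z) in
     let sg := sigma_h h in
       - J / 2 * lsumlist (fun y => sp (sg x) * sp (sg y) - 1) (nbrs x)
       + / 2 * lsum (fun y => if site_eqb y x then 0
                              else (sp (sg x) * sp (sg y) - 1) / distp p x y))
    (map Z.of_nat (seq 0 (2 * h))).

Definition is_min_es (p J : R) (hs : nat) : Prop :=
  (1 <= hs)%nat /\ forall h : nat, (1 <= h)%nat -> es p J hs <= es p J h.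

Definition glue (X : list site) (s sigma' : config) : config :=
  fun x => if inX X x then s x else sigma' x.

(* Dual vertex v = (a,b) stands for the point (a+1/2, b+1/2).  Its four
   incident dual bonds separate resp. (a,b)|(a+1,b) [down],
   (a,b+1)|(a+1,b+1) [up], (a,b)|(a,b+1) [left], (a+1,b)|(a+1,b+1) [right].
   A bond is in Gamma(Delta) iff the two spins it separates differ.
   Number of corners at v: 2 if all four bonds are in Gamma (chopped vertex),
   1 if exactly two orthogonal bonds meet there, 0 otherwise. *)
Definition corners (sg : config) (v : site) : nat :=
  let a := fst v in let b := snd v in
  let s00 := sg (a, b) in let s10 := sg ((a+1)%Z, b) in
  let s01 := sg (a, (b+1)%Z) in let s11 := sg ((a+1)%Z, (b+1)%Z) in
  let dn := negb (Bool.eqb s00 s10) in let up := negb (Bool.eqb s01 s11) in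
  let lf := negb (Bool.eqb s00 s01) in let rt := negb (Bool.eqb s10 s11) in
  if (dn && up && lf && rt)%bool then 2%nat
  else if ((dn || up) && (lf || rt))%bool then 1%nat else 0%nat.

Definition Nc (sg : config) : R := lsum (fun v => INR (corners sg v)).

(* endpoints (dual vertices) of the dual bond separating x and y = x + d *)
Definition bond_ends (x y : site) : list site :=
  let a := fst x in let b := snd x in
  if Z.eqb (fst y) (a + 1) then [ (a, (b-1)%Z); (a, b) ]
  else if Z.eqb (fst y) (a - 1) then [ ((a-1)%Z, (b-1)%Z); ((a-1)%Z, b) ]
  else if Z.eqb (snd y) (b + 1) then [ ((a-1)%Z, b); (a, b) ]
  else [ ((a-1)%Z, (b-1)%Z); (a, (b-1)%Z) ].

Definition tile_of (l : nat) (x : site) : site :=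
  (Z.div (fst x) (Z.of_nat l), Z.div (snd x) (Z.of_nat l)).

Definition tile_sites (l : nat) (t : site) : list site :=
  list_prod (map (fun k => (fst t * Z.of_nat l + Z.of_nat k)%Z) (seq 0 l))
            (map (fun k => (snd t * Z.of_nat l + Z.of_nat k)%Z) (seq 0 l)).

(* n_c(T): each bond of Gamma_T(Delta) (separating x in Delta /\ T from
   y in Delta^c) contributes 1/2 for each of its endpoints that is a corner
   (such an endpoint is necessarily an endpoint of the maximal straight
   portion containing the bond, and each such portion endpoint arises from
   exactly one bond). *)
Definition n_c (sg : config) (l : nat) (t : site) : R :=
  lsumlist (fun x =>
    lsumlist (fun y =>
      if (negb (sg x) && sg y)%bool
      then lsumlist (fun v => if Nat.ltb 0 (corners sg v) then / 2 else 0)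
                    (bond_ends x y)
      else 0) (nbrs x)) (tile_sites l t).

Definition hole (sg : config) (l : nat) (t : site) : Prop :=
  exists (a b : Z) (k : nat), (l <= 5 * k)%nat /\
    (forall u v : nat, (u < k)%nat -> (v < k)%nat ->
       tile_of l ((a + Z.of_nat u)%Z, (b + Z.of_nat v)%Z) = t /\
       sg ((a + Z.of_nat u)%Z, (b + Z.of_nat v)%Z) = sg (a, b)).

Definition bad (sg : config) (l : nat) (t : site) : Prop :=
  n_c sg l t > 0 \/ hole sg l t.

Definition NBhole (sg : config) (l : nat) : R :=
  lsum (fun t => ind (bad sg l t /\ hole sg l t)).

Definition good_site (sg : config) (l : nat) (x : site) : Prop :=
  ~ bad sg l (tile_of l x).

Definition good_step (sg : config) (l : nat) (x y : site) : Prop :=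
  good_site sg l x /\ good_site sg l y /\ nnb x y = true.

(* x and y lie in the same good region (connected component of the union of
   good tiles; tiles are connected through shared edges) *)
Definition same_good (sg : config) (l : nat) (x y : site) : Prop :=
  good_site sg l x /\ clos_refl_trans site (good_step sg l) x y.

(* z lies in a rectangular portion of stripe of width h of vertical type in
   the good region G containing z: a rectangle of sites
   {a..a+h-1} x {b..c}, monochromatic, contained in G, whose two vertical
   sides (at distance h) consist of contour bonds lying in G. *)
Definition in_stripeV (sg : config) (l : nat) (h : nat) (z : site) : Prop :=
  exists (a b c : Z), (b <= c)%Z /\
    (a <= fst z < a + Z.of_nat h)%Z /\ (b <= snd z <= c)%Z /\
    (forall w : site, (a <= fst w < a + Z.of_nat h)%Z -> (b <= snd w <= c)%Z ->
        sg w = sg z /\ same_good sg l z w) /\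
    (forall y : Z, (b <= y <= c)%Z ->
        sg ((a - 1)%Z, y) <> sg (a, y) /\
        sg ((a + Z.of_nat h - 1)%Z, y) <> sg ((a + Z.of_nat h)%Z, y) /\
        same_good sg l z ((a - 1)%Z, y) /\ same_good sg l z ((a + Z.of_nat h)%Z, y)).

Definition in_stripeH (sg : config) (l : nat) (h : nat) (z : site) : Prop :=
  exists (a b c : Z), (b <= c)%Z /\
    (a <= snd z < a + Z.of_nat h)%Z /\ (b <= fst z <= c)%Z /\
    (forall w : site, (a <= snd w < a + Z.of_nat h)%Z -> (b <= fst w <= c)%Z ->
        sg w = sg z /\ same_good sg l z w) /\
    (forall y : Z, (b <= y <= c)%Z ->
        sg (y, (a - 1)%Z) <> sg (y, a) /\
        sg (y, (a + Z.of_nat h - 1)%Z) <> sg (y, (a + Z.of_nat h)%Z) /\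
        same_good sg l z (y, (a - 1)%Z) /\ same_good sg l z (y, (a + Z.of_nat h)%Z)).

Definition in_stripe (sg : config) (l h : nat) (z : site) : Prop :=
  in_stripeV sg l h z \/ in_stripeH sg l h z.

(* sum_{h <> hs, h >= 1} sum_i (e_s(h) - e_s(hs)) A_h(G_i), where
   sum_i A_h(G_i) = number of sites z lying in a rectangular portion of stripe
   of width h of the good region containing z.  All terms are >= 0 (hs is a
   minimizer), so this is the (possibly +oo) limit of the partial sums. *)
Definition stripe_term (p J : R) (hs : nat) (sg : config) (l : nat) : Rbar :=
  Lim_seq (fun n =>
    lsumlist (fun h =>
      if Nat.eqb h hs then 0
      else (es p J h - es p J hs) * bsum n (fun z => ind (in_stripe sg l h z)))
    (seq 1 n)).

(* Main.v *)
(** For [z] the corner of the L-shaped path from [x] to [y], [a = sigma_x sigma_z] and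
    [b = sigma_z sigma_y], the identity [1 - a b = (1 - a) + (1 - b) - (1 - a) (1 - b)] splits the energy
    exactly into one-dimensional energies of the rows and of the columns, with kernel
    [K n = sum_m |(n, m)|^-p], and a nonnegative rest which pays a constant for every corner.

    The Hankel form of [K] is positive and contracts under shifts, because [|z + conj w|^-p] is a positive
    definite kernel on the half plane. This gives a chessboard estimate in local form: in an arbitrary
    configuration a run of width [h] costs at least [h e_s(h)] up to a telescoping boundary term.
    Hence the energy difference is at least the sum over the sites of [e_s(h_r) + e_s(h_c) - e_s(h_0)],
    with [h_0] the minimizer and [h_r], [h_c] the widths of the runs of the row and of the column
    through the site.

    As [e_s(h) >= - 2 (J_c - J) / h], this is negative only up to [2 (J_c - J) / h_r] or
    [2 (J_c - J) / h_c]. When the other run is shorter than [2 l] these amounts are charged to corners: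
    following the end of the short run along the long one, one meets a corner. Every corner receives
    [O(l (J_c - J))], which its own energy exceeds since [l (J_c - J)] is small. When both runs are long,
    [e_s(h_0)] wins since [l / h_0] is large. *)

Require Import Defs.
From Stdlib Require Import Reals Lra Lia ZArith List Relations Classical ClassicalEpsilon.
From Stdlib Require Import FunctionalExtensionality Permutation.
From Coquelicot Require Import Coquelicot.
Import ListNotations.
Open Scope R_scope.

(** Near [Jc] a bound with the wrong constant would be useless: a run of width [h] costs [2 J] and
    regains [2 Jc] up to a deficit comparable with [h^(3-p)]. With [d = Jc - J], balancing this
    deficit against [d] gives [h] of order [d^(-1/(p-3))] and a specific energy of order only
    [- d^((p-2)/(p-3))]. Since the boundary condition is a stripe state on the infinite lattice and
    not a torus, repeated reflection is replaced by the squared norm, in the Hankel form, of the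
    field seen from a kink: its differences telescope along a line and its end values are compared
    with the reference state. Rows are compared with periodic stripes. Columns are constant in the
    reference state, and in a nonconstant column the unbounded run on the left is only bounded below
    by [- 2 d]. This loss escapes the sum over sites and is charged to corners separately, at most
    [h_0] columns to each. Good tiles and tiles with a hole are disjoint, so one sum of nonnegative
    local gains pays for both; the factor [1/2] of the stripe term is there because a site might be
    counted in a vertical and in a horizontal stripe. *)

Definition eqd {A : Type} (x y : A) : {x = y} + {x <> y} :=
  excluded_middle_informative (x = y).

(** * Finite sums over lists *)

Lemma lsl_ext {A} (f g : A -> R) L :
  (forall a, In a L -> f a = g a) -> lsumlist f L = lsumlist g L.
Proof.
  induction L as [|a L IH]; intros E; [reflexivity|]. simpl.
  rewrite (E a (or_introl eq_refl)). f_equal. apply IH. intros; apply E; right; auto.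
Qed.

Lemma lsl_app {A} (f : A -> R) L M : lsumlist f (L ++ M) = lsumlist f L + lsumlist f M.
Proof. induction L; simpl; [ring|]. unfold lsumlist in *; simpl. rewrite IHL. ring. Qed.

Lemma lsl_plus {A} (f g : A -> R) L :
  lsumlist (fun a => f a + g a) L = lsumlist f L + lsumlist g L.
Proof. induction L; simpl; [ring|]. unfold lsumlist in *; simpl. rewrite IHL. ring. Qed.

Lemma lsl_scal {A} (c : R) (f : A -> R) L :
  lsumlist (fun a => c * f a) L = c * lsumlist f L.
Proof. induction L; simpl; [ring|]. unfold lsumlist in *; simpl. rewrite IHL. ring. Qed.

Lemma lsl_minus {A} (f g : A -> R) L :
  lsumlist (fun a => f a - g a) L = lsumlist f L - lsumlist g L.
Proof. induction L; simpl; [ring|]. unfold lsumlist in *; simpl. rewrite IHL. ring. Qed.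

Lemma lsl_zero {A} (f : A -> R) L : (forall a, In a L -> f a = 0) -> lsumlist f L = 0.
Proof.
  induction L as [|a L IH]; intros E; [reflexivity|]. simpl.
  rewrite (E a (or_introl eq_refl)), IH; [ring|]. intros; apply E; right; auto.
Qed.

Lemma lsl_const {A} (c : R) (L : list A) : lsumlist (fun _ => c) L = INR (length L) * c.
Proof.
  induction L as [|a L IH]; [simpl; ring|].
  change (c + lsumlist (fun _ => c) L = INR (S (length L)) * c). rewrite IH, S_INR; ring.
Qed.

Lemma lsl_le {A} (f g : A -> R) L :
  (forall a, In a L -> f a <= g a) -> lsumlist f L <= lsumlist g L.
Proof.
  induction L as [|a L IH]; intros E; [right; reflexivity|]. simpl.
  apply Rplus_le_compat; [apply E; left; auto|apply IH; intros; apply E; right; auto].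
Qed.

Lemma lsl_nonneg {A} (f : A -> R) L : (forall a, In a L -> 0 <= f a) -> 0 <= lsumlist f L.
Proof.
  intros E. rewrite <- (lsl_zero (fun _ : A => 0) L) by auto. apply lsl_le; auto.
Qed.

Lemma lsl_perm {A} (f : A -> R) L M : Permutation L M -> lsumlist f L = lsumlist f M.
Proof. induction 1; unfold lsumlist in *; simpl in *; try lra. Qed.

Lemma lsl_map {A B} (g : A -> B) (f : B -> R) L :
  lsumlist f (map g L) = lsumlist (fun a => f (g a)) L.
Proof. induction L; unfold lsumlist in *; simpl; [auto|]. rewrite IHL; auto. Qed.

Lemma lsl_swap {A B} (f : A -> B -> R) L M :
  lsumlist (fun a => lsumlist (f a) M) L = lsumlist (fun b => lsumlist (fun a => f a b) L) M.
Proof.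
  induction L as [|a L IH].
  - simpl. symmetry. apply lsl_zero. auto.
  - change (lsumlist (f a) M + lsumlist (fun a => lsumlist (f a) M) L =
      lsumlist (fun b => f a b + lsumlist (fun a => f a b) L) M).
    rewrite lsl_plus, IH. reflexivity.
Qed.

Lemma lsl_prod {A B} (f : A * B -> R) L M :
  lsumlist f (list_prod L M) = lsumlist (fun a => lsumlist (fun b => f (a, b)) M) L.
Proof.
  induction L as [|a L IH]; [reflexivity|].
  simpl. rewrite lsl_app, lsl_map, IH. reflexivity.
Qed.

Definition notin {A} (L : list A) (x : A) : bool := if in_dec eqd x L then false else true.

Lemma notin_spec {A} (L : list A) x : notin L x = true <-> ~ In x L.
Proof. unfold notin; destruct in_dec; split; intros; congruence || tauto. Qed.

Lemma incl_split {A} (L M : list A) : NoDup L -> NoDup M -> incl L M ->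
  Permutation M (L ++ filter (notin L) M).
Proof.
  intros HL HM HI. apply NoDup_Permutation; auto.
  - apply NoDup_app; auto; [apply NoDup_filter; auto|].
    intros a Ha. rewrite filter_In, notin_spec. tauto.
  - intros x. rewrite in_app_iff, filter_In, notin_spec.
    destruct (classic (In x L)); intuition.
Qed.

Lemma lsl_incl_le {A} (f : A -> R) L M : NoDup L -> NoDup M -> incl L M ->
  (forall a, In a M -> 0 <= f a) -> lsumlist f L <= lsumlist f M.
Proof.
  intros HL HM HI Hf. rewrite (lsl_perm f M _ (incl_split L M HL HM HI)), lsl_app.
  assert (0 <= lsumlist f (filter (notin L) M)); [|lra].
  apply lsl_nonneg. intros a Ha. apply filter_In in Ha. apply Hf; tauto.
Qed.

Lemma lsl_incl_eq {A} (f : A -> R) L M : NoDup L -> NoDup M -> incl L M ->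
  (forall a, In a M -> ~ In a L -> f a = 0) -> lsumlist f L = lsumlist f M.
Proof.
  intros HL HM HI Hf. rewrite (lsl_perm f M _ (incl_split L M HL HM HI)), lsl_app.
  rewrite (lsl_zero f (filter _ _)); [ring|].
  intros a Ha. apply filter_In in Ha. rewrite notin_spec in Ha. apply Hf; tauto.
Qed.

Lemma nodup_ext_list {A} (L M : list A) : exists N : list A, NoDup N /\ incl L N /\ incl M N.
Proof.
  exists (nodup eqd (L ++ M)). split; [apply NoDup_nodup|].
  split; intros x Hx; apply nodup_In, in_or_app; auto.
Qed.

(** * Unordered sums *)

(** Convergence along the net of finite subsets, encoded as duplicate-free lists. No enumeration
    enters, so reindexing and exchange of sums need no rearrangement argument. *)
Definition has_sum {A : Type} (f : A -> R) (S : R) : Prop :=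
  forall e, 0 < e -> exists L : list A,
    forall M, NoDup M -> incl L M -> Rabs (lsumlist f M - S) < e.

Definition summable {A : Type} (f : A -> R) : Prop :=
  exists C, forall L, NoDup L -> lsumlist (fun a => Rabs (f a)) L <= C.

Definition tsum {A : Type} (f : A -> R) : R := epsilon (inhabits 0) (has_sum f).

Lemma has_sum_unique {A} (f : A -> R) S T : has_sum f S -> has_sum f T -> S = T.
Proof.
  intros HS HT. destruct (Req_dec S T) as [|N]; auto. exfalso.
  assert (P : 0 < Rabs (S - T) / 2) by (assert (0 < Rabs (S - T)) by (apply Rabs_pos_lt; lra); lra).
  destruct (HS _ P) as [L HL]. destruct (HT _ P) as [M HM].
  destruct (nodup_ext_list L M) as [K [K1 [K2 K3]]].
  specialize (HL K K1 K2). specialize (HM K K1 K3).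
  assert (Rabs (S - T) <= Rabs (lsumlist f K - S) + Rabs (lsumlist f K - T)).
  { replace (S - T) with (- (lsumlist f K - S) + (lsumlist f K - T)) by ring.
    eapply Rle_trans; [apply Rabs_triang|]. rewrite Rabs_Ropp. lra. }
  lra.
Qed.

Lemma has_sum_tsum_eq {A} (f : A -> R) S : has_sum f S -> tsum f = S.
Proof.
  intros H. apply has_sum_unique with f; auto. unfold tsum. apply epsilon_spec. eauto.
Qed.

Lemma has_sum_plus {A} (f g : A -> R) S T :
  has_sum f S -> has_sum g T -> has_sum (fun a => f a + g a) (S + T).
Proof.
  intros HS HT e He. destruct (HS (e/2)) as [L HL]; [lra|]. destruct (HT (e/2)) as [M HM]; [lra|].
  exists (L ++ M). intros K K1 K2. rewrite lsl_plus.
  specialize (HL K K1 (fun x hx => K2 x (in_or_app _ _ _ (or_introl hx)))).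
  specialize (HM K K1 (fun x hx => K2 x (in_or_app _ _ _ (or_intror hx)))).
  replace (lsumlist f K + lsumlist g K - (S + T)) with ((lsumlist f K - S) + (lsumlist g K - T)) by ring.
  eapply Rle_lt_trans; [apply Rabs_triang|]. lra.
Qed.

Lemma has_sum_scal {A} (f : A -> R) c S : has_sum f S -> has_sum (fun a => c * f a) (c * S).
Proof.
  intros HS e He. destruct (HS (e / (Rabs c + 1))) as [L HL].
  { apply Rdiv_lt_0_compat; auto. generalize (Rabs_pos c); lra. }
  exists L. intros K K1 K2. specialize (HL K K1 K2). rewrite lsl_scal, <- Rmult_minus_distr_l, Rabs_mult.
  assert (P := Rabs_pos c).
  apply Rle_lt_trans with (Rabs c * (e / (Rabs c + 1))).
  - apply Rmult_le_compat_l; lra.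
  - apply Rmult_lt_reg_r with (Rabs c + 1); [lra|]. field_simplify; [|lra]. nra.
Qed.

Lemma has_sum_ext {A} (f g : A -> R) S : (forall a, f a = g a) -> has_sum f S -> has_sum g S.
Proof. intros E. replace g with f; auto. extensionality a; auto. Qed.

Lemma has_sum_finite {A} (f : A -> R) L : NoDup L -> (forall a, ~ In a L -> f a = 0) ->
  has_sum f (lsumlist f L).
Proof.
  intros HL Hf e He. exists L. intros M HM HI.
  rewrite <- (lsl_incl_eq f L M); auto. rewrite Rminus_diag, Rabs_R0. auto.
Qed.

Lemma has_sum_lsl {A I} (f : I -> A -> R) (S : I -> R) L : (forall i, In i L -> has_sum (f i) (S i)) ->
  has_sum (fun a => lsumlist (fun i => f i a) L) (lsumlist S L).
Proof.
  induction L as [|i L IH]; intros H.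
  - intros e He. exists []. intros M _ _. rewrite lsl_zero; auto.
    simpl. rewrite Rminus_diag, Rabs_R0. auto.
  - apply (has_sum_plus (f i) (fun a => lsumlist (fun i => f i a) L)).
    + apply H; left; auto.
    + apply IH; intros; apply H; right; auto.
Qed.

(** The sum is the supremum of the finite sums: one list comes within [e] of it, and every larger
    list stays there because the terms are nonnegative. *)
Lemma has_sum_nonneg_exists {A} (f : A -> R) C : (forall a, 0 <= f a) ->
  (forall L, NoDup L -> lsumlist f L <= C) ->
  exists S, has_sum f S /\ S <= C /\ forall L, NoDup L -> lsumlist f L <= S.
Proof.
  intros Hf HC.
  destruct (completeness (fun r => exists L, NoDup L /\ r = lsumlist f L)) as [S [S1 S2]].
  - exists C. intros r [L [HL ->]]. auto.
  - exists 0, []. split; [constructor|reflexivity].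
  - exists S. split; [|split].
    + intros e He.
      assert (N : exists L, NoDup L /\ S - e < lsumlist f L).
      { apply NNPP. intros N. assert (S <= S - e); [|lra]. apply S2.
        intros r [L [HL ->]]. apply Rnot_lt_le. intros Hlt. apply N. eauto. }
      destruct N as [L [HL N]]. exists L. intros M HM HI.
      assert (lsumlist f M <= S) by (apply S1; eauto).
      assert (lsumlist f L <= lsumlist f M) by (apply lsl_incl_le; auto).
      apply Rabs_def1; lra.
    + apply S2. intros r [L [HL ->]]. auto.
    + intros L HL. apply S1. eauto.
Qed.

Lemma summable_has_sum {A} (f : A -> R) : summable f -> has_sum f (tsum f).
Proof.
  intros [C HC]. unfold tsum. apply epsilon_spec.
  (* Positive and negative parts are summed separately. *)
  destruct (has_sum_nonneg_exists (fun a => Rmax (f a) 0) C) as [S [HS _]].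
  - intros; apply Rmax_r.
  - intros L HL. eapply Rle_trans; [|apply HC; eauto]. apply lsl_le. intros a _.
    unfold Rmax, Rabs. destruct Rle_dec, Rcase_abs; lra.
  - destruct (has_sum_nonneg_exists (fun a => Rmax (- f a) 0) C) as [T [HT _]].
    + intros; apply Rmax_r.
    + intros L HL. eapply Rle_trans; [|apply HC; eauto]. apply lsl_le. intros a _.
      unfold Rmax, Rabs. destruct Rle_dec, Rcase_abs; lra.
    + exists (S + (-1) * T).
      eapply has_sum_ext; [|apply has_sum_plus; [apply HS|apply has_sum_scal, HT]].
      intros a. simpl. unfold Rmax. destruct (Rle_dec (f a) 0), (Rle_dec (- f a) 0); lra.
Qed.

Lemma tsum_ext {A} (f g : A -> R) : (forall a, f a = g a) -> tsum f = tsum g.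
Proof. intros E. f_equal. extensionality a; auto. Qed.

Lemma summable_ext {A} (f g : A -> R) : (forall a, f a = g a) -> summable f -> summable g.
Proof. intros E. replace g with f; auto. extensionality a; auto. Qed.

Lemma summable_le {A} (f g : A -> R) : (forall a, Rabs (f a) <= Rabs (g a)) -> summable g -> summable f.
Proof.
  intros E [C HC]. exists C. intros L HL. eapply Rle_trans; [|apply HC; eauto].
  apply lsl_le; auto.
Qed.

Lemma summable_plus {A} (f g : A -> R) : summable f -> summable g -> summable (fun a => f a + g a).
Proof.
  intros [C HC] [D HD]. exists (C + D). intros L HL.
  eapply Rle_trans; [apply lsl_le; intros; apply Rabs_triang|]. rewrite lsl_plus.
  apply Rplus_le_compat; auto.
Qed.

Lemma summable_scal {A} (f : A -> R) c : summable f -> summable (fun a => c * f a).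
Proof.
  intros [C HC]. exists (Rabs c * C). intros L HL.
  rewrite (lsl_ext _ (fun a => Rabs c * Rabs (f a))) by (intros; apply Rabs_mult).
  rewrite lsl_scal. apply Rmult_le_compat_l; auto. apply Rabs_pos.
Qed.

Lemma summable_minus {A} (f g : A -> R) : summable f -> summable g -> summable (fun a => f a - g a).
Proof.
  intros Hf Hg. apply summable_ext with (fun a => f a + (-1) * g a); [intros; ring|].
  apply summable_plus; auto. apply summable_scal; auto.
Qed.

Lemma summable_finite {A} (f : A -> R) L : NoDup L -> (forall a, ~ In a L -> f a = 0) -> summable f.
Proof.
  intros HL Hf. exists (lsumlist (fun a => Rabs (f a)) L). intros M HM.
  destruct (nodup_ext_list L M) as [K [K1 [K2 K3]]].
  rewrite (lsl_incl_eq _ L K); auto.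
  - apply lsl_incl_le; auto. intros; apply Rabs_pos.
  - intros a _ Ha. rewrite Hf by auto. apply Rabs_R0.
Qed.

Lemma summable_lsl {A I} (f : I -> A -> R) L : (forall i, In i L -> summable (f i)) ->
  summable (fun a => lsumlist (fun i => f i a) L).
Proof.
  induction L as [|i L IH]; intros H.
  - exists 0. intros M _. rewrite lsl_zero; [lra|]. intros; apply Rabs_R0.
  - apply (summable_plus (f i) (fun a => lsumlist (fun i => f i a) L)).
    + apply H; left; auto.
    + apply IH; intros; apply H; right; auto.
Qed.

Lemma tsum_plus {A} (f g : A -> R) : summable f -> summable g ->
  tsum (fun a => f a + g a) = tsum f + tsum g.
Proof. intros. apply has_sum_tsum_eq, has_sum_plus; apply summable_has_sum; auto. Qed.

Lemma tsum_scal {A} (f : A -> R) c : summable f -> tsum (fun a => c * f a) = c * tsum f.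
Proof. intros. apply has_sum_tsum_eq, has_sum_scal; apply summable_has_sum; auto. Qed.

Lemma tsum_minus {A} (f g : A -> R) : summable f -> summable g ->
  tsum (fun a => f a - g a) = tsum f - tsum g.
Proof.
  intros. rewrite (tsum_ext _ (fun a => f a + (-1) * g a)) by (intros; ring).
  rewrite tsum_plus, tsum_scal; auto; [ring|]. apply summable_scal; auto.
Qed.

Lemma tsum_finite {A} (f : A -> R) L : NoDup L -> (forall a, ~ In a L -> f a = 0) ->
  tsum f = lsumlist f L.
Proof. intros. apply has_sum_tsum_eq, has_sum_finite; auto. Qed.

Lemma tsum_lsl {A I} (f : I -> A -> R) L : (forall i, In i L -> summable (f i)) ->
  tsum (fun a => lsumlist (fun i => f i a) L) = lsumlist (fun i => tsum (f i)) L.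
Proof.
  intros. apply has_sum_tsum_eq.
  apply (has_sum_lsl f (fun i => tsum (f i))). intros; apply summable_has_sum; auto.
Qed.

Lemma tsum_ge_finite {A} (f : A -> R) L : summable f -> NoDup L ->
  (forall a, ~ In a L -> 0 <= f a) -> lsumlist f L <= tsum f.
Proof.
  intros Hs HL Hf. apply le_epsilon. intros e He.
  destruct (summable_has_sum f Hs e He) as [M HM].
  destruct (nodup_ext_list L M) as [K [K1 [K2 K3]]].
  specialize (HM K K1 K3). apply Rabs_def2 in HM.
  rewrite (lsl_perm f K _ (incl_split L K HL K1 K2)), lsl_app in HM.
  assert (0 <= lsumlist f (filter (notin L) K)); [|lra].
  apply lsl_nonneg. intros a Ha. apply filter_In in Ha. rewrite notin_spec in Ha. apply Hf; tauto.
Qed.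

Lemma tsum_nonneg {A} (f : A -> R) : summable f -> (forall a, 0 <= f a) -> 0 <= tsum f.
Proof. intros Hs Hf. apply (tsum_ge_finite f []); auto. constructor. Qed.

Lemma tsum_le {A} (f g : A -> R) : summable f -> summable g -> (forall a, f a <= g a) -> tsum f <= tsum g.
Proof.
  intros Hf Hg H. assert (0 <= tsum (fun a => g a - f a)).
  { apply tsum_nonneg; [apply summable_minus; auto|]. intros a; specialize (H a); lra. }
  rewrite tsum_minus in H0; auto. lra.
Qed.

Lemma tsum_le_bound {A} (f : A -> R) C : summable f ->
  (forall L, NoDup L -> lsumlist f L <= C) -> tsum f <= C.
Proof.
  intros Hs H. apply le_epsilon. intros e He.
  destruct (summable_has_sum f Hs e He) as [M HM].
  specialize (HM (nodup eqd M) (NoDup_nodup _ _) (fun x hx => proj2 (nodup_In _ _ _) hx)).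
  apply Rabs_def2 in HM. specialize (H _ (NoDup_nodup eqd M)). lra.
Qed.

Lemma summable_abs {A} (f : A -> R) : summable f -> summable (fun a => Rabs (f a)).
Proof. apply summable_le. intros a. rewrite Rabs_Rabsolu. lra. Qed.

Lemma tsum_abs {A} (f : A -> R) : summable f -> Rabs (tsum f) <= tsum (fun a => Rabs (f a)).
Proof.
  intros Hs. assert (Ha := summable_abs f Hs). apply Rabs_le. split.
  - replace (- tsum (fun a => Rabs (f a))) with ((-1) * tsum (fun a => Rabs (f a))) by ring.
    rewrite <- tsum_scal; auto. apply tsum_le; auto; [apply summable_scal; auto|].
    intros a. generalize (Rle_abs (- f a)); rewrite Rabs_Ropp; lra.
  - apply tsum_le; auto. intros; apply Rle_abs.
Qed.

Lemma lsl_map_inj {A B} (g : A -> B) (L : list A) : (forall a b, g a = g b -> a = b) ->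
  NoDup L -> NoDup (map g L).
Proof. intros Hg HL. apply FinFun.Injective_map_NoDup; auto. Qed.

Lemma preimage_list {A B} (g : A -> B) (M : list B) : (forall a b, g a = g b -> a = b) ->
  NoDup M -> exists L, NoDup L /\ forall a, In a L <-> In (g a) M.
Proof.
  intros Hg. induction M as [|b M IH]; intros HM.
  - exists []. split; [constructor|]. simpl; tauto.
  - inversion HM; subst. destruct IH as [L [L1 L2]]; auto.
    destruct (classic (exists a, g a = b)) as [[a <-]|N].
    + exists (a :: L). split.
      * constructor; auto. rewrite L2; auto.
      * intros c. simpl. rewrite L2. split; intros [E|E]; auto.
        left. rewrite E. auto.
    + exists L. split; auto. intros a. rewrite L2. simpl. split; auto.
      intros [E|E]; auto. exfalso; eauto.
Qed.

Lemma preimage_sum {A B} (g : A -> B) (f : B -> R) (M : list B) L :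
  (forall a b, g a = g b -> a = b) -> (forall b, (forall a, g a <> b) -> f b = 0) ->
  NoDup M -> NoDup L -> (forall a, In a L <-> In (g a) M) ->
  lsumlist f M = lsumlist (fun a => f (g a)) L.
Proof.
  intros Hg Hf HM HL H. rewrite <- (lsl_map g f L). symmetry. apply lsl_incl_eq; auto.
  - apply lsl_map_inj; auto.
  - intros b Hb. apply in_map_iff in Hb. destruct Hb as [a [<- Ha]]. apply H; auto.
  - intros b Hb Nb. apply Hf. intros a <-. apply Nb. apply in_map. apply H. auto.
Qed.

Lemma summable_inj {A B} (g : A -> B) (f : B -> R) : (forall a b, g a = g b -> a = b) ->
  summable f -> summable (fun a => f (g a)).
Proof.
  intros Hg [C HC]. exists C. intros L HL. rewrite <- (lsl_map g (fun b => Rabs (f b))).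
  apply HC. apply lsl_map_inj; auto.
Qed.

Lemma summable_inj_conv {A B} (g : A -> B) (f : B -> R) : (forall a b, g a = g b -> a = b) ->
  (forall b, (forall a, g a <> b) -> f b = 0) ->
  summable (fun a => f (g a)) -> summable f.
Proof.
  intros Hg Hf [C HC]. exists C. intros M HM.
  destruct (preimage_list g M Hg HM) as [L [L1 L2]].
  rewrite (preimage_sum g (fun b => Rabs (f b)) M L); auto.
  intros b Hb. rewrite Hf; auto. apply Rabs_R0.
Qed.

Lemma tsum_inj {A B} (g : A -> B) (f : B -> R) : (forall a b, g a = g b -> a = b) ->
  (forall b, (forall a, g a <> b) -> f b = 0) -> summable f ->
  tsum (fun a => f (g a)) = tsum f.
Proof.
  intros Hg Hf Hs. symmetry. apply has_sum_tsum_eq. intros e He.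
  destruct (summable_has_sum _ (summable_inj g f Hg Hs) e He) as [L HL].
  exists (map g L). intros M HM HI.
  destruct (preimage_list g M Hg HM) as [N [N1 N2]].
  rewrite (preimage_sum g f M N); auto. apply HL; auto.
  intros a Ha. apply N2, HI, in_map; auto.
Qed.

Lemma summable_bij {A B} (g : A -> B) (h : B -> A) (f : B -> R) :
  (forall a, h (g a) = a) -> (forall b, g (h b) = b) ->
  summable (fun a => f (g a)) -> summable f.
Proof.
  intros H1 H2. apply summable_inj_conv.
  - intros a b E. rewrite <- (H1 a), E; auto.
  - intros b Hb. exfalso. apply (Hb (h b)); auto.
Qed.

Lemma tsum_bij {A B} (g : A -> B) (h : B -> A) (f : B -> R) :
  (forall a, h (g a) = a) -> (forall b, g (h b) = b) -> summable f ->
  tsum (fun a => f (g a)) = tsum f.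
Proof.
  intros H1 H2. apply tsum_inj.
  - intros a b E. rewrite <- (H1 a), E; auto.
  - intros b Hb. exfalso. apply (Hb (h b)); auto.
Qed.

Lemma NoDup_list_prod {A B} (L : list A) (M : list B) : NoDup L -> NoDup M -> NoDup (list_prod L M).
Proof.
  induction L as [|a L IH]; intros HL HM; simpl; [constructor|]. inversion HL; subst.
  apply NoDup_app; auto.
  - apply FinFun.Injective_map_NoDup; auto. intros x y E; congruence.
  - intros [x y] Hx Hy. apply in_map_iff in Hx. destruct Hx as [z [E _]].
    inversion E; subst. apply in_prod_iff in Hy. tauto.
Qed.

Lemma tsum_fubini {A B} (f : A * B -> R) : summable f ->
  (forall a, summable (fun b => f (a, b))) /\
  summable (fun a => tsum (fun b => f (a, b))) /\
  tsum f = tsum (fun a => tsum (fun b => f (a, b))).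
Proof.
  intros Hs.
  assert (H1 : forall a, summable (fun b => f (a, b))).
  { intros a. apply (summable_inj (fun b => (a, b)) f); auto. congruence. }
  assert (H2 : summable (fun a => tsum (fun b => f (a, b)))).
  { destruct Hs as [C HC]. exists C. intros L HL.
    apply Rle_trans with (lsumlist (fun a => tsum (fun b => Rabs (f (a, b)))) L).
    - apply lsl_le. intros a _. apply (tsum_abs (fun b => f (a, b))); auto.
    - rewrite <- (tsum_lsl (fun a b => Rabs (f (a, b)))) by (intros; apply summable_abs; auto).
      apply tsum_le_bound.
      + apply (summable_lsl (fun a b => Rabs (f (a, b)))). intros; apply summable_abs; auto.
      + intros M HM. rewrite lsl_swap, <- (lsl_prod (fun ab => Rabs (f ab))). apply HC.
        apply NoDup_list_prod; auto. }
  split; [auto|split; [auto|]]. symmetry. apply has_sum_tsum_eq. intros e He.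
  destruct (summable_has_sum f Hs (e/2)) as [L HL]; [lra|].
  exists (map fst L). intros M HM HI.
  assert (H3 : has_sum (fun b => lsumlist (fun a => f (a, b)) M) (lsumlist (fun a => tsum (fun b => f (a, b))) M)).
  { apply (has_sum_lsl (fun a b => f (a, b)) (fun a => tsum (fun b => f (a, b)))).
    intros a _. apply summable_has_sum; auto. }
  destruct (H3 (e/2)) as [N HN]; [lra|].
  (* One rectangle [M x K] serves both limits: [K] is large enough for the finitely many inner sums
     over [M], and the rectangle contains [L]. *)
  destruct (nodup_ext_list N (map snd L)) as [K [K1 [K2 K3]]].
  specialize (HN K K1 K2). rewrite <- lsl_swap in HN. rewrite <- (lsl_prod f) in HN.
  assert (HK : Rabs (lsumlist f (list_prod M K) - tsum f) < e/2).
  { apply HL; [apply NoDup_list_prod; auto|]. intros [a b] Hab. apply in_prod.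
    - apply HI. apply (in_map fst) in Hab. auto.
    - apply K3. apply (in_map snd) in Hab. auto. }
  apply Rabs_def2 in HN. apply Rabs_def2 in HK. apply Rabs_def1; lra.
Qed.

(** Tonelli: a finite list of pairs lies in the product of its two projections, where the iterated
    sums bound it. *)
Lemma summable_sigma {A B} (f : A * B -> R) :
  (forall a, summable (fun b => f (a, b))) ->
  summable (fun a => tsum (fun b => Rabs (f (a, b)))) -> summable f.
Proof.
  intros H1 [C HC]. exists C. intros L HL.
  destruct (nodup_ext_list (map fst L) []) as [M [M1 [M2 _]]].
  destruct (nodup_ext_list (map snd L) []) as [N [N1 [N2 _]]].
  apply Rle_trans with (lsumlist (fun ab => Rabs (f ab)) (list_prod M N)).
  - apply lsl_incl_le; auto; [apply NoDup_list_prod; auto| |intros; apply Rabs_pos].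
    intros [a b] Hab. apply in_prod; [apply M2, (in_map fst L (a,b))|apply N2, (in_map snd L (a,b))]; auto.
  - rewrite lsl_prod. eapply Rle_trans; [|apply (HC M M1)]. apply lsl_le. intros a _.
    eapply Rle_trans; [|apply Rle_abs].
    apply (tsum_ge_finite (fun b => Rabs (f (a, b)))); auto; [apply summable_abs; auto|].
    intros; apply Rabs_pos.
Qed.

Lemma summable_prod {A B} (f : A -> R) (g : B -> R) : summable f -> summable g ->
  summable (fun ab : A * B => f (fst ab) * g (snd ab)).
Proof.
  intros Hf Hg. apply summable_sigma; simpl.
  - intros a. apply summable_scal; auto.
  - apply summable_ext with (fun a => tsum (fun b => Rabs (g b)) * Rabs (f a)).
    + intros a. symmetry. rewrite (tsum_ext _ (fun b => Rabs (f a) * Rabs (g b))) by (intros; apply Rabs_mult).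
      rewrite tsum_scal by (apply summable_abs; auto). ring.
    + apply summable_scal, summable_abs; auto.
Qed.

(** * Exhaustion of [Z^2] by boxes *)

Lemma in_zr n z : In z (zr n) <-> (- Z.of_nat n <= z <= Z.of_nat n)%Z.
Proof.
  unfold zr. rewrite in_map_iff. split.
  - intros [k [<- Hk]]. apply in_seq in Hk. lia.
  - intros Hz. exists (Z.to_nat (z + Z.of_nat n)). rewrite in_seq. lia.
Qed.

Lemma NoDup_zr n : NoDup (zr n).
Proof. unfold zr. apply lsl_map_inj; [intros; lia|apply seq_NoDup]. Qed.

Lemma in_box n x : In x (box n) <->
  (- Z.of_nat n <= fst x <= Z.of_nat n)%Z /\ (- Z.of_nat n <= snd x <= Z.of_nat n)%Z.
Proof.
  destruct x as [a b]. unfold box. etransitivity; [apply in_prod_iff|].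
  rewrite !in_zr. reflexivity.
Qed.

Lemma NoDup_box n : NoDup (box n).
Proof. apply NoDup_list_prod; apply NoDup_zr. Qed.

Lemma box_exhausts (L : list site) : exists N, forall n, (N <= n)%nat -> incl L (box n).
Proof.
  induction L as [|x L [N HN]].
  - exists O. intros n _ y [].
  - exists (N + Z.to_nat (Z.abs (fst x)) + Z.to_nat (Z.abs (snd x)))%nat.
    intros n Hn y [<-|Hy]; [apply in_box; lia|]. apply (HN n); auto. lia.
Qed.

Lemma zr_exhausts (L : list Z) : exists N, forall n, (N <= n)%nat -> incl L (zr n).
Proof.
  induction L as [|x L [N HN]].
  - exists O. intros n _ y [].
  - exists (N + Z.to_nat (Z.abs x))%nat.
    intros n Hn y [<-|Hy]; [apply in_zr; lia|]. apply (HN n); auto. lia.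
Qed.

(** Boxes eventually contain every finite list, so the box limits of the definitions may be handled
    as unordered sums. *)
Lemma lsum_tsum (f : site -> R) : summable f -> lsum f = tsum f.
Proof.
  intros Hs. unfold lsum. replace (Lim_seq _) with (Finite (tsum f)); auto.
  symmetry. apply is_lim_seq_unique. apply is_lim_seq_spec. intros e.
  destruct (summable_has_sum f Hs e (cond_pos e)) as [L HL].
  destruct (box_exhausts L) as [N HN]. exists N. intros n Hn. apply HL; [apply NoDup_box|auto].
Qed.

Lemma tsum_lim_zr (f : Z -> R) : summable f -> is_lim_seq (fun n => lsumlist f (zr n)) (tsum f).
Proof.
  intros Hs. apply is_lim_seq_spec. intros e.
  destruct (summable_has_sum f Hs e (cond_pos e)) as [L HL].
  destruct (zr_exhausts L) as [N HN]. exists N. intros n Hn. apply HL; [apply NoDup_zr|auto].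
Qed.

(** * Positive semidefinite kernels *)

Definition psd {I : Type} (M : I -> I -> R) : Prop :=
  forall (L : list I) (c : I -> R),
    0 <= lsumlist (fun i => lsumlist (fun j => c i * c j * M i j) L) L.

(** An explicit finite factorization. Unlike [psd] it is visibly stable under entrywise products, so
    the Schur product theorem needs no spectral decomposition; it is lost only in limits, where
    [psd] takes over. *)
Definition gram {I : Type} (M : I -> I -> R) : Prop :=
  exists F : list (I -> R), forall i j, M i j = lsumlist (fun f => f i * f j) F.

Lemma lsl_mult {A B} (f : A -> R) (g : B -> R) L M :
  lsumlist f L * lsumlist g M = lsumlist (fun a => lsumlist (fun b => f a * g b) M) L.
Proof.
  symmetry. transitivity (lsumlist (fun a => lsumlist g M * f a) L).
  - apply lsl_ext. intros a _. rewrite lsl_scal. apply Rmult_comm.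
  - rewrite lsl_scal. apply Rmult_comm.
Qed.

Lemma gram_psd {I} (M : I -> I -> R) : gram M -> psd M.
Proof.
  intros [F HF] L c.
  rewrite (lsl_ext _ (fun i => lsumlist (fun f => lsumlist (fun j => (c i * f i) * (c j * f j)) L) F)).
  - rewrite lsl_swap. apply lsl_nonneg. intros f _. rewrite <- lsl_mult. apply Rle_0_sqr.
  - intros i _. rewrite <- lsl_swap. apply lsl_ext. intros j _. rewrite HF, <- lsl_scal.
    apply lsl_ext. intros; ring.
Qed.

Lemma gram_ext {I} (M N : I -> I -> R) : (forall i j, M i j = N i j) -> gram M -> gram N.
Proof. intros E [F HF]. exists F. intros. rewrite <- E. auto. Qed.

Lemma gram_rank1 {I} (f : I -> R) : gram (fun i j => f i * f j).
Proof. exists [f]. intros. simpl. ring. Qed.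

Lemma gram_plus {I} (M N : I -> I -> R) : gram M -> gram N -> gram (fun i j => M i j + N i j).
Proof.
  intros [F HF] [G HG]. exists (F ++ G). intros. rewrite lsl_app, HF, HG. auto.
Qed.

Lemma gram_scal {I} (c : R) (M : I -> I -> R) : 0 <= c -> gram M -> gram (fun i j => c * M i j).
Proof.
  intros Hc [F HF]. exists (map (fun f i => sqrt c * f i) F). intros.
  rewrite lsl_map, HF, <- lsl_scal. apply lsl_ext. intros f _.
  rewrite <- (sqrt_sqrt c Hc) at 1. ring.
Qed.

(** The features of the product are the products of a feature of [M] and a feature of [N]. *)
Lemma gram_mult {I} (M N : I -> I -> R) : gram M -> gram N -> gram (fun i j => M i j * N i j).
Proof.
  intros [F HF] [G HG]. exists (map (fun fg i => fst fg i * snd fg i) (list_prod F G)). intros.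
  rewrite lsl_map, lsl_prod, HF, HG, lsl_mult.
  apply lsl_ext. intros f _. apply lsl_ext. intros g _. simpl. ring.
Qed.

Lemma gram_pow {I} (M : I -> I -> R) n : gram M -> gram (fun i j => M i j ^ n).
Proof.
  intros H. induction n; simpl.
  - apply gram_ext with (fun i j : I => 1 * 1); [intros; ring|]. apply (gram_rank1 (fun _ => 1)).
  - apply gram_mult; auto.
Qed.

Lemma is_lim_seq_lsl {A} (f : nat -> A -> R) (g : A -> R) L :
  (forall a, In a L -> is_lim_seq (fun n => f n a) (g a)) ->
  is_lim_seq (fun n => lsumlist (f n) L) (lsumlist g L).
Proof.
  induction L as [|a L IH]; intros H; simpl.
  - apply is_lim_seq_const.
  - apply is_lim_seq_plus'; [apply H; left; auto|]. apply IH. intros; apply H; right; auto.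
Qed.

Lemma psd_lim {I} (M : nat -> I -> I -> R) (N : I -> I -> R) :
  (forall n, psd (M n)) -> (forall i j, is_lim_seq (fun n => M n i j) (N i j)) -> psd N.
Proof.
  intros HM HN L c.
  assert (H : is_lim_seq (fun n => lsumlist (fun i => lsumlist (fun j => c i * c j * M n i j) L) L)
    (lsumlist (fun i => lsumlist (fun j => c i * c j * N i j) L) L)).
  { apply (is_lim_seq_lsl (fun n i => lsumlist (fun j => c i * c j * M n i j) L)). intros i _.
    apply (is_lim_seq_lsl (fun n j => c i * c j * M n i j)). intros j _.
    apply (is_lim_seq_scal_l (fun n => M n i j) (c i * c j) (N i j)), HN. }
  apply (is_lim_seq_le (fun _ => 0) _ 0 _ (fun n => HM n L c) (is_lim_seq_const 0) H).
Qed.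

(** Partial sums of the exponential series are positive combinations of entrywise powers, hence Gram
    kernels; only the limit leaves that class. *)
Lemma gram_exp {I} (M : I -> I -> R) : gram M -> psd (fun i j => exp (M i j)).
Proof.
  intros H.
  apply psd_lim with (fun n i j => sum_n (fun k => scal (pow_n (M i j) k) (/ INR (fact k))) n).
  - intros n. apply gram_psd.
    assert (T : forall k, gram (fun i j => scal (pow_n (M i j) k) (/ INR (fact k)))).
    { intros k. apply gram_ext with (fun i j => / INR (fact k) * M i j ^ k).
      - intros. rewrite <- (pow_n_pow (M i j) k). apply Rmult_comm.
      - apply gram_scal, gram_pow; auto. left. apply Rinv_0_lt_compat, INR_fact_lt_0. }
    induction n.
    + apply gram_ext with (2 := T 0%nat). intros. rewrite sum_O. auto.
    + apply gram_ext with (2 := gram_plus _ _ IHn (T (S n))). intros. rewrite sum_Sn. auto.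
  - intros i j. apply (is_exp_Reals (M i j)).
Qed.

(** The exponential is taken before the limit: [N] itself need not be a Gram kernel, whereas
    [gram_exp] applies to every [M n]. *)
Lemma psd_exp_lim {I} (M : nat -> I -> I -> R) (N : I -> I -> R) :
  (forall n, gram (M n)) -> (forall i j, is_lim_seq (fun n => M n i j) (N i j)) ->
  psd (fun i j => exp (N i j)).
Proof.
  intros HM HN. apply psd_lim with (fun n i j => exp (M n i j)).
  - intros n. apply gram_exp; auto.
  - intros i j. apply is_lim_seq_continuous; auto. apply derivable_continuous_pt, derivable_pt_exp.
Qed.

(** * The logarithmic series in the unit disc *)

(* Real and imaginary parts of [(a + i b)^n]. *)
Fixpoint cpw (a b : R) (n : nat) : R * R :=
  match n with
  | O => (1, 0)
  | S n => (a * fst (cpw a b n) - b * snd (cpw a b n), a * snd (cpw a b n) + b * fst (cpw a b n))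
  end.

(** The powers of [z conj w] are [z^n conj (w^n)]; their real part is therefore a sum of two
    rank-one kernels in [z] and [w]. *)
Lemma cpw_conj_mult a b c d n :
  fst (cpw (a * c + b * d) (b * c - a * d) n) =
    fst (cpw a b n) * fst (cpw c d n) + snd (cpw a b n) * snd (cpw c d n) /\
  snd (cpw (a * c + b * d) (b * c - a * d) n) =
    snd (cpw a b n) * fst (cpw c d n) - fst (cpw a b n) * snd (cpw c d n).
Proof.
  induction n as [|n [IH1 IH2]]; simpl; [split; ring|]. rewrite IH1, IH2. split; ring.
Qed.

Lemma cpw_norm a b n : fst (cpw a b n) ^ 2 + snd (cpw a b n) ^ 2 = (a ^ 2 + b ^ 2) ^ n.
Proof.
  induction n as [|n IH]; [simpl; ring|].
  change ((a ^ 2 + b ^ 2) ^ S n) with ((a ^ 2 + b ^ 2) * (a ^ 2 + b ^ 2) ^ n). rewrite <- IH. simpl. ring.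
Qed.

(** With [z = a + i b], the partial sums of [Re (sum_n (r z)^n / n) = - ln |1 - r z|]. Only [r = 1]
    is wanted; the variable [r] allows a comparison by differentiation. *)
Definition log_part (a b : R) (N : nat) (r : R) : R :=
  sum_n (fun k => fst (cpw a b (S k)) * (r ^ S k / INR (S k))) N.

Lemma log_part_derive a b N r :
  is_derive (log_part a b N) r (sum_n (fun k => fst (cpw a b (S k)) * r ^ k) N).
Proof.
  unfold log_part. apply (is_derive_sum_n (fun k r => fst (cpw a b (S k)) * (r ^ S k / INR (S k)))). intros k _.
  evar_last.
  - apply is_derive_scal. apply (is_derive_ext (fun r => / INR (S k) * r ^ S k)); [intros; unfold Rdiv; apply Rmult_comm|].
    apply is_derive_scal. apply is_derive_pow. apply is_derive_id.
  - unfold one; simpl Nat.pred. assert (INR (S k) <> 0) by (apply not_0_INR; lia).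
    change (fst (cpw a b (S k)) * (/ INR (S k) * (INR (S k) * 1 * r ^ k)) = fst (cpw a b (S k)) * r ^ k).
    field. auto.
Qed.

(** The geometric series: [|1 - r z|^2] times [sum_k z^(k+1) r^k] is [z conj (1 - r z)] minus
    [r^(N+1) z^(N+2) conj (1 - r z)], and the real parts are taken. *)
Lemma log_part_remainder a b r N :
  (a - r * (a ^ 2 + b ^ 2)) - ((1 - r * a) ^ 2 + (r * b) ^ 2) * sum_n (fun k => fst (cpw a b (S k)) * r ^ k) N
  = r ^ S N * (fst (cpw a b (S (S N))) - r * (a ^ 2 + b ^ 2) * fst (cpw a b (S N))).
Proof.
  induction N as [|N IH].
  - rewrite sum_O. simpl. ring.
  - rewrite sum_Sn. set (X := sum_n _ N) in *.
    change (a - r * (a ^ 2 + b ^ 2) - ((1 - r * a) ^ 2 + (r * b) ^ 2) * (X + fst (cpw a b (S (S N))) * r ^ S N) =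
      r ^ S (S N) * (fst (cpw a b (S (S (S N)))) - r * (a ^ 2 + b ^ 2) * fst (cpw a b (S (S N))))).
    transitivity (a - r * (a ^ 2 + b ^ 2) - ((1 - r * a) ^ 2 + (r * b) ^ 2) * X -
      ((1 - r * a) ^ 2 + (r * b) ^ 2) * (fst (cpw a b (S (S N))) * r ^ S N)); [ring|].
    rewrite IH. simpl. ring.
Qed.

Lemma cpw_abs a b n : Rabs (fst (cpw a b n)) <= sqrt (a ^ 2 + b ^ 2) ^ n.
Proof.
  assert (P : 0 <= a ^ 2 + b ^ 2) by nra.
  assert (Q : 0 <= sqrt (a ^ 2 + b ^ 2) ^ n) by (apply pow_le, sqrt_pos).
  rewrite <- (Rabs_pos_eq (sqrt (a ^ 2 + b ^ 2) ^ n)) by auto.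
  apply Rsqr_le_abs_0. unfold Rsqr. rewrite <- Rpow_mult_distr, sqrt_sqrt by auto.
  rewrite <- cpw_norm. generalize (pow2_ge_0 (snd (cpw a b n))). nra.
Qed.

Lemma log_series a b : a ^ 2 + b ^ 2 < 1 ->
  is_lim_seq (fun N => log_part a b N 1) (- / 2 * ln ((1 - a) ^ 2 + b ^ 2)).
Proof.
  intros H. set (rho := sqrt (a ^ 2 + b ^ 2)).
  assert (P : 0 <= a ^ 2 + b ^ 2) by nra.
  assert (R0 : 0 <= rho) by apply sqrt_pos.
  assert (R2 : rho * rho = a ^ 2 + b ^ 2) by (apply sqrt_sqrt; auto).
  assert (R1 : rho < 1) by (apply Rsqr_incrst_0; unfold Rsqr; lra).
  assert (HA : a <= rho) by (apply Rsqr_incr_0_var; unfold Rsqr; nra).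
  assert (Hpos : forall r, 0 <= r <= 1 -> (1 - rho) ^ 2 <= (1 - r * a) ^ 2 + (r * b) ^ 2).
  { intros r Hr. assert (1 - rho <= 1 - r * a) by nra. nra. }
  assert (Hq : 0 < (1 - rho) ^ 2) by nra.
  assert (B : forall N, Rabs (- / 2 * ln ((1 - a) ^ 2 + b ^ 2) - log_part a b N 1) <= 2 / (1 - rho) ^ 2 * rho ^ N).
  { intros N.
    (* The error vanishes at [r = 0], and its derivative is the geometric remainder divided by
       [|1 - r z|^2]; the mean value theorem on [[0, 1]] bounds it by a multiple of [rho^N]. *)
    pose (F := fun r => - / 2 * ln ((1 - r * a) ^ 2 + (r * b) ^ 2) - log_part a b N r).
    pose (F' := fun r => (a - r * (a ^ 2 + b ^ 2)) / ((1 - r * a) ^ 2 + (r * b) ^ 2) - sum_n (fun k => fst (cpw a b (S k)) * r ^ k) N).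
    destruct (MVT_gen F 0 1 F') as [c [Hc E]].
    - intros r Hr. unfold F, F'. rewrite Rmin_left, Rmax_right in Hr by lra.
      apply @is_derive_minus; [|apply log_part_derive].
      specialize (Hpos r ltac:(lra)). auto_derive; [lra|]. field. simpl in Hpos. lra.
    - intros r Hr. rewrite Rmin_left, Rmax_right in Hr by lra.
      apply continuity_pt_filterlim. apply (ex_derive_continuous F). exists (F' r).
      unfold F, F'.
      apply @is_derive_minus; [|apply log_part_derive].
      specialize (Hpos r ltac:(lra)). auto_derive; [lra|]. field. simpl in Hpos. lra.
    - rewrite Rmin_left, Rmax_right in Hc by lra.
      assert (E0 : F 0 = 0).
      { unfold F. replace ((1 - 0 * a) ^ 2 + (0 * b) ^ 2) with 1 by ring. rewrite ln_1.
        unfold log_part. rewrite (sum_n_ext _ (fun _ => 0)); [|intros; simpl; unfold Rdiv; ring].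
        rewrite sum_n_const. ring. }
      assert (E1 : F 1 = - / 2 * ln ((1 - a) ^ 2 + b ^ 2) - log_part a b N 1).
      { unfold F. rewrite !Rmult_1_l. auto. }
      rewrite <- E1. replace (F 1) with (F' c) by lra.
      specialize (Hpos c ltac:(lra)).
      set (D := (1 - c * a) ^ 2 + (c * b) ^ 2) in *.
      assert (EF : F' c = c ^ S N * (fst (cpw a b (S (S N))) - c * (a ^ 2 + b ^ 2) * fst (cpw a b (S N))) / D).
      { rewrite <- log_part_remainder. unfold F'. fold D. field. lra. }
      rewrite EF. unfold Rdiv. rewrite Rabs_mult, (Rabs_pos_eq (/ D)) by (left; apply Rinv_0_lt_compat; lra).
      assert (ID : / D <= / (1 - rho) ^ 2) by (apply Rinv_le_contravar; lra).
      assert (ID0 : 0 < / D) by (apply Rinv_0_lt_compat; lra).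
      assert (C1 : 0 <= c ^ S N <= 1) by (split; [apply pow_le; lra|rewrite <- (pow1 (S N)); apply pow_incr; lra]).
      assert (X1 := cpw_abs a b (S (S N))). assert (X2 := cpw_abs a b (S N)). fold rho in X1, X2.
      assert (RN : 0 <= rho ^ N) by (apply pow_le; auto).
      assert (Y1 : rho ^ S N <= rho ^ N) by (simpl; nra).
      assert (Y2 : rho ^ S (S N) <= rho ^ N) by (simpl in *; nra).
      assert (Z : Rabs (fst (cpw a b (S (S N))) - c * (a ^ 2 + b ^ 2) * fst (cpw a b (S N))) <= 2 * rho ^ N).
      { unfold Rminus. eapply Rle_trans; [apply Rabs_triang|]. rewrite Rabs_Ropp, Rabs_mult.
        rewrite (Rabs_pos_eq (c * (a ^ 2 + b ^ 2))) by nra.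
        assert (c * (a ^ 2 + b ^ 2) <= 1) by nra. assert (0 <= c * (a ^ 2 + b ^ 2)) by nra.
        assert (HX := Rabs_pos (fst (cpw a b (S N)))). nra. }
      rewrite Rabs_mult, (Rabs_pos_eq (c ^ S N)) by lra.
      replace (2 * / (1 - rho) ^ 2 * rho ^ N) with (1 * (2 * rho ^ N) * / (1 - rho) ^ 2) by ring.
      apply Rmult_le_compat; try lra.
      + apply Rmult_le_pos; [lra|apply Rabs_pos].
      + apply Rmult_le_compat; try lra. apply Rabs_pos. }
  apply is_lim_seq_ext with (fun N => - / 2 * ln ((1 - a) ^ 2 + b ^ 2) - (- / 2 * ln ((1 - a) ^ 2 + b ^ 2) - log_part a b N 1)); [intros; ring|].
  replace (Finite (- / 2 * ln ((1 - a) ^ 2 + b ^ 2))) with (Finite (- / 2 * ln ((1 - a) ^ 2 + b ^ 2) - 0)) by (f_equal; ring).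
  apply is_lim_seq_minus'; [apply is_lim_seq_const|].
  apply is_lim_seq_abs_0.
  apply is_lim_seq_le_le with (fun _ => 0) (fun N => 2 / (1 - rho) ^ 2 * rho ^ N).
  - intros n. split; [apply Rabs_pos|apply B].
  - apply is_lim_seq_const.
  - replace (Finite 0) with (Rbar_mult (2 / (1 - rho) ^ 2) 0) by (simpl; f_equal; ring).
    apply is_lim_seq_scal_l, is_lim_seq_geom. rewrite Rabs_pos_eq; auto.
Qed.

Lemma log_part_gram {I} (a b : I -> R) N :
  gram (fun i j => log_part (a i * a j + b i * b j) (b i * a j - a i * b j) N 1).
Proof.
  unfold log_part.
  assert (T : forall k, gram (fun i j => fst (cpw (a i * a j + b i * b j) (b i * a j - a i * b j) (S k)) * (1 ^ S k / INR (S k)))).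
  { intros k. apply gram_ext with (fun i j => (1 ^ S k / INR (S k)) *
      (fst (cpw (a i) (b i) (S k)) * fst (cpw (a j) (b j) (S k)) + snd (cpw (a i) (b i) (S k)) * snd (cpw (a j) (b j) (S k)))).
    - intros. destruct (cpw_conj_mult (a i) (b i) (a j) (b j) (S k)) as [-> _]. ring.
    - apply gram_scal.
      + rewrite pow1. left. apply Rdiv_lt_0_compat; [lra|]. apply lt_0_INR; lia.
      + apply gram_plus; [apply (gram_rank1 (fun i => fst (cpw (a i) (b i) (S k))))|apply (gram_rank1 (fun i => snd (cpw (a i) (b i) (S k))))]. }
  induction N.
  - apply gram_ext with (2 := T 0%nat). intros. rewrite sum_O. auto.
  - apply gram_ext with (2 := gram_plus _ _ IHN (T (S N))). intros. rewrite sum_Sn. auto.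
Qed.

(* The Cayley transform [zeta = (z - 1) / (z + 1)] of the half plane turns [z + conj w] into
   [(z + 1) (conj w + 1) (1 - zeta conj omega) / 2], and [- ln |1 - zeta conj omega|^2] is a
   positive combination of the kernels [Re (zeta^n conj omega^n)]. *)
Lemma halfplane_psd {I} (x y : I -> R) (al : R) : 0 <= al -> (forall i, 0 < x i) ->
  psd (fun i j => / Rpower ((x i + x j) ^ 2 + (y i - y j) ^ 2) al).
Proof.
  intros Hal Hx.
  set (n := fun i => (x i + 1) ^ 2 + y i ^ 2).
  assert (Hn : forall i, 0 < n i) by (intros i; unfold n; specialize (Hx i); nra).
  set (a := fun i => (x i ^ 2 + y i ^ 2 - 1) / n i).
  set (b := fun i => 2 * y i / n i).
  (* [1 - |zeta|^2 = 4 Re z / |z + 1|^2] places the transformed points in the open disc, where the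
     logarithmic series converges. *)
  assert (Hab : forall i, 1 - (a i ^ 2 + b i ^ 2) = 4 * x i / n i).
  { intros i. unfold a, b. field_simplify_eq; [|specialize (Hn i); lra]. unfold n. ring. }
  assert (K : psd (fun i j => exp (al * (2 * (- / 2 * ln ((1 - (a i * a j + b i * b j)) ^ 2 + (b i * a j - a i * b j) ^ 2)))))).
  { apply psd_exp_lim with (fun N i j => al * (2 * log_part (a i * a j + b i * b j) (b i * a j - a i * b j) N 1)).
    - intros N. apply gram_scal; auto. apply gram_scal; [lra|]. apply log_part_gram.
    - intros i j.
      apply (is_lim_seq_scal_l _ al (Finite _)). apply (is_lim_seq_scal_l _ 2 (Finite _)). apply log_series.
      replace ((a i * a j + b i * b j) ^ 2 + (b i * a j - a i * b j) ^ 2) with ((a i ^ 2 + b i ^ 2) * (a j ^ 2 + b j ^ 2)) by ring.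
      assert (A1 := Hab i). assert (A2 := Hab j).
      assert (0 < 4 * x i / n i) by (apply Rdiv_lt_0_compat; auto; specialize (Hx i); lra).
      assert (0 < 4 * x j / n j) by (apply Rdiv_lt_0_compat; auto; specialize (Hx j); lra).
      assert (0 <= a i ^ 2 + b i ^ 2) by nra. assert (0 <= a j ^ 2 + b j ^ 2) by nra. nra. }
  intros L c.
  (* The factors [|z + 1|] and [|w + 1|] involve one index each and are absorbed in the
     coefficients, together with a factor [2^al] for each index. *)
  specialize (K L (fun i => c i * exp (- al * (ln (n i) - ln 2)))). eapply Rle_trans; [exact K|].
  right. apply lsl_ext; intros i _. apply lsl_ext; intros j _.
  assert (E : (1 - (a i * a j + b i * b j)) ^ 2 + (b i * a j - a i * b j) ^ 2 =
     4 * ((x i + x j) ^ 2 + (y i - y j) ^ 2) / (n i * n j)).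
  { unfold a, b. assert (H1 := Hn i). assert (H2 := Hn j). field_simplify_eq; [|split; lra]. unfold n. ring. }
  rewrite E. unfold Rpower. rewrite <- exp_Ropp.
  assert (Hs : 0 < (x i + x j) ^ 2 + (y i - y j) ^ 2) by
    (apply Rplus_lt_le_0_compat; [apply pow_lt; assert (H1 := Hx i); assert (H2 := Hx j); lra|apply pow2_ge_0]).
  assert (H1 := Hn i). assert (H2 := Hn j).
  rewrite ln_div; [|lra|nra]. rewrite (ln_mult 4), (ln_mult (n i)) by auto || lra.
  replace 4 with (2 * 2) by ring. rewrite (ln_mult 2 2) by lra.
  transitivity (c i * c j * (exp (- al * (ln (n i) - ln 2)) * exp (- al * (ln (n j) - ln 2)) *
    exp (al * (2 * (- / 2 * (ln 2 + ln 2 + ln ((x i + x j) ^ 2 + (y i - y j) ^ 2) - (ln (n i) + ln (n j)))))))); [ring|].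
  rewrite <- !exp_plus. f_equal. f_equal. field.
Qed.

(** * Sums over intervals of integers *)

Lemma lsl_zr_S (f : Z -> R) n :
  lsumlist f (zr (S n)) = lsumlist f (zr n) + f (Z.of_nat (S n)) + f (- Z.of_nat (S n))%Z.
Proof.
  rewrite (lsl_perm f _ (Z.of_nat (S n) :: (- Z.of_nat (S n))%Z :: zr n)).
  - simpl lsumlist. unfold lsumlist; simpl. ring.
  - apply NoDup_Permutation.
    + apply NoDup_zr.
    + constructor; [|constructor].
      * intros [E|E]; [lia|]. apply in_zr in E. lia.
      * intros E. apply in_zr in E. lia.
      * apply NoDup_zr.
    + intros x. split.
      * intros Hx. apply in_zr in Hx.
        destruct (Z.eq_dec x (Z.of_nat (S n))); [left; auto|].
        destruct (Z.eq_dec x (- Z.of_nat (S n))); [right; left; auto|].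
        right; right. apply in_zr. lia.
      * intros [<-|[<-|Hx]]; [| |apply in_zr in Hx]; apply in_zr; lia.
Qed.

Lemma lsl_zr_0 (f : Z -> R) : lsumlist f (zr 0) = f 0%Z.
Proof. unfold zr, lsumlist; simpl. ring. Qed.

Lemma lsl_seq_S (f : nat -> R) n : lsumlist f (seq 0 (S n)) = lsumlist f (seq 0 n) + f n.
Proof. rewrite seq_S, lsl_app. unfold lsumlist; simpl. ring. Qed.

Lemma seq_exhausts (L : list nat) : exists N, forall n, (N <= n)%nat -> incl L (seq 0 n).
Proof.
  induction L as [|x L [N HN]].
  - exists O. intros n _ y [].
  - exists (N + S x)%nat. intros n Hn y [<-|Hy]; [apply in_seq; lia|]. apply (HN n); auto; lia.
Qed.

Lemma summable_seq (f : nat -> R) C : (forall n, lsumlist (fun z => Rabs (f z)) (seq 0 n) <= C) -> summable f.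
Proof.
  intros H. exists C. intros L HL. destruct (seq_exhausts L) as [N HN].
  eapply Rle_trans; [|apply (H N)]. apply lsl_incl_le; auto; [apply seq_NoDup|intros; apply Rabs_pos].
Qed.

Lemma sum_Z_split (f : Z -> R) :
  summable (fun n => f (Z.of_nat n)) -> summable (fun n => f (- Z.of_nat (S n))%Z) ->
  summable f /\ tsum f = tsum (fun n => f (Z.of_nat n)) + tsum (fun n => f (- Z.of_nat (S n))%Z).
Proof.
  intros H1 H2.
  set (f1 := fun z => if Z.leb 0 z then f z else 0).
  set (f2 := fun z => if Z.leb 0 z then 0 else f z).
  assert (E1 : forall n, f (Z.of_nat n) = f1 (Z.of_nat n)).
  { intros n. unfold f1. destruct (Z.leb_spec 0 (Z.of_nat n)); auto; lia. }
  assert (E2 : forall n, f (- Z.of_nat (S n))%Z = f2 (- Z.of_nat (S n))%Z).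
  { intros n. unfold f2. destruct (Z.leb_spec 0 (- Z.of_nat (S n))); auto; lia. }
  assert (I1 : forall a b, Z.of_nat a = Z.of_nat b -> a = b) by (intros; lia).
  assert (I2 : forall a b, (- Z.of_nat (S a) = - Z.of_nat (S b))%Z -> a = b) by (intros; lia).
  assert (J1 : forall b, (forall a, Z.of_nat a <> b) -> f1 b = 0).
  { intros b Hb. unfold f1. destruct (Z.leb_spec 0 b); auto. exfalso. apply (Hb (Z.to_nat b)). lia. }
  assert (J2 : forall b, (forall a, (- Z.of_nat (S a))%Z <> b) -> f2 b = 0).
  { intros b Hb. unfold f2. destruct (Z.leb_spec 0 b); auto. exfalso. apply (Hb (Z.to_nat (-b-1))). lia. }
  assert (S1 : summable f1).
  { apply (summable_inj_conv Z.of_nat); auto. eapply summable_ext; [apply E1|auto]. }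
  assert (S2 : summable f2).
  { apply (summable_inj_conv (fun n => - Z.of_nat (S n))%Z); auto. }
  assert (E : forall z, f1 z + f2 z = f z).
  { intros z. unfold f1, f2. destruct (Z.leb 0 z); ring. }
  split.
  - eapply summable_ext; [apply E|]. apply summable_plus; auto.
  - rewrite <- (tsum_ext _ _ E), (tsum_plus f1 f2 S1 S2). f_equal.
    + rewrite (tsum_ext _ _ E1). symmetry. apply tsum_inj; auto.
    + rewrite (tsum_ext _ _ E2). symmetry. apply (tsum_inj (fun n => - Z.of_nat (S n))%Z); auto.
Qed.

(** * The long range kernel *)

Definition w (p : R) (d : site) : R :=
  if site_eqb d (0, 0)%Z then 0
  else / Rpower (IZR (fst d * fst d + snd d * snd d)) (p / 2).

(* Interaction of a site with the column at distance [n]. *)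
Definition K (p : R) (n : nat) : R := tsum (fun m : Z => w p (Z.of_nat n, m)).

Lemma site_eqb_spec x y : site_eqb x y = true <-> x = y.
Proof.
  destruct x as [a b], y as [c d]. unfold site_eqb. simpl. rewrite Bool.andb_true_iff, !Z.eqb_eq.
  split; [intros [-> ->]; auto|intros E; inversion E; auto].
Qed.

Lemma site_eqb_neq x y : site_eqb x y = false <-> x <> y.
Proof.
  rewrite <- Bool.not_true_iff_false, site_eqb_spec. tauto.
Qed.

Lemma Rpower_pos x y : 0 < Rpower x y.
Proof. apply exp_pos. Qed.

Lemma w_nonneg p d : 0 <= w p d.
Proof. unfold w. destruct site_eqb; [lra|]. left. apply Rinv_0_lt_compat, Rpower_pos. Qed.

Lemma w_swap p a b : w p (a, b) = w p (b, a).
Proof.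
  unfold w, site_eqb; simpl. rewrite Bool.andb_comm. destruct andb; auto.
  f_equal. f_equal. f_equal. lia.
Qed.

Lemma w_opp_l p a b : w p (- a, b)%Z = w p (a, b).
Proof.
  unfold w, site_eqb; simpl. replace (- a =? 0)%Z with (a =? 0)%Z.
  - destruct andb; auto. f_equal. f_equal. f_equal. lia.
  - destruct (Z.eqb_spec a 0), (Z.eqb_spec (-a) 0); auto; lia.
Qed.

Lemma w_opp_r p a b : w p (a, - b)%Z = w p (a, b).
Proof. rewrite w_swap, w_opp_l, w_swap. auto. Qed.

Lemma Rpower_opp_le x y c : 0 <= c -> 0 < x <= y -> Rpower y (- c) <= Rpower x (- c).
Proof.
  intros Hc Hxy. rewrite !Rpower_Ropp. apply Rinv_le_contravar; [apply Rpower_pos|].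
  apply Rle_Rpower_l; auto.
Qed.

(** The exponent is split as [- p/2 = - (p/2 - 1) - 1]. The first factor is largest at [m = 0]; the
    second keeps the decay in [m] and can be summed by hand. *)
Lemma w_bound p n m : 2 <= p -> (0 < n)%nat ->
  w p (Z.of_nat n, m) <= Rpower (INR n) (2 - p) * / (INR n ^ 2 + IZR m ^ 2).
Proof.
  intros Hp Hn. assert (Hn' : 0 < INR n) by (apply lt_0_INR; auto).
  unfold w. destruct site_eqb eqn:E.
  { apply site_eqb_spec in E. inversion E. lia. }
  simpl fst; simpl snd.
  rewrite plus_IZR, !mult_IZR, <- INR_IZR_INZ.
  replace (INR n * INR n + IZR m * IZR m) with (INR n ^ 2 + IZR m ^ 2) by ring.
  assert (P : 0 < INR n ^ 2) by (apply pow_lt; auto). assert (Q := pow2_ge_0 (IZR m)).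
  rewrite <- Rpower_Ropp. replace (- (p / 2)) with (- (p / 2 - 1) + - (1)) by field.
  rewrite Rpower_plus. apply Rmult_le_compat; try (left; apply Rpower_pos).
  - eapply Rle_trans; [apply (Rpower_opp_le (INR n ^ 2)); lra|].
    rewrite <- Rpower_pow by auto. rewrite Rpower_mult. right. f_equal. simpl. field.
  - rewrite Rpower_Ropp, Rpower_1 by lra. lra.
Qed.

(** The terms with [|m| <= n] are at most [3 n] in number and contribute at most [3 / n]; each half
    of the others telescopes below [1 / n]. *)
Lemma inv_sq_sum n M : (0 < n)%nat ->
  lsumlist (fun m => / (INR n ^ 2 + IZR m ^ 2)) (zr M) <= 5 / INR n.
Proof.
  intros Hn. assert (Hn1 : 1 <= INR n) by (apply (le_INR 1); lia).
  assert (P : 0 < INR n ^ 2) by (apply pow_lt; lra).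
  assert (B1 : forall M, (M <= n)%nat ->
    lsumlist (fun m => / (INR n ^ 2 + IZR m ^ 2)) (zr M) <= (2 * INR M + 1) / INR n ^ 2).
  { intros N. induction N; intros HN.
    - rewrite lsl_zr_0. simpl INR. right. field. lra.
    - rewrite lsl_zr_S. specialize (IHN ltac:(lia)).
      assert (A : forall z, / (INR n ^ 2 + IZR z ^ 2) <= / INR n ^ 2).
      { intros z. apply Rinv_le_contravar; auto. generalize (pow2_ge_0 (IZR z)); lra. }
      assert (A1 := A (Z.of_nat (S N))). assert (A2 := A (- Z.of_nat (S N))%Z).
      rewrite S_INR. replace ((2 * (INR N + 1) + 1) / INR n ^ 2) with ((2 * INR N + 1) / INR n ^ 2 + / INR n ^ 2 + / INR n ^ 2) by (field; lra).
      lra. }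
  assert (B2 : forall k, lsumlist (fun m => / (INR n ^ 2 + IZR m ^ 2)) (zr (n + k)) <=
     (2 * INR n + 1) / INR n ^ 2 + 2 * (/ INR n - / INR (n + k))).
  { induction k.
    - rewrite Nat.add_0_r. specialize (B1 n ltac:(lia)). lra.
    - replace (n + S k)%nat with (S (n + k)) by lia. rewrite lsl_zr_S.
      assert (H : 0 < INR (n + k)) by (apply lt_0_INR; lia).
      assert (A : forall z, IZR z ^ 2 = INR (S (n + k)) ^ 2 -> / (INR n ^ 2 + IZR z ^ 2) <= / INR (n + k) - / INR (S (n + k))).
      { intros z ->. rewrite S_INR. apply Rle_trans with (/ ((INR (n+k) + 1) * INR (n+k))).
        - apply Rinv_le_contravar; nra.
        - right. field. lra. }
      assert (A1 := A (Z.of_nat (S (n + k))) ltac:(rewrite <- INR_IZR_INZ; auto)).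
      assert (A2 := A (- Z.of_nat (S (n + k)))%Z ltac:(rewrite opp_IZR, <- INR_IZR_INZ; ring)).
      lra. }
  assert (E : (2 * INR n + 1) / INR n ^ 2 <= 3 / INR n).
  { apply Rmult_le_reg_r with (INR n ^ 2); auto. unfold Rdiv. field_simplify; lra. }
  assert (F : 5 / INR n = 3 / INR n + 2 * / INR n) by (field; lra).
  destruct (Nat.le_gt_cases M n) as [H|H].
  - eapply Rle_trans; [apply B1; auto|]. apply Rle_trans with ((2 * INR n + 1) / INR n ^ 2).
    + apply Rmult_le_compat_r; [left; apply Rinv_0_lt_compat; auto|]. apply le_INR in H. lra.
    + assert (0 < / INR n) by (apply Rinv_0_lt_compat; lra). lra.
  - specialize (B2 (M - n)%nat). replace (n + (M - n))%nat with M in B2 by lia.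
    assert (0 < / INR M) by (apply Rinv_0_lt_compat, lt_0_INR; lia). lra.
Qed.

Lemma w_row_bound p n L : 2 <= p -> (0 < n)%nat -> NoDup L ->
  lsumlist (fun m => w p (Z.of_nat n, m)) L <= 5 * Rpower (INR n) (1 - p).
Proof.
  intros Hp Hn HL. assert (Hn' : 0 < INR n) by (apply lt_0_INR; auto).
  destruct (zr_exhausts L) as [N HN].
  eapply Rle_trans; [apply (lsl_incl_le _ L (zr N)); auto; [apply NoDup_zr|intros; apply w_nonneg]|].
  eapply Rle_trans; [apply lsl_le; intros; apply w_bound; auto|].
  rewrite lsl_scal.
  replace (5 * Rpower (INR n) (1 - p)) with (Rpower (INR n) (2 - p) * (5 / INR n)).
  - apply Rmult_le_compat_l; [left; apply Rpower_pos|]. apply inv_sq_sum; auto.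
  - replace (1 - p) with ((2 - p) + - (1)) by ring. rewrite Rpower_plus, Rpower_Ropp, Rpower_1 by auto.
    field. lra.
Qed.

Lemma summable_w_pos p n : 2 <= p -> (0 < n)%nat -> summable (fun m => w p (Z.of_nat n, m)).
Proof.
  intros Hp Hn. exists (5 * Rpower (INR n) (1 - p)). intros L HL.
  rewrite (lsl_ext _ (fun m => w p (Z.of_nat n, m))) by (intros; apply Rabs_pos_eq, w_nonneg).
  apply w_row_bound; auto.
Qed.

(** [w_bound] says nothing on the column through the site itself; that column is compared with the
    next one, as [1 + m^2 <= 2 m^2] for [m <> 0]. *)
Lemma w_axis_le p m : 0 <= p -> w p (0%Z, m) <= Rpower 2 (p / 2) * w p (1%Z, m).
Proof.
  intros Hp. unfold w. destruct (site_eqb (0%Z, m) (0%Z, 0%Z)) eqn:E.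
  - assert (0 < Rpower 2 (p / 2)) by apply Rpower_pos.
    destruct (site_eqb (1%Z, m) (0%Z, 0%Z)); [rewrite Rmult_0_r; lra|].
    left. apply Rmult_lt_0_compat; [|apply Rinv_0_lt_compat]; apply Rpower_pos.
  - apply site_eqb_neq in E. destruct (site_eqb (1%Z, m) _) eqn:E'.
    { apply site_eqb_spec in E'. inversion E'. }
    simpl fst; simpl snd. assert (Hm : m <> 0%Z) by congruence.
    set (A := IZR (0 * 0 + m * m)). set (B := IZR (1 * 1 + m * m)).
    assert (HA : 1 <= A) by (apply IZR_le; nia).
    assert (HB : B <= 2 * A) by (unfold A, B; rewrite <- mult_IZR; apply IZR_le; nia).
    assert (HB0 : 0 < B) by (apply IZR_lt; nia).
    rewrite <- !Rpower_Ropp.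
    apply Rle_trans with (Rpower 2 (p/2) * Rpower (2 * A) (- (p / 2))).
    + rewrite <- Rpower_mult_distr by lra. rewrite <- Rmult_assoc, <- Rpower_plus.
      replace (p / 2 + - (p / 2)) with 0 by ring. rewrite Rpower_O by lra. lra.
    + apply Rmult_le_compat_l; [left; apply Rpower_pos|]. apply Rpower_opp_le; lra.
Qed.

Lemma summable_w_row p a : 2 <= p -> summable (fun m => w p (a, m)).
Proof.
  intros Hp. destruct (Z.eq_dec a 0) as [->|Ha].
  - apply summable_le with (fun m => Rpower 2 (p / 2) * w p (1%Z, m)).
    + intros m. rewrite !Rabs_pos_eq; [apply w_axis_le; lra| |apply w_nonneg].
      apply Rmult_le_pos; [left; apply Rpower_pos|apply w_nonneg].
    + apply summable_scal. apply (summable_w_pos p 1); auto.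
  - apply summable_ext with (fun m => w p (Z.of_nat (Z.abs_nat a), m)).
    + intros m. destruct (Z.le_gt_cases 0 a).
      * f_equal. f_equal. lia.
      * rewrite <- w_opp_l. f_equal. f_equal. lia.
    + apply summable_w_pos; auto. lia.
Qed.

Lemma K_nonneg p n : 2 <= p -> 0 <= K p n.
Proof. intros. apply tsum_nonneg; [apply summable_w_row; auto|intros; apply w_nonneg]. Qed.

Lemma K_upper p n : 2 <= p -> (0 < n)%nat -> K p n <= 5 * Rpower (INR n) (1 - p).
Proof.
  intros. apply tsum_le_bound; [apply summable_w_row; auto|]. intros; apply w_row_bound; auto.
Qed.

(** The [n] sites with [0 <= m < n] lie within distance [sqrt 2 * n]. *)
Lemma K_lower p n : 2 <= p -> (0 < n)%nat -> Rpower 2 (- (p / 2)) * Rpower (INR n) (1 - p) <= K p n.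
Proof.
  intros Hp Hn. assert (Hn' : 0 < INR n) by (apply lt_0_INR; auto).
  apply Rle_trans with (lsumlist (fun m => w p (Z.of_nat n, m)) (map Z.of_nat (seq 0 n))).
  - rewrite lsl_map.
    apply Rle_trans with (lsumlist (fun _ => Rpower 2 (- (p / 2)) * Rpower (INR n) (- p)) (seq 0 n)).
    + rewrite lsl_const, length_seq. replace (1 - p) with (1 + - p) by ring.
      rewrite Rpower_plus, Rpower_1 by auto. right; ring.
    + apply lsl_le. intros m Hm. apply in_seq in Hm. unfold w.
      destruct site_eqb eqn:E; [apply site_eqb_spec in E; inversion E; lia|]. simpl fst; simpl snd.
      rewrite <- Rpower_Ropp.
      replace (- p) with (INR 2 * - (p / 2)) by (simpl; field). rewrite <- Rpower_mult, Rpower_pow by auto.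
      rewrite Rpower_mult_distr; [|lra|apply pow_lt; auto].
      apply Rpower_opp_le; [lra|]. split; [apply IZR_lt; nia|].

      rewrite plus_IZR, !mult_IZR, <- !INR_IZR_INZ.
      assert (INR m <= INR n) by (apply le_INR; lia). assert (0 <= INR m) by apply pos_INR. nra.
  - apply tsum_ge_finite; [apply summable_w_row; auto| |intros; apply w_nonneg].
    apply lsl_map_inj; [intros; lia|apply seq_NoDup].
Qed.

(* Telescoping substitute for [sum_{n > h} n^(-a-1) <= h^(-a) / a]. *)
Lemma Rpower_telescope a n : 0 < a -> (0 < n)%nat ->
  a * Rpower (INR (S n)) (- a - 1) <= Rpower (INR n) (- a) - Rpower (INR (S n)) (- a).
Proof.
  intros Ha Hn. assert (H0 : 0 < INR n) by (apply lt_0_INR; auto).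
  assert (H1 : 0 < INR (S n)) by (apply lt_0_INR; lia).
  replace (- a - 1) with (- a + - (1)) by ring.
  rewrite Rpower_plus, (Rpower_Ropp _ 1), Rpower_1 by auto.
  assert (E : Rpower (INR n) (- a) = Rpower (INR (S n)) (- a) * Rpower (INR n / INR (S n)) (- a)).
  { rewrite Rpower_mult_distr; auto; [|apply Rdiv_lt_0_compat; auto]. f_equal. field. lra. }
  rewrite E. assert (P := Rpower_pos (INR (S n)) (- a)).
  assert (F : 1 + a * / INR (S n) <= Rpower (INR n / INR (S n)) (- a)).
  { unfold Rpower. eapply Rle_trans; [|apply exp_ineq1_le].
    assert (G : ln (INR n / INR (S n)) <= - / INR (S n)).
    { replace (INR n / INR (S n)) with (1 + - / INR (S n)) by (rewrite S_INR; field; rewrite <- S_INR; lra).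
      assert (/ INR (S n) < 1) by (rewrite <- Rinv_1; apply Rinv_1_lt_contravar; [lra|]; rewrite S_INR; lra).
      rewrite <- (ln_exp (- / INR (S n))) at 2. apply ln_le; [lra|]. apply exp_ineq1_le. }
    nra. }
  nra.
Qed.

Lemma Rpower_tail a h N : 0 < a -> (0 < h)%nat ->
  lsumlist (fun i => Rpower (INR (h + S i)) (- a - 1)) (seq 0 N) <= Rpower (INR h) (- a) / a.
Proof.
  intros Ha Hh.
  assert (H : a * lsumlist (fun i => Rpower (INR (h + S i)) (- a - 1)) (seq 0 N) <= Rpower (INR h) (- a) - Rpower (INR (h + N)) (- a)).
  { induction N.
    - simpl. rewrite Nat.add_0_r. unfold lsumlist; simpl. lra.
    - rewrite lsl_seq_S. assert (T := Rpower_telescope a (h + N) Ha ltac:(lia)).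
      replace (S (h + N)) with (h + S N)%nat in T by lia. lra. }
  assert (P := Rpower_pos (INR (h + N)) (- a)).
  apply Rmult_le_reg_l with a; auto. unfold Rdiv. field_simplify; lra.
Qed.

Lemma K_tail p i N : 3 < p -> (0 < i)%nat ->
  lsumlist (fun j => K p (S (i + j))) (seq 0 N) <= 5 / (p - 2) * Rpower (INR i) (2 - p).
Proof.
  intros Hp Hi.
  eapply Rle_trans; [apply lsl_le; intros j _; apply K_upper; lia || lra|].
  rewrite lsl_scal. assert (T := Rpower_tail (p - 2) i N ltac:(lra) Hi).
  rewrite (lsl_ext _ (fun j => Rpower (INR (i + S j)) (- (p - 2) - 1))).
  - replace (2 - p) with (- (p - 2)) by ring. unfold Rdiv in *. lra.
  - intros j _. f_equal; [f_equal; lia|ring].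
Qed.

Lemma summable_K_from p i : 3 < p -> summable (fun j => K p (S (i + j))).
Proof.
  intros Hp.
  assert (S1 : summable (fun j => K p (S (1 + j)))).
  { apply summable_seq with (5 / (p - 2) * Rpower (INR 1) (2 - p)). intros N.
    rewrite (lsl_ext _ (fun j => K p (S (1 + j)))) by (intros; apply Rabs_pos_eq, K_nonneg; lra).
    apply K_tail; auto. }
  assert (S0 : summable (fun j => K p (S j))).
  { destruct S1 as [C HC]. apply summable_seq with (K p 1 + C). intros [|N].
    - unfold lsumlist; simpl. assert (0 <= K p 1) by (apply K_nonneg; lra).
      specialize (HC [] (NoDup_nil _)). unfold lsumlist in HC; simpl in HC. lra.
    - rewrite <- cons_seq, <- seq_shift.
      change (Rabs (K p 1) + lsumlist (fun z => Rabs (K p (S z))) (map S (seq 0 N)) <= K p 1 + C).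
      rewrite lsl_map, Rabs_pos_eq by (apply K_nonneg; lra). specialize (HC _ (seq_NoDup N 0)).
      apply Rplus_le_compat_l; auto. }
  apply (summable_inj (fun j => (i + j)%nat) (fun j => K p (S j))); auto. intros; lia.
Qed.

Lemma tsum_K_tail p i : 3 < p -> (0 < i)%nat ->
  tsum (fun j => K p (S (i + j))) <= 5 / (p - 2) * Rpower (INR i) (2 - p).
Proof.
  intros Hp Hi.
  apply tsum_le_bound; [apply summable_K_from; auto|]. intros L HL. destruct (seq_exhausts L) as [N HN].
  eapply Rle_trans; [|apply (K_tail p i N); auto].
  apply lsl_incl_le; auto; [apply seq_NoDup|intros; apply K_nonneg; lra].
Qed.

(** The factor [5 / (p - 2)] is that of [K_tail]; the terms [1] and [/ (p - 3)] come from the first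
    row of the corner and from the sum of the tails of the others. *)
Definition tail_const (p : R) : R := 5 / (p - 2) * (1 + / (p - 3)).

Lemma tail_const_pos p : 3 < p -> 0 < tail_const p.
Proof.
  intros Hp. unfold tail_const. assert (0 < 5 / (p - 2)) by (apply Rdiv_lt_0_compat; lra).
  assert (0 < / (p - 3)) by (apply Rinv_0_lt_compat; lra). nra.
Qed.

Lemma K_corner_tail p h L : 3 < p -> (0 < h)%nat -> NoDup L ->
  lsumlist (fun i => tsum (fun j => K p (S (h + i + j)))) L <=
  tail_const p * Rpower (INR h) (3 - p).
Proof.
  intros Hp Hh HL. unfold tail_const. destruct (seq_exhausts L) as [N HN].
  assert (HC : 0 < 5 / (p - 2)) by (apply Rdiv_lt_0_compat; lra).
  assert (NN : forall i, 0 <= tsum (fun j => K p (S (h + i + j)))).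
  { intros i. apply tsum_nonneg; [apply summable_K_from; auto|intros; apply K_nonneg; lra]. }
  eapply Rle_trans; [apply (lsl_incl_le _ L (seq 0 (S N))); auto using seq_NoDup|].
  rewrite <- cons_seq, <- seq_shift.
  change (tsum (fun j => K p (S (h + 0 + j))) + lsumlist (fun i => tsum (fun j => K p (S (h + i + j)))) (map S (seq 0 N)) <= tail_const p * Rpower (INR h) (3 - p)).
  rewrite lsl_map.
  assert (A : tsum (fun j => K p (S (h + 0 + j))) <= 5 / (p - 2) * Rpower (INR h) (3 - p)).
  { rewrite Nat.add_0_r. eapply Rle_trans; [apply tsum_K_tail; auto|].
    apply Rmult_le_compat_l; [lra|]. apply Rle_Rpower; [|lra]. apply (le_INR 1); lia. }
  assert (B : lsumlist (fun a => tsum (fun j => K p (S (h + S a + j)))) (seq 0 N) <= 5 / (p - 2) * (/ (p - 3) * Rpower (INR h) (3 - p))).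
  { eapply Rle_trans; [apply lsl_le; intros i _; apply tsum_K_tail; auto; lia|].
    rewrite lsl_scal. apply Rmult_le_compat_l; [lra|].
    assert (T := Rpower_tail (p - 3) h N ltac:(lra) Hh).
    rewrite (lsl_ext _ (fun i => Rpower (INR (h + S i)) (- (p - 3) - 1))) by (intros; f_equal; ring).
    replace (3 - p) with (- (p - 3)) by ring. unfold Rdiv in T. lra. }
  unfold tail_const. lra.
Qed.

(** The inner sums decay like [i^(2-p)], which is summable for [p > 3]. This finiteness is that of
    [Jc]. *)
Lemma summable_K2 p : 3 < p -> summable (fun ij : nat * nat => K p (S (fst ij + snd ij))).
Proof.
  intros Hp. apply summable_sigma; simpl.
  - intros i. apply summable_K_from; auto.
  - assert (NN : forall i, 0 <= tsum (fun j => K p (S (i + j)))).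
    { intros i. apply tsum_nonneg; [apply summable_K_from; auto|intros; apply K_nonneg; lra]. }
    apply summable_ext with (fun i => tsum (fun j => K p (S (i + j)))).
    { intros i. apply tsum_ext. intros j. symmetry; apply Rabs_pos_eq, K_nonneg; lra. }
    exists (tsum (fun j => K p (S (0 + j))) + tail_const p * Rpower (INR 1) (3 - p)).
    intros L HL. destruct (seq_exhausts L) as [N HN].
    eapply Rle_trans; [apply (lsl_incl_le _ L (seq 0 (S N))); auto using seq_NoDup, Rabs_pos|].
    rewrite (lsl_ext _ (fun i => tsum (fun j => K p (S (i + j))))) by (intros; apply Rabs_pos_eq; auto).
    rewrite <- cons_seq, <- seq_shift.
    change (tsum (fun j => K p (S (0 + j))) + lsumlist (fun i => tsum (fun j => K p (S (i + j)))) (map S (seq 0 N)) <= tsum (fun j => K p (S (0 + j))) + tail_const p * Rpower (INR 1) (3 - p)).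
    rewrite lsl_map. apply Rplus_le_compat_l.
    apply (K_corner_tail p 1 (seq 0 N)); auto. apply seq_NoDup.
Qed.

(** * Reflection positivity *)

(** Both sides contain [F z] exactly [M + 1 - |z|] times: double sums of a Toeplitz kernel are
    cumulative sums of the symmetric partial sums. *)
Lemma fejer_sum (F : Z -> R) M :
  lsumlist (fun r => lsumlist (fun s => F (Z.of_nat r - Z.of_nat s)%Z) (seq 0 (S M))) (seq 0 (S M)) =
  lsumlist (fun k => lsumlist F (zr k)) (seq 0 (S M)).
Proof.
  assert (P : forall M, lsumlist (fun s => F (Z.of_nat M - Z.of_nat s)%Z) (seq 0 (S M)) +
     lsumlist (fun r => F (Z.of_nat r - Z.of_nat M)%Z) (seq 0 M) = lsumlist F (zr M)).
  { intros N. transitivity (lsumlist F (map (fun s => (Z.of_nat N - Z.of_nat s)%Z) (seq 0 (S N)) ++ map (fun s => (Z.of_nat s - Z.of_nat N)%Z) (seq 0 N))).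
    - rewrite lsl_app, !lsl_map. auto.
    - apply lsl_perm. apply NoDup_Permutation.
      + apply NoDup_app.
        * apply lsl_map_inj; [intros; lia|apply seq_NoDup].
        * apply lsl_map_inj; [intros; lia|apply seq_NoDup].
        * intros z H1 H2. apply in_map_iff in H1, H2. destruct H1 as [a [<- Ha]], H2 as [b [E Hb]].
          apply in_seq in Ha, Hb. lia.
      + apply NoDup_zr.
      + intros z. rewrite in_app_iff, !in_map_iff, in_zr. split.
        * intros [[a [<- Ha]]|[a [<- Ha]]]; apply in_seq in Ha; lia.
        * intros Hz. destruct (Z.le_gt_cases 0 z).
          -- left. exists (Z.to_nat (Z.of_nat N - z)). rewrite in_seq. lia.
          -- right. exists (Z.to_nat (Z.of_nat N + z)). rewrite in_seq. lia. }
  induction M as [|M IH].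
  - unfold lsumlist; simpl. ring.
  - rewrite (lsl_seq_S (fun k => lsumlist F (zr k))), <- IH, <- P.
    rewrite lsl_seq_S.
    rewrite (lsl_ext _ (fun r => lsumlist (fun s => F (Z.of_nat r - Z.of_nat s)%Z) (seq 0 (S M)) + F (Z.of_nat r - Z.of_nat (S M))%Z)) by (intros; apply lsl_seq_S).
    rewrite lsl_plus. ring.
Qed.

(** Were the sum negative, the symmetric partial sums would eventually stay below half of it, and
    their cumulative sums, which are the nonnegative Toeplitz sums, would tend to minus infinity. *)
Lemma fejer_nonneg (F : Z -> R) : summable F ->
  (forall M, 0 <= lsumlist (fun r => lsumlist (fun s => F (Z.of_nat r - Z.of_nat s)%Z) (seq 0 M)) (seq 0 M)) ->
  0 <= tsum F.
Proof.
  intros Hs H. apply Rnot_lt_le. intros Neg.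
  assert (L := tsum_lim_zr F Hs). apply is_lim_seq_spec in L.
  assert (Hp : 0 < - tsum F / 2) by lra.
  destruct (L (mkposreal _ Hp)) as [N HN]. simpl in HN.
  set (A := lsumlist (fun k => lsumlist F (zr k)) (seq 0 N)).
  assert (B : forall k, lsumlist (fun k => lsumlist F (zr k)) (seq 0 (N + k)) <= A + INR k * (tsum F / 2)).
  { induction k.
    - rewrite Nat.add_0_r. simpl. unfold A. lra.
    - replace (N + S k)%nat with (S (N + k)) by lia. rewrite lsl_seq_S, S_INR.
      specialize (HN (N + k)%nat ltac:(lia)). apply Rabs_def2 in HN. lra. }
  destruct (INR_unbounded (A / (- (tsum F / 2)))) as [k Hk].
  specialize (B (S k)). replace (N + S k)%nat with (S (N + k)) in B by lia.
  rewrite <- fejer_sum in B. specialize (H (S (N + k))). rewrite S_INR in B.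
  assert (A < INR k * (- (tsum F / 2))).
  { apply Rmult_lt_reg_r with (/ (- (tsum F / 2))); [apply Rinv_0_lt_compat; lra|].
    rewrite Rmult_assoc, Rinv_r, Rmult_1_r by lra. auto. }
  lra.
Qed.

(** [halfplane_psd] is applied at the points with real part [i + 1/2] and integer height [r], with
    weights that ignore [r]: two such points interact through [w] at horizontal distance
    [i + j + 1]. Summing over heights, [fejer_nonneg] replaces [w] by its column sum [K]. *)
Lemma hankel_nonneg p (q : nat -> R) N : 2 <= p ->
  0 <= lsumlist (fun i => lsumlist (fun j => q i * q j * K p (S (i + j))) (seq 0 N)) (seq 0 N).
Proof.
  intros Hp.
  set (F := fun m => lsumlist (fun i => lsumlist (fun j => q i * q j * w p (Z.of_nat (S (i + j)), m)) (seq 0 N)) (seq 0 N)).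
  assert (S1 : forall i j, summable (fun m => q i * q j * w p (Z.of_nat (S (i + j)), m))).
  { intros. apply summable_scal, summable_w_row; auto. }
  assert (S2 : forall i, summable (fun m => lsumlist (fun j => q i * q j * w p (Z.of_nat (S (i + j)), m)) (seq 0 N))).
  { intros i. apply (summable_lsl (fun j m => q i * q j * w p (Z.of_nat (S (i + j)), m))). auto. }
  assert (SF : summable F).
  { apply (summable_lsl (fun i m => lsumlist (fun j => q i * q j * w p (Z.of_nat (S (i + j)), m)) (seq 0 N))). auto. }
  assert (E : tsum F = lsumlist (fun i => lsumlist (fun j => q i * q j * K p (S (i + j))) (seq 0 N)) (seq 0 N)).
  { unfold F. rewrite (tsum_lsl (fun i m => lsumlist (fun j => q i * q j * w p (Z.of_nat (S (i + j)), m)) (seq 0 N))) by auto.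
    apply lsl_ext. intros i _. rewrite (tsum_lsl (fun j m => q i * q j * w p (Z.of_nat (S (i + j)), m))) by auto.
    apply lsl_ext. intros j _. rewrite tsum_scal by (apply summable_w_row; auto). auto. }
  rewrite <- E. apply fejer_nonneg; auto. intros M.
  assert (Hal : 0 <= p / 2) by lra.
  assert (Hx : forall x : nat * nat, 0 < INR (fst x) + / 2).
  { intros x. generalize (pos_INR (fst x)). lra. }
  assert (P := halfplane_psd (fun x : nat * nat => INR (fst x) + / 2) (fun x => INR (snd x)) (p / 2) Hal Hx
     (list_prod (seq 0 N) (seq 0 M)) (fun x => q (fst x))).
  eapply Rle_trans; [exact P|]. right. clear P.
  assert (W : forall i j r s, / Rpower ((INR i + / 2 + (INR j + / 2)) ^ 2 + (INR r - INR s) ^ 2) (p / 2) =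
     w p (Z.of_nat (S (i + j)), Z.of_nat r - Z.of_nat s)%Z).
  { intros. unfold w. destruct site_eqb eqn:E1; [apply site_eqb_spec in E1; inversion E1; lia|].
    f_equal. f_equal. cbn [fst snd]. rewrite plus_IZR, !mult_IZR, minus_IZR, <- !INR_IZR_INZ, S_INR, plus_INR. field. }
  transitivity (lsumlist (fun i => lsumlist (fun r => lsumlist (fun j => lsumlist (fun s =>
    q i * q j * w p (Z.of_nat (S (i + j)), Z.of_nat r - Z.of_nat s)%Z) (seq 0 M)) (seq 0 N)) (seq 0 M)) (seq 0 N)).
  - rewrite lsl_prod. apply lsl_ext; intros i _. apply lsl_ext; intros r _. rewrite lsl_prod.
    apply lsl_ext; intros j _. apply lsl_ext; intros s _. cbn [fst snd]. rewrite W. auto.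
  - rewrite lsl_swap. apply lsl_ext; intros r _. unfold F. symmetry. rewrite lsl_swap.
    apply lsl_ext; intros i _. apply lsl_swap.
Qed.

(** * The Hankel form of the kernel *)

Definition bdd (q : nat -> R) : Prop := exists C, forall i, Rabs (q i) <= C.

(** Interaction across a cut of the line: [q] is read from the cut to the left and [r] to the right,
    so that the sites [i] and [j] are at distance [i + j + 1]. Nonnegativity on the diagonal is
    reflection positivity. *)
Definition B (p : R) (q r : nat -> R) : R :=
  tsum (fun ij : nat * nat => q (fst ij) * r (snd ij) * K p (S (fst ij + snd ij))).

Definition one_seq : nat -> R := fun _ => 1.

Definition shift (q : nat -> R) : nat -> R := fun i => match i with O => 0 | S i => q i end.

Fixpoint shiftn (n : nat) (q : nat -> R) : nat -> R :=
  match n with O => q | S n => shift (shiftn n q) end.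

Lemma B_summable p q r : 3 < p -> bdd q -> bdd r ->
  summable (fun ij : nat * nat => q (fst ij) * r (snd ij) * K p (S (fst ij + snd ij))).
Proof.
  intros Hp [C HC] [D HD].
  apply summable_le with (fun ij : nat * nat => (C * D) * K p (S (fst ij + snd ij))).
  - intros [i j]; simpl. rewrite !Rabs_mult. apply Rmult_le_compat_r; [apply Rabs_pos|].
    assert (0 <= C) by (eapply Rle_trans; [apply Rabs_pos|apply (HC i)]).
    assert (0 <= D) by (eapply Rle_trans; [apply Rabs_pos|apply (HD i)]).
    rewrite (Rabs_pos_eq C), (Rabs_pos_eq D) by auto.
    apply Rmult_le_compat; auto using Rabs_pos.
  - apply summable_scal, summable_K2; auto.
Qed.

Lemma bdd_plus q r : bdd q -> bdd r -> bdd (fun i => q i + r i).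
Proof.
  intros [C HC] [D HD]. exists (C + D). intros i. eapply Rle_trans; [apply Rabs_triang|].
  apply Rplus_le_compat; auto.
Qed.

Lemma bdd_scal c q : bdd q -> bdd (fun i => c * q i).
Proof.
  intros [C HC]. exists (Rabs c * C). intros i. rewrite Rabs_mult.
  apply Rmult_le_compat_l; auto using Rabs_pos.
Qed.

Lemma bdd_minus q r : bdd q -> bdd r -> bdd (fun i => q i - r i).
Proof.
  intros Hq Hr. replace (fun i => q i - r i) with (fun i => q i + (-1) * r i) by (extensionality i; ring).
  apply bdd_plus; auto. apply bdd_scal; auto.
Qed.

Lemma bdd_shift q : bdd q -> bdd (shift q).
Proof.
  intros [C HC]. exists C. intros [|i]; simpl; auto. rewrite Rabs_R0.
  eapply Rle_trans; [apply Rabs_pos|apply (HC O)].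
Qed.

Lemma bdd_shiftn n q : bdd q -> bdd (shiftn n q).
Proof. induction n; simpl; auto using bdd_shift. Qed.

Lemma bdd_one : bdd one_seq.
Proof. exists 1. intros. unfold one_seq. rewrite Rabs_R1. lra. Qed.

Lemma shiftn_spec n q i : shiftn n q i = if Nat.ltb i n then 0 else q (i - n)%nat.
Proof.
  revert i. induction n; intros i; simpl.
  - rewrite Nat.sub_0_r. auto.
  - destruct i; [reflexivity|]. simpl. rewrite IHn. reflexivity.
Qed.

Lemma shiftn_plus m n q : shiftn m (shiftn n q) = shiftn (m + n) q.
Proof. induction m; simpl; congruence. Qed.

Lemma B_ext p q q' r r' : (forall i, q i = q' i) -> (forall i, r i = r' i) -> B p q r = B p q' r'.
Proof. intros E1 E2. apply tsum_ext. intros. rewrite E1, E2. auto. Qed.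

Lemma B_sym p q r : 3 < p -> bdd q -> bdd r -> B p q r = B p r q.
Proof.
  intros Hp Hq Hr. unfold B.
  rewrite <- (tsum_bij (fun ij : nat * nat => (snd ij, fst ij)) (fun ij => (snd ij, fst ij))
     (fun ij : nat * nat => r (fst ij) * q (snd ij) * K p (S (fst ij + snd ij)))).
  - apply tsum_ext. intros [i j]; simpl. rewrite (Nat.add_comm j i). ring.
  - intros []; auto.
  - intros []; auto.
  - apply B_summable; auto.
Qed.

Lemma B_plus_l p q q' r : 3 < p -> bdd q -> bdd q' -> bdd r ->
  B p (fun i => q i + q' i) r = B p q r + B p q' r.
Proof.
  intros. unfold B. rewrite <- tsum_plus by (apply B_summable; auto).
  apply tsum_ext. intros. ring.
Qed.

Lemma B_minus_l p q q' r : 3 < p -> bdd q -> bdd q' -> bdd r ->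
  B p (fun i => q i - q' i) r = B p q r - B p q' r.
Proof.
  intros. unfold B. rewrite <- tsum_minus by (apply B_summable; auto).
  apply tsum_ext. intros. ring.
Qed.

Lemma B_plus_r p q r r' : 3 < p -> bdd q -> bdd r -> bdd r' ->
  B p q (fun i => r i + r' i) = B p q r + B p q r'.
Proof.
  intros. unfold B. rewrite <- tsum_plus by (apply B_summable; auto).
  apply tsum_ext. intros. ring.
Qed.

Lemma B_minus_r p q r r' : 3 < p -> bdd q -> bdd r -> bdd r' ->
  B p q (fun i => r i - r' i) = B p q r - B p q r'.
Proof.
  intros. unfold B. rewrite <- tsum_minus by (apply B_summable; auto).
  apply tsum_ext. intros. ring.
Qed.

Lemma B_scal2 p c q r : 3 < p -> bdd q -> bdd r ->
  B p (fun i => c * q i) (fun i => c * r i) = c * c * B p q r.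
Proof.
  intros. unfold B. rewrite <- tsum_scal by (apply B_summable; auto).
  apply tsum_ext. intros. ring.
Qed.

(** Hankel property: the kernel depends on [i + j] alone. It makes the shift symmetric, hence
    [B (T^a q) (T^b q)] a function of [a + b]. *)
Lemma B_shift p q r : 3 < p -> bdd q -> bdd r -> B p (shift q) r = B p q (shift r).
Proof.
  intros Hp Hq Hr. unfold B.
  rewrite <- (tsum_inj (fun ij : nat * nat => (S (fst ij), snd ij)) (fun ij : nat * nat => shift q (fst ij) * r (snd ij) * K p (S (fst ij + snd ij)))).
  - rewrite <- (tsum_inj (fun ij : nat * nat => (fst ij, S (snd ij))) (fun ij : nat * nat => q (fst ij) * shift r (snd ij) * K p (S (fst ij + snd ij)))).
    + apply tsum_ext. intros [i j]; simpl. rewrite <- plus_n_Sm. auto.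
    + intros [] []; simpl; congruence.
    + intros [i [|j]] Hb; simpl; [ring|]. exfalso. apply (Hb (i, j)); auto.
    + apply B_summable; auto using bdd_shift.
  - intros [] []; simpl; congruence.
  - intros [[|i] j] Hb; simpl; [ring|]. exfalso. apply (Hb (i, j)); auto.
  - apply B_summable; auto using bdd_shift.
Qed.

Lemma B_shiftn p n q r : 3 < p -> bdd q -> bdd r -> B p (shiftn n q) r = B p q (shiftn n r).
Proof.
  intros Hp. revert q r. induction n; intros q r Hq Hr; simpl; auto.
  rewrite B_shift, IHn; auto using bdd_shift, bdd_shiftn.
  f_equal. clear. induction n; simpl; auto. f_equal; auto.
Qed.

Lemma B_nonneg p q : 3 < p -> bdd q -> 0 <= B p q q.
Proof.
  intros Hp Hq. apply Rnot_lt_le. intros Neg.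
  assert (Hs := B_summable p q q Hp Hq Hq).
  destruct (summable_has_sum _ Hs (- B p q q)) as [L HL]; [lra|].
  destruct (seq_exhausts (map fst L)) as [N1 H1]. destruct (seq_exhausts (map snd L)) as [N2 H2].
  set (N := (N1 + N2)%nat).
  specialize (HL (list_prod (seq 0 N) (seq 0 N))). fold (B p q q) in HL.
  assert (P := hankel_nonneg p q N ltac:(lra)). rewrite lsl_prod in HL. simpl in HL.
  assert (Rabs (lsumlist (fun i => lsumlist (fun j => q i * q j * K p (S (i + j))) (seq 0 N)) (seq 0 N) - B p q q) < - B p q q).
  { apply HL.
    - apply NoDup_list_prod; apply seq_NoDup.
    - intros [i j] Hij. apply in_prod.
      + apply (H1 N); [unfold N; lia|]. apply (in_map fst L (i, j)); auto.
      + apply (H2 N); [unfold N; lia|]. apply (in_map snd L (i, j)); auto. }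
  apply Rabs_def2 in H. lra.
Qed.

Lemma B_bound p q r C D : 3 < p -> (forall i, Rabs (q i) <= C) -> (forall i, Rabs (r i) <= D) ->
  Rabs (B p q r) <= C * D * B p one_seq one_seq.
Proof.
  intros Hp HC HD.
  assert (bdd q) by (exists C; auto). assert (bdd r) by (exists D; auto).
  eapply Rle_trans; [apply tsum_abs, B_summable; auto|].
  unfold B. rewrite <- tsum_scal by (apply B_summable; auto using bdd_one).
  apply tsum_le.
  - apply summable_abs, B_summable; auto.
  - apply summable_scal, B_summable; auto using bdd_one.
  - intros [i j]; simpl. rewrite !Rabs_mult. unfold one_seq.
    rewrite (Rabs_pos_eq (K p _)) by (apply K_nonneg; lra).
    rewrite !Rmult_1_l. apply Rmult_le_compat_r; [apply K_nonneg; lra|].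
    apply Rmult_le_compat; auto using Rabs_pos.
Qed.

Lemma convex_bounded_nonincr (g : nat -> R) C :
  (forall k, 0 <= g k - 2 * g (S k) + g (S (S k))) -> (forall k, g k <= C) -> g 1%nat <= g 0%nat.
Proof.
  intros H1 H2. apply Rnot_lt_le. intros Hlt.
  assert (P : forall k, g (S k) - g k >= g 1%nat - g 0%nat).
  { induction k; [lra|]. specialize (H1 k). lra. }
  assert (Q : forall k, g k >= g 0%nat + INR k * (g 1%nat - g 0%nat)).
  { induction k; [simpl; lra|]. rewrite S_INR. specialize (P k). lra. }
  destruct (INR_unbounded ((C - g 0%nat) / (g 1%nat - g 0%nat))) as [k Hk].
  assert (C - g 0%nat < INR k * (g 1%nat - g 0%nat)).
  { apply Rmult_lt_reg_r with (/ (g 1%nat - g 0%nat)); [apply Rinv_0_lt_compat; lra|].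
    rewrite Rmult_assoc, Rinv_r, Rmult_1_r by lra. auto. }
  specialize (Q k). specialize (H2 k). lra.
Qed.

(** The squared norms of [T^(k h) q] form a convex sequence in [k], by positivity of [B] at
    [T^(k h) q - T^((k+2) h) q] and the Hankel property. A convex sequence bounded above cannot
    increase. *)
Lemma B_contraction p h q : 3 < p -> bdd q -> B p (shiftn h q) (shiftn h q) <= B p q q.
Proof.
  intros Hp Hq.
  set (g := fun k => B p (shiftn (k * h) q) (shiftn (k * h) q)).
  assert (G : g 1%nat <= g 0%nat); [|unfold g in G; simpl in G; rewrite Nat.add_0_r in G; auto].
  assert (F : forall a b, B p (shiftn a q) (shiftn b q) = B p q (shiftn (a + b) q)).
  { intros. rewrite B_shiftn, shiftn_plus; auto using bdd_shiftn. }
  destruct Hq as [C HC]. assert (Hq : bdd q) by (exists C; auto).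
  apply convex_bounded_nonincr with (C * C * B p one_seq one_seq).
  - intros k. unfold g.
    assert (P := B_nonneg p (fun i => shiftn (k * h) q i - shiftn (k * h + 2 * h) q i) Hp
      ltac:(apply bdd_minus; auto using bdd_shiftn)).
    rewrite B_minus_l, !B_minus_r in P by auto using bdd_shiftn, bdd_minus.
    rewrite !F in *.
    replace (k * h + (k * h + 2 * h))%nat with (S k * h + S k * h)%nat in P by lia.
    replace (k * h + 2 * h + k * h)%nat with (S k * h + S k * h)%nat in P by lia.
    replace (k * h + 2 * h + (k * h + 2 * h))%nat with (S (S k) * h + S (S k) * h)%nat in P by lia.
    lra.
  - intros k. eapply Rle_trans; [apply Rle_abs|]. apply B_bound; auto;
    intros i; rewrite shiftn_spec; destruct Nat.ltb; auto; rewrite Rabs_R0;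
    eapply Rle_trans; [apply Rabs_pos|apply (HC O)| apply Rabs_pos|apply (HC O)].
Qed.

Lemma B_mono p q q' r r' : 3 < p -> bdd q -> bdd q' -> bdd r -> bdd r' ->
  (forall i j, q i * r j <= q' i * r' j) -> B p q r <= B p q' r'.
Proof.
  intros Hp H1 H2 H3 H4 H. apply tsum_le; try (apply B_summable; auto).
  intros [i j]; simpl. apply Rmult_le_compat_r; [apply K_nonneg; lra|auto].
Qed.

Lemma B_indicator p h q : 3 < p -> bdd q ->
  B p (fun i => if Nat.ltb i h then 1 else 0) q =
  lsumlist (fun i => tsum (fun j => q j * K p (S (i + j)))) (seq 0 h).
Proof.
  intros Hp Hq. unfold B.
  assert (bdd (fun i => if Nat.ltb i h then 1 else 0)).
  { exists 1. intros i. destruct Nat.ltb; rewrite ?Rabs_R0, ?Rabs_R1; lra. }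
  destruct (tsum_fubini (fun ij : nat * nat => (if Nat.ltb (fst ij) h then 1 else 0) * q (snd ij) * K p (S (fst ij + snd ij)))) as [_ [_ ->]].
  { apply (B_summable p (fun i => if Nat.ltb i h then 1 else 0) q); auto. }
  simpl. rewrite (tsum_finite _ (seq 0 h)).
  - apply lsl_ext. intros i Hi. apply in_seq in Hi. apply tsum_ext. intros j.
    destruct (Nat.ltb_spec i h); [ring|lia].
  - apply seq_NoDup.
  - intros i Hi. rewrite in_seq in Hi. rewrite (tsum_finite _ []); auto; [constructor|].
    intros j _. destruct (Nat.ltb_spec i h); [lia|ring].
Qed.

(** Exactly [n] pairs satisfy [i + j + 1 = n], so both sides equal [sum_n n K n]. *)
Lemma Jc_eq p : 3 < p -> Jc p = B p one_seq one_seq.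
Proof.
  intros Hp.
  assert (S1 : summable (fun nk : nat * nat => (if Nat.ltb (snd nk) (fst nk) then 1 else 0) * K p (fst nk))).
  { apply (summable_inj_conv (fun ij : nat * nat => (S (fst ij + snd ij), fst ij)%nat)).
    - intros [] []; simpl. intros E; inversion E; f_equal; lia.
    - intros [n k] Hb. simpl. destruct (Nat.ltb_spec k n); [|ring].
      exfalso. apply (Hb (k, n - S k)%nat). simpl. f_equal; lia.
    - eapply summable_ext; [|apply (summable_K2 p Hp)]. intros [i j]; simpl.
      destruct (Nat.ltb_spec i (S (i + j))) as [L|L]; [lra|lia]. }
  assert (E0 : B p one_seq one_seq = tsum (fun nk : nat * nat => (if Nat.ltb (snd nk) (fst nk) then 1 else 0) * K p (fst nk))).
  { rewrite <- (tsum_inj (fun ij : nat * nat => (S (fst ij + snd ij), fst ij)%nat) (fun nk : nat * nat => (if Nat.ltb (snd nk) (fst nk) then 1 else 0) * K p (fst nk))); auto.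
    - apply tsum_ext. intros [i j]; simpl. unfold one_seq. destruct (Nat.ltb_spec i (S (i + j))) as [L|L]; [lra|lia].
    - intros [] []; simpl. intros E; inversion E; f_equal; lia.
    - intros [n k] Hb. simpl. destruct (Nat.ltb_spec k n); [|ring].
      exfalso. apply (Hb (k, n - S k)%nat). simpl. f_equal; lia. }
  assert (E1 : forall n, tsum (fun k => (if Nat.ltb k n then 1 else 0) * K p n) = INR n * K p n).
  { intros n. rewrite (tsum_finite _ (seq 0 n)).
    - rewrite (lsl_ext _ (fun _ => K p n)), lsl_const, length_seq; auto.
      intros k Hk. apply in_seq in Hk. destruct (Nat.ltb_spec k n); [ring|lia].
    - apply seq_NoDup.
    - intros k Hk. rewrite in_seq in Hk. destruct (Nat.ltb_spec k n); [lia|ring]. }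
  destruct (tsum_fubini _ S1) as [_ [S2 E2]]. simpl in S2, E2.
  rewrite (tsum_ext _ _ E1) in E2. apply (summable_ext _ _ E1) in S2.
  set (f := fun y : site => if Z.ltb 0 (fst y) then IZR (fst y) / Rpower (IZR (fst y * fst y + snd y * snd y)) (p / 2) else 0).
  assert (F1 : forall n m, f (Z.of_nat n, m) = INR n * w p (Z.of_nat n, m)).
  { intros n m. unfold f, w. cbn [fst snd]. destruct (Z.ltb_spec 0 (Z.of_nat n)).
    - destruct site_eqb eqn:E; [apply site_eqb_spec in E; inversion E; lia|].
      rewrite <- INR_IZR_INZ. auto.
    - replace n with 0%nat by lia. simpl. ring. }
  assert (F2 : forall n m, f (- Z.of_nat (S n), m)%Z = 0).
  { intros n m. unfold f. cbn [fst snd]. destruct (Z.ltb_spec 0 (- Z.of_nat (S n))); auto. lia. }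
  assert (NN : forall y, 0 <= f y).
  { intros y. unfold f. destruct (Z.ltb_spec 0 (fst y)); [|lra].
    apply Rmult_le_pos; [apply IZR_le; lia|]. left. apply Rinv_0_lt_compat, Rpower_pos. }
  assert (G1 : forall n, tsum (fun m => f (Z.of_nat n, m)) = INR n * K p n).
  { intros n. rewrite (tsum_ext _ _ (F1 n)), tsum_scal; auto. apply summable_w_row; lra. }
  assert (G2 : forall n, tsum (fun m => f (- Z.of_nat (S n), m)%Z) = 0).
  { intros n. rewrite (tsum_finite _ []); auto; constructor. }
  assert (S3 : summable (fun a => tsum (fun b => f (a, b))) /\ tsum (fun a => tsum (fun b => f (a, b))) = tsum (fun n => INR n * K p n)).
  { destruct (sum_Z_split (fun a => tsum (fun b => f (a, b)))) as [T1 T2].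
    - apply (summable_ext (fun n => INR n * K p n)); auto.
    - apply (summable_finite _ []); [constructor|]. intros; apply G2.
    - split; auto. rewrite T2. rewrite (tsum_ext _ _ G1).
      rewrite (tsum_ext _ _ G2), (tsum_finite (fun _ : nat => 0) []); auto; [unfold lsumlist; simpl; ring|constructor]. }
  destruct S3 as [S3 E3].
  assert (S4 : summable f).
  { apply summable_sigma.
    - intros a. destruct (Z.le_gt_cases 0 a).
      + apply summable_ext with (fun m => INR (Z.to_nat a) * w p (Z.of_nat (Z.to_nat a), m)).
        * intros m. rewrite <- F1. f_equal. f_equal. lia.
        * apply summable_scal, summable_w_row; lra.
      + apply (summable_finite _ []); [constructor|]. intros b _.
        replace a with (- Z.of_nat (S (Z.to_nat (- a - 1))))%Z by lia. apply F2.
    - eapply summable_ext; [|apply S3]. intros a. apply tsum_ext. intros b. symmetry. apply Rabs_pos_eq. apply NN. }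
  unfold Jc. fold f. rewrite (lsum_tsum f S4).
  etransitivity; [apply (proj2 (proj2 (tsum_fubini (A := Z) (B := Z) f S4)))|].
  rewrite E3, E0. auto.
Qed.

(** * One-dimensional chessboard estimate *)

Definition rseq (tau : Z -> bool) (b : Z) : nat -> R := fun j => sp (tau (b + Z.of_nat j)%Z).
Definition blk (h : nat) : nat -> R := fun i => if Nat.ltb i h then 1 else 0.
Definition altseq (h : nat) : nat -> R := fun j => if Nat.even (j / h) then 1 else -1.

(** What a run of width [h] of the periodic state regains from the sites to its right. Their spins,
    multiplied by minus the spin of the run, form [altseq h], which therefore begins with [1]. *)
Definition self_energy (p : R) (h : nat) : R := B p (blk h) (fun j => 1 + altseq h j).
(** One-dimensional form of [es], see [es_eq]: one kink and one self energy per run. At [h = 0] the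
    convention [/ 0 = 0] gives [0], the right value for an infinite run. *)
Definition e1 (p J : R) (h : nat) : R := / INR h * (2 * J - self_energy p h).

(** Every pair is attributed to its left end: no factor [1/2] is needed, and a run interacts only
    with the half line to its right. *)
Definition Phi (p : R) (tau : Z -> bool) (i : Z) : R :=
  tsum (fun n : nat => K p n * (1 - sp (tau i) * sp (tau (i + Z.of_nat n)%Z))).

Definition site_energy (p J : R) (tau : Z -> bool) (i : Z) : R :=
  J * (1 - sp (tau i) * sp (tau (i + 1)%Z)) - Phi p tau i.

(** Boundary term at [b]. It depends only on the field to the right of [b], and it is the quantity
    that telescopes from run to run. *)
Definition nrm (p : R) (tau : Z -> bool) (b : Z) : R := B p (rseq tau b) (rseq tau b).

Lemma sp_sq b : sp b * sp b = 1.
Proof. destruct b; simpl; ring. Qed.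

Lemma sp_neq a b : a <> b -> sp a = - sp b.
Proof. destruct a, b; simpl; intros; try congruence; ring. Qed.

Lemma sp_abs b : Rabs (sp b) = 1.
Proof. destruct b; simpl; rewrite ?Rabs_R1; auto. rewrite Rabs_left; lra. Qed.

Lemma bdd_rseq tau b : bdd (rseq tau b).
Proof. exists 1. intros. unfold rseq. rewrite sp_abs. lra. Qed.

Lemma bdd_blk h : bdd (blk h).
Proof. exists 1. intros. unfold blk. destruct Nat.ltb; rewrite ?Rabs_R1, ?Rabs_R0; lra. Qed.

Lemma altseq_cases h j : altseq h j = 1 \/ altseq h j = -1.
Proof. unfold altseq. destruct Nat.even; auto. Qed.

Lemma bdd_altseq h : bdd (altseq h).
Proof. exists 1. intros j. destruct (altseq_cases h j) as [-> | ->]; unfold Rabs; destruct Rcase_abs; lra. Qed.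

Lemma altseq_rec h j : (0 < h)%nat -> altseq h j = blk h j - shiftn h (altseq h) j.
Proof.
  intros Hh. rewrite shiftn_spec. unfold blk, altseq. destruct (Nat.ltb_spec j h) as [L|L].
  - rewrite Nat.div_small by auto. simpl. ring.
  - replace j with ((j - h) + 1 * h)%nat at 1 by lia. rewrite Nat.div_add by lia.
    rewrite Nat.add_1_r, Nat.even_succ, <- Nat.negb_even. destruct Nat.even; simpl; ring.
Qed.

(* With [q] the difference between the field [r] to the right of the run and the field [altseq h] of the
   periodic state, [B blk r = B blk altseq + (|r|^2 - |blk - T^h r|^2) / 2 - (|q|^2 - |T^h q|^2) / 2]. *)
Lemma run_interaction p h r : 3 < p -> (0 < h)%nat -> bdd r ->
  B p (blk h) r <= B p (blk h) (altseq h) +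
    / 2 * (B p r r - B p (fun j => blk h j - shiftn h r j) (fun j => blk h j - shiftn h r j)).
Proof.
  intros Hp Hh Hr. set (u := altseq h). assert (Hu : bdd u) by apply bdd_altseq.
  set (q := fun j => r j - u j). assert (Hq : bdd q) by (apply bdd_minus; auto).
  set (Tq := shiftn h q). assert (HT : bdd Tq) by (apply bdd_shiftn; auto).
  assert (E1 : B p r r = B p u u + B p u q + (B p q u + B p q q)).
  { rewrite (B_ext p r (fun j => u j + q j) r (fun j => u j + q j)) by (intros; unfold q; ring).
    rewrite B_plus_l, !B_plus_r; auto using bdd_plus. }
  assert (E2 : B p (fun j => blk h j - shiftn h r j) (fun j => blk h j - shiftn h r j) =
     B p u u - B p u Tq - (B p Tq u - B p Tq Tq)).
  { assert (X : forall j, blk h j - shiftn h r j = u j - Tq j).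
    { intros j. unfold u, Tq. rewrite (altseq_rec h j Hh), !shiftn_spec. destruct Nat.ltb; unfold q, u; ring. }
    rewrite (B_ext p _ (fun j => u j - Tq j) _ (fun j => u j - Tq j)) by auto.
    rewrite B_minus_l, !B_minus_r; auto using bdd_minus. }
  assert (E3 : B p (blk h) q = B p u q + B p u Tq).
  { rewrite (B_ext p (blk h) (fun j => u j + shiftn h u j) q q); auto.
    - rewrite B_plus_l by auto using bdd_shiftn. rewrite B_shiftn; auto.
    - intros j. unfold u. rewrite (altseq_rec h j Hh) at 1. ring. }
  assert (E4 : B p (blk h) q = B p (blk h) r - B p (blk h) u).
  { unfold q. apply B_minus_r; auto. apply bdd_blk. }
  assert (E5 := B_contraction p h q Hp Hq). fold Tq in E5.
  rewrite (B_sym p q u) in E1 by auto. rewrite (B_sym p Tq u) in E2 by auto. lra.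
Qed.

Lemma Phi_tail p tau c i : 3 < p ->
  (forall k, (0 <= k <= Z.of_nat i)%Z -> tau (c - k)%Z = tau c) ->
  Phi p tau (c - Z.of_nat i) = tsum (fun j => (1 - sp (tau c) * rseq tau (c + 1) j) * K p (S (i + j))).
Proof.
  intros Hp H. unfold Phi.
  rewrite <- (tsum_inj (fun j => S (i + j)) (fun n => K p n * (1 - sp (tau (c - Z.of_nat i)%Z) * sp (tau (c - Z.of_nat i + Z.of_nat n)%Z)))).
  - apply tsum_ext. intros j. rewrite (H (Z.of_nat i)) by lia. unfold rseq.
    replace (c - Z.of_nat i + Z.of_nat (S (i + j)))%Z with (c + 1 + Z.of_nat j)%Z by lia. ring.
  - intros; lia.
  - intros n Hn. assert (n <= i)%nat.
    { apply Nat.nlt_ge. intros L. apply (Hn (n - S i)%nat). lia. }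
    rewrite (H (Z.of_nat i)) by lia.
    replace (c - Z.of_nat i + Z.of_nat n)%Z with (c - (Z.of_nat i - Z.of_nat n))%Z by lia.
    rewrite H by lia. rewrite sp_sq. ring.
  - apply (summable_inj_conv (fun j => S j)).
    + intros; lia.
    + intros [|n] Hn; [|exfalso; apply (Hn n); auto]. rewrite Z.add_0_r, sp_sq. ring.
    + apply summable_le with (fun j => 2 * K p (S (0 + j))).
      * intros j. rewrite !Rabs_mult, Rmult_comm. apply Rmult_le_compat_r; [apply Rabs_pos|].
        destruct (tau (c - Z.of_nat i)%Z), (tau (c - Z.of_nat i + Z.of_nat (S j))%Z); simpl; unfold Rabs; repeat destruct Rcase_abs; lra.
      * apply summable_scal. apply (summable_K_from p 0); auto.
Qed.

Lemma lsl_seq_rev (f : nat -> R) h :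
  lsumlist f (seq 0 h) = lsumlist (fun k => f (h - 1 - k)%nat) (seq 0 h).
Proof.
  rewrite <- (lsl_map (fun k => (h - 1 - k)%nat) f). apply lsl_perm. apply NoDup_Permutation.
  - apply seq_NoDup.
  - apply NoDup_map_NoDup_ForallPairs; [|apply seq_NoDup].
    intros a b Ha Hb. apply in_seq in Ha, Hb. lia.
  - intros x. rewrite in_seq, in_map_iff. split.
    + intros Hx. exists (h - 1 - x)%nat. rewrite in_seq. lia.
    + intros [k [<- Hk]]. apply in_seq in Hk. lia.
Qed.

Lemma run_Phi p tau b h : 3 < p -> (0 < h)%nat ->
  (forall k, (0 <= k < Z.of_nat h)%Z -> tau (b + k)%Z = tau b) ->
  lsumlist (fun k => Phi p tau (b + Z.of_nat k)) (seq 0 h) =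
  B p (blk h) (fun j => 1 - sp (tau b) * rseq tau (b + Z.of_nat h) j).
Proof.
  intros Hp Hh H. rewrite lsl_seq_rev.
  assert (bdd (fun j => 1 - sp (tau b) * rseq tau (b + Z.of_nat h) j)).
  { apply (bdd_minus one_seq); [apply bdd_one|]. apply bdd_scal, bdd_rseq. }
  unfold blk. rewrite B_indicator by auto. apply lsl_ext. intros i Hi. apply in_seq in Hi.
  replace (b + Z.of_nat (h - 1 - i))%Z with ((b + Z.of_nat h - 1) - Z.of_nat i)%Z by lia.
  rewrite Phi_tail; auto.
  - apply tsum_ext. intros j. replace (b + Z.of_nat h - 1 + 1)%Z with (b + Z.of_nat h)%Z by lia.
    replace (b + Z.of_nat h - 1)%Z with (b + (Z.of_nat h - 1))%Z by lia. rewrite H by lia. auto.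
  - intros k Hk. replace (b + Z.of_nat h - 1 - k)%Z with (b + (Z.of_nat h - 1 - k))%Z by lia.
    replace (b + Z.of_nat h - 1)%Z with (b + (Z.of_nat h - 1))%Z by lia. rewrite !H by lia. auto.
Qed.

Lemma run_kink J tau b h : (0 < h)%nat ->
  (forall k, (0 <= k < Z.of_nat h)%Z -> tau (b + k)%Z = tau b) -> tau (b + Z.of_nat h)%Z <> tau b ->
  lsumlist (fun k => J * (1 - sp (tau (b + Z.of_nat k)%Z) * sp (tau (b + Z.of_nat k + 1)%Z))) (seq 0 h) = 2 * J.
Proof.
  intros Hh H Hn. destruct h as [|h]; [lia|]. rewrite lsl_seq_S, lsl_zero.
  - rewrite H by lia. replace (b + Z.of_nat h + 1)%Z with (b + Z.of_nat (S h))%Z by lia.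
    rewrite (sp_neq _ _ Hn). rewrite Rplus_0_l, <- Ropp_mult_distr_r, sp_sq. ring.
  - intros k Hk. apply in_seq in Hk. rewrite H by lia.
    replace (b + Z.of_nat k + 1)%Z with (b + (Z.of_nat k + 1))%Z by lia. rewrite H by lia.
    rewrite sp_sq. ring.
Qed.

(** [run_interaction] is used with [r] equal to minus the spin of the run times the field beyond it.
    Both norms in it are then values of [nrm], at the two ends of the run. *)
Lemma run_energy_lb p J tau b h : 3 < p -> (0 < h)%nat ->
  (forall k, (0 <= k < Z.of_nat h)%Z -> tau (b + k)%Z = tau b) -> tau (b + Z.of_nat h)%Z <> tau b ->
  2 * J - self_energy p h + / 2 * (nrm p tau b - nrm p tau (b + Z.of_nat h)) <=
  lsumlist (fun k => site_energy p J tau (b + Z.of_nat k)) (seq 0 h).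
Proof.
  intros Hp Hh H Hn. unfold site_energy. rewrite lsl_minus, (run_kink J tau b h) by auto.
  rewrite run_Phi by auto.
  set (s := sp (tau b)). set (r := fun j => - s * rseq tau (b + Z.of_nat h) j).
  assert (Hr : bdd r) by (apply bdd_scal, bdd_rseq).
  rewrite (B_ext p (blk h) (blk h) _ (fun j => one_seq j + r j)); [|auto|intros; unfold r, one_seq; ring].
  rewrite B_plus_r by auto using bdd_blk, bdd_one.
  unfold self_energy. rewrite (B_plus_r p (blk h) (fun _ => 1) (altseq h)) by auto using bdd_blk, bdd_one, bdd_altseq.
  fold one_seq.
  assert (R := run_interaction p h r Hp Hh Hr).
  assert (E1 : B p r r = nrm p tau (b + Z.of_nat h)).
  { unfold r. rewrite B_scal2 by auto using bdd_rseq. unfold s. rewrite Rmult_opp_opp, sp_sq. unfold nrm. ring. }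
  (* The block followed by [- r] is the field from [b] on, up to the sign [s], which the quadratic
     form does not see. *)
  assert (E2 : B p (fun j => blk h j - shiftn h r j) (fun j => blk h j - shiftn h r j) = nrm p tau b).
  { assert (X : forall j, blk h j - shiftn h r j = s * rseq tau b j).
    { intros j. rewrite shiftn_spec. unfold blk, r, rseq. destruct (Nat.ltb_spec j h) as [L|L].
      - rewrite (H (Z.of_nat j)) by lia. unfold s. rewrite sp_sq. ring.
      - replace (b + Z.of_nat h + Z.of_nat (j - h))%Z with (b + Z.of_nat j)%Z by lia. ring. }
    rewrite (B_ext p _ (fun j => s * rseq tau b j) _ (fun j => s * rseq tau b j)) by auto.
    rewrite B_scal2 by auto using bdd_rseq. unfold s. rewrite sp_sq. unfold nrm. ring. }
  rewrite E1, E2 in R. lra.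
Qed.

(** * Maximal runs and windows made of runs *)

Definition is_run (tau : Z -> bool) (a : Z) (h : nat) : Prop :=
  (0 < h)%nat /\ (forall k, (0 <= k < Z.of_nat h)%Z -> tau (a + k)%Z = tau a) /\
  tau (a - 1)%Z <> tau a /\ tau (a + Z.of_nat h)%Z <> tau a.

Definition in_run (tau : Z -> bool) (i : Z) (h : nat) : Prop :=
  exists a, is_run tau a h /\ (a <= i < a + Z.of_nat h)%Z.

(* [0] when the maximal constant interval containing [i] is infinite. *)
Definition runlen (tau : Z -> bool) (i : Z) : nat :=
  epsilon (inhabits O) (fun h => in_run tau i h \/ (~ (exists h', in_run tau i h') /\ h = O)).

Lemma is_run_unique tau a h a' h' i : is_run tau a h -> is_run tau a' h' ->
  (a <= i < a + Z.of_nat h)%Z -> (a' <= i < a' + Z.of_nat h')%Z -> a = a' /\ h = h'.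
Proof.
  intros [H1 [H2 [H3 H4]]] [G1 [G2 [G3 G4]]] I I'.
  assert (M : forall k, (a <= k < a + Z.of_nat h)%Z -> tau k = tau i).
  { intros k Hk. replace k with (a + (k - a))%Z by lia. replace i with (a + (i - a))%Z by lia. rewrite !H2 by lia. auto. }
  assert (M' : forall k, (a' <= k < a' + Z.of_nat h')%Z -> tau k = tau i).
  { intros k Hk. replace k with (a' + (k - a'))%Z by lia. replace i with (a' + (i - a'))%Z by lia. rewrite !G2 by lia. auto. }
  assert (A1 : ~ (a < a')%Z). { intros L. apply G3. rewrite (M (a' - 1)%Z), (M' a') by lia. auto. }
  assert (A2 : ~ (a' < a)%Z). { intros L. apply H3. rewrite (M' (a - 1)%Z), (M a) by lia. auto. }
  assert (a = a') by lia. subst a'. split; auto.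
  assert (B1 : ~ (h < h')%nat). { intros L. apply H4. rewrite (M' (a + Z.of_nat h)%Z), (M a) by lia. auto. }
  assert (B2 : ~ (h' < h)%nat). { intros L. apply G4. rewrite (M (a + Z.of_nat h')%Z), (M a) by lia. auto. }
  lia.
Qed.

Lemma runlen_spec tau i : in_run tau i (runlen tau i) \/ (~ (exists h', in_run tau i h') /\ runlen tau i = O).
Proof.
  unfold runlen. apply epsilon_spec. destruct (classic (exists h', in_run tau i h')) as [[h H]|N].
  - exists h; auto.
  - exists O; auto.
Qed.

Lemma runlen_eq tau i h : in_run tau i h -> runlen tau i = h.
Proof.
  intros H. destruct (runlen_spec tau i) as [G|[G _]]; [|exfalso; eauto].
  destruct H as [a [Ha Hi]], G as [a' [Ha' Hi']]. destruct (is_run_unique _ _ _ _ _ _ Ha Ha' Hi Hi'). auto.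
Qed.

Lemma runlen_pos tau i : (0 < runlen tau i)%nat -> in_run tau i (runlen tau i).
Proof. destruct (runlen_spec tau i) as [G|[_ G]]; auto. lia. Qed.

Lemma lsl_seq_plus (f : nat -> R) a b :
  lsumlist f (seq 0 (a + b)) = lsumlist f (seq 0 a) + lsumlist (fun k => f (a + k)%nat) (seq 0 b).
Proof.
  rewrite seq_app, lsl_app. f_equal. rewrite Nat.add_0_l.
  rewrite <- (lsl_map (fun k => (a + k)%nat) f). f_equal.
  clear. replace a with (a + 0)%nat at 1 by lia. generalize O.
  induction b; intros o; simpl; f_equal. rewrite plus_n_Sm. apply IHb.
Qed.

Lemma nat_least (P : nat -> Prop) : (exists n, P n) -> exists n, P n /\ forall m, (m < n)%nat -> ~ P m.
Proof.
  intros [n Hn]. revert Hn. induction n as [n IH] using lt_wf_ind. intros Hn.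
  destruct (classic (exists m, (m < n)%nat /\ P m)) as [[m [L Hm]]|N].
  - apply (IH m L Hm).
  - exists n. split; auto. intros m L Hm. apply N. eauto.
Qed.

Lemma next_kink (tau : Z -> bool) b n : (0 < n)%nat -> tau (b + Z.of_nat n - 1)%Z <> tau (b + Z.of_nat n)%Z ->
  exists h, (0 < h <= n)%nat /\ (forall k, (0 <= k < Z.of_nat h)%Z -> tau (b + k)%Z = tau b) /\
    tau (b + Z.of_nat h)%Z <> tau b.
Proof.
  intros Hn Hk.
  destruct (nat_least (fun h => (0 < h)%nat /\ tau (b + Z.of_nat h - 1)%Z <> tau (b + Z.of_nat h)%Z)) as [h [[H1 H2] H3]].
  { exists n; auto. }
  assert (C : forall k, (k < h)%nat -> tau (b + Z.of_nat k)%Z = tau b).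
  { induction k; intros L; [f_equal; lia|]. rewrite <- IHk by lia.
    destruct (Bool.bool_dec (tau (b + Z.of_nat k)%Z) (tau (b + Z.of_nat (S k))%Z)) as [E|E]; auto.
    exfalso. apply (H3 (S k) L). split; [lia|]. replace (b + Z.of_nat (S k) - 1)%Z with (b + Z.of_nat k)%Z by lia. auto. }
  exists h. repeat split; auto.
  - apply Nat.nlt_ge. intros L. apply (H3 n L). auto.
  - intros k L. replace k with (Z.of_nat (Z.to_nat k)) by lia. apply C. lia.
  - replace (b + Z.of_nat h - 1)%Z with (b + Z.of_nat (h - 1))%Z in H2 by lia. rewrite C in H2 by lia. auto.
Qed.

(** Induction on the first run. Since both ends are kinks, the window consists of whole runs, and
    the norms at interior kinks cancel. *)
Lemma window_energy_lb p J tau n : 3 < p -> forall b,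
  tau (b - 1)%Z <> tau b -> tau (b + Z.of_nat n - 1)%Z <> tau (b + Z.of_nat n)%Z ->
  lsumlist (fun k => e1 p J (runlen tau (b + Z.of_nat k))) (seq 0 n)
   + / 2 * (nrm p tau b - nrm p tau (b + Z.of_nat n)) <=
  lsumlist (fun k => site_energy p J tau (b + Z.of_nat k)) (seq 0 n).
Proof.
  intros Hp. induction n as [n IH] using lt_wf_ind. intros b Hb Hn.
  destruct (Nat.eq_dec n 0) as [->|N0].
  { simpl. rewrite Z.add_0_r. unfold lsumlist; simpl. lra. }
  destruct (next_kink tau b n ltac:(lia) Hn) as [h [Hh [H1 H2]]].
  assert (HR : is_run tau b h) by (unfold is_run; intuition).
  assert (R := run_energy_lb p J tau b h Hp ltac:(lia) H1 H2).
  specialize (IH (n - h)%nat ltac:(lia) (b + Z.of_nat h)%Z).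
  replace (b + Z.of_nat h + Z.of_nat (n - h))%Z with (b + Z.of_nat n)%Z in IH by lia.
  specialize (IH ltac:(replace (b + Z.of_nat h - 1)%Z with (b + (Z.of_nat h - 1))%Z by lia; rewrite H1 by lia; auto) Hn).
  replace n with (h + (n - h))%nat at 1 3 by lia. rewrite !lsl_seq_plus.
  rewrite (lsl_ext (fun k => e1 p J (runlen tau (b + Z.of_nat k))) (fun _ => e1 p J h)).
  2: { intros k Hk. apply in_seq in Hk. f_equal. apply runlen_eq. exists b. split; auto. lia. }
  rewrite lsl_const, length_seq.
  replace (INR h * e1 p J h) with (2 * J - self_energy p h).
  2: { unfold e1. field. apply not_0_INR. lia. }
  rewrite (lsl_ext (fun k => e1 p J (runlen tau (b + Z.of_nat (h + k)))) (fun k => e1 p J (runlen tau (b + Z.of_nat h + Z.of_nat k)))).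
  2: { intros k _. do 2 f_equal. lia. }
  rewrite (lsl_ext (fun k => site_energy p J tau (b + Z.of_nat (h + k))) (fun k => site_energy p J tau (b + Z.of_nat h + Z.of_nat k))).
  2: { intros k _. f_equal. lia. }
  lra.
Qed.

(** * Energy per site of periodic stripes *)

Lemma B_one_two p : 3 < p -> B p one_seq (fun _ => 2) = 2 * Jc p.
Proof.
  intros Hp. rewrite Jc_eq by auto. unfold B. rewrite <- tsum_scal by (apply B_summable; auto using bdd_one).
  apply tsum_ext. intros; unfold one_seq; ring.
Qed.

Lemma bdd_const c : bdd (fun _ => c).
Proof. exists (Rabs c). intros; lra. Qed.

Lemma bdd_1alt h : bdd (fun j => 1 + altseq h j).
Proof. apply (bdd_plus (fun _ => 1)); [apply bdd_const|apply bdd_altseq]. Qed.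

Lemma self_energy_upper p h : 3 < p -> self_energy p h <= 2 * Jc p.
Proof.
  intros Hp. rewrite <- B_one_two by auto. apply B_mono; auto using bdd_blk, bdd_one, bdd_const, bdd_1alt.
  intros i j. unfold blk, one_seq. cbv beta. destruct (altseq_cases h j) as [-> | ->]; destruct Nat.ltb; lra.
Qed.

Lemma B_corner_tail p h : 3 < p -> (0 < h)%nat ->
  B p (shiftn h one_seq) one_seq <= tail_const p * Rpower (INR h) (3 - p).
Proof.
  intros Hp Hh. assert (Hb : bdd (shiftn h one_seq)) by (apply bdd_shiftn, bdd_one).
  destruct (tsum_fubini _ (B_summable p _ _ Hp Hb bdd_one)) as [S1 [S2 E]]. simpl in S1, S2, E.
  unfold B. rewrite E. clear E.
  assert (X : forall i, tsum (fun j => shiftn h one_seq (h + i) * one_seq j * K p (S (h + i + j))) = tsum (fun j => K p (S (h + i + j)))).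
  { intros i. apply tsum_ext. intros j. rewrite shiftn_spec. destruct (Nat.ltb_spec (h + i) h); [lia|]. unfold one_seq. ring. }
  assert (Inj : forall a b, (h + a = h + b)%nat -> a = b) by (intros; lia).
  rewrite <- (tsum_inj (fun i => (h + i)%nat)); auto.
  - apply tsum_le_bound.
    + apply (summable_inj (fun i => (h + i)%nat) _ Inj S2).
    + intros L HL. rewrite (lsl_ext _ (fun i => tsum (fun j => K p (S (h + i + j))))) by (intros; apply X).
      apply K_corner_tail; auto.
  - intros i Hi. rewrite (tsum_finite _ []); auto; [constructor|]. intros j _.
    rewrite shiftn_spec. destruct (Nat.ltb_spec i h); [ring|]. exfalso. apply (Hi (i - h)%nat). lia.
Qed.

(** A pair has weight less than [2] only if [i >= h] or [j >= h], since [altseq h] is [1] on the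
    first block. Each of these two corner tails is counted with weight [2]. *)
Lemma self_energy_lower p h : 3 < p -> (0 < h)%nat ->
  2 * Jc p - 4 * (tail_const p * Rpower (INR h) (3 - p)) <= self_energy p h.
Proof.
  intros Hp Hh. assert (T := B_corner_tail p h Hp Hh). rewrite <- B_one_two by auto.
  set (co := shiftn h one_seq) in *. assert (Hb : bdd co) by (apply bdd_shiftn, bdd_one).
  assert (M : B p one_seq (fun _ => 2) <= self_energy p h + (2 * B p co one_seq + 2 * B p one_seq co)).
  { assert (T1 := B_summable p _ _ Hp (bdd_blk h) (bdd_1alt h)).
    assert (T2 := summable_scal _ 2 (B_summable p _ _ Hp Hb bdd_one)).
    assert (T3 := summable_scal _ 2 (B_summable p _ _ Hp bdd_one Hb)).
    unfold self_energy, B. rewrite <- !tsum_scal by (apply B_summable; auto using bdd_one).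
    rewrite <- (tsum_plus _ _ T2 T3), <- (tsum_plus _ _ T1 (summable_plus _ _ T2 T3)).
    apply tsum_le.
    - apply (B_summable p one_seq (fun _ => 2)); auto using bdd_one, bdd_const.
    - exact (summable_plus _ _ T1 (summable_plus _ _ T2 T3)).
    - intros [i j]; simpl. set (k := K p _). assert (Hk : 0 <= k) by (apply K_nonneg; lra).
      assert (X : 1 * 2 <= blk h i * (1 + altseq h j) + (2 * (co i * 1) + 2 * (1 * co j))).
      { unfold blk, co. rewrite !shiftn_spec. unfold one_seq. destruct (Nat.ltb_spec i h).
        - destruct (Nat.ltb_spec j h); [unfold altseq; rewrite Nat.div_small by auto; simpl; lra|].
          destruct (altseq_cases h j) as [-> | ->]; lra.
        - destruct (Nat.ltb_spec j h); lra. }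
      unfold one_seq. replace (blk h i * (1 + altseq h j) * k + (2 * (co i * 1 * k) + 2 * (1 * co j * k))) with
        ((blk h i * (1 + altseq h j) + (2 * (co i * 1) + 2 * (1 * co j))) * k) by ring.
      apply Rmult_le_compat_r; auto. }
  rewrite (B_sym p one_seq co) in M by auto using bdd_one. lra.
Qed.

(** The second block to the right has the sign of the run itself, so its [h^2] pairs with the run
    regain nothing. They are at distance less than [3 h]. *)
Lemma self_energy_upper_strict p h : 3 < p -> (0 < h)%nat ->
  self_energy p h + 2 * (Rpower 2 (- (p / 2)) * Rpower 3 (1 - p)) * Rpower (INR h) (3 - p) <= 2 * Jc p.
Proof.
  intros Hp Hh. assert (Hh' : 0 < INR h) by (apply lt_0_INR; auto). rewrite <- B_one_two by auto.
  set (bb := shiftn h (blk h)). assert (Hb : bdd bb) by (apply bdd_shiftn, bdd_blk).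
  assert (M : self_energy p h + 2 * B p (blk h) bb <= B p one_seq (fun _ => 2)).
  { assert (T1 := B_summable p _ _ Hp (bdd_blk h) (bdd_1alt h)).
    assert (T2 := summable_scal _ 2 (B_summable p _ _ Hp (bdd_blk h) Hb)).
    unfold self_energy, B. rewrite <- !tsum_scal by (apply B_summable; auto using bdd_blk).
    rewrite <- (tsum_plus _ _ T1 T2).
    apply tsum_le.
    - exact (summable_plus _ _ T1 T2).
    - apply (B_summable p one_seq (fun _ => 2)); auto using bdd_one, bdd_const.
    - intros [i j]; simpl. set (k := K p _). assert (Hk : 0 <= k) by (apply K_nonneg; lra).
      assert (X : blk h i * (1 + altseq h j) + 2 * (blk h i * bb j) <= 1 * 2).
      { unfold bb. rewrite !shiftn_spec. unfold blk. destruct (Nat.ltb_spec i h); [|lra].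
        destruct (Nat.ltb_spec j h); [destruct (altseq_cases h j) as [-> | ->]; lra|].
        destruct (Nat.ltb_spec (j - h) h); [|destruct (altseq_cases h j) as [-> | ->]; lra].
        replace (altseq h j) with (-1); [lra|]. unfold altseq.
        replace j with ((j - h) + 1 * h)%nat by lia. rewrite Nat.div_add, (Nat.div_small (j - h)) by lia. simpl. auto. }
      unfold one_seq. replace (blk h i * (1 + altseq h j) * k + 2 * (blk h i * bb j * k)) with
        ((blk h i * (1 + altseq h j) + 2 * (blk h i * bb j)) * k) by ring.
      apply Rmult_le_compat_r; auto. }
  assert (L : INR h * (INR h * (Rpower 2 (- (p / 2)) * Rpower (3 * INR h) (1 - p))) <= B p (blk h) bb).
  { unfold blk at 1. rewrite B_indicator by auto.
    rewrite <- (length_seq h 0) at 1. rewrite <- lsl_const. apply lsl_le. intros i Hi. apply in_seq in Hi.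
    apply Rle_trans with (lsumlist (fun j => bb j * K p (S (i + j))) (map (fun j => (h + j)%nat) (seq 0 h))).
    - rewrite lsl_map. rewrite <- (length_seq h 0) at 1. rewrite <- lsl_const. apply lsl_le. intros j Hj. apply in_seq in Hj.
      unfold bb. rewrite shiftn_spec. destruct (Nat.ltb_spec (h + j) h); [lia|].
      unfold blk. destruct (Nat.ltb_spec (h + j - h) h); [|lia]. rewrite Rmult_1_l.
      eapply Rle_trans; [|apply K_lower; lia || lra].
      apply Rmult_le_compat_l; [left; apply Rpower_pos|].
      replace (1 - p) with (- (p - 1)) by ring. apply Rpower_opp_le; [lra|]. split; [apply lt_0_INR; lia|].
      replace (3 * INR h) with (INR (3 * h)) by (rewrite mult_INR; simpl; ring). apply le_INR. lia.
    - apply tsum_ge_finite.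
      + assert (Q := proj1 (tsum_fubini _ (B_summable p one_seq bb Hp bdd_one Hb)) i). simpl in Q.
        eapply summable_ext; [|apply Q]. intros j; unfold one_seq; ring.
      + apply lsl_map_inj; [intros; lia|apply seq_NoDup].
      + intros j _. apply Rmult_le_pos; [|apply K_nonneg; lra].
        unfold bb. rewrite shiftn_spec. unfold blk. destruct (Nat.ltb j h), (Nat.ltb (j - h) h); lra. }
  assert (E : INR h * (INR h * (Rpower 2 (- (p / 2)) * Rpower (3 * INR h) (1 - p))) =
     (Rpower 2 (- (p / 2)) * Rpower 3 (1 - p)) * Rpower (INR h) (3 - p)).
  { rewrite <- Rpower_mult_distr by lra. replace (3 - p) with (1 + (1 + (1 - p))) by ring.
    rewrite !Rpower_plus, Rpower_1 by auto. ring. }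
  lra.
Qed.

(** * Periodic stripes *)

Definition stp (h : nat) (i : Z) : bool := Z.even (i / Z.of_nat h).

Lemma sin_period_Z x m : sin (x + 2 * IZR m * PI) = sin x.
Proof.
  destruct (Z.le_gt_cases 0 m) as [L|L].
  - replace m with (Z.of_nat (Z.to_nat m)) by lia. rewrite <- INR_IZR_INZ. apply sin_period.
  - rewrite <- (sin_period _ (Z.to_nat (- m))). f_equal. rewrite INR_IZR_INZ.
    replace (Z.of_nat (Z.to_nat (- m))) with (- m)%Z by lia. rewrite opp_IZR. ring.
Qed.

(** The shift by [1/2] keeps the argument off the zeros of the sine: it equals [t + q PI], with [q]
    the index of the block and [0 < t < PI]. *)
Lemma sigma_h_stp h x : (0 < h)%nat -> sigma_h h x = stp h (fst x).
Proof.
  intros Hh. unfold sigma_h, stp. set (i := fst x). set (H := Z.of_nat h).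
  assert (Hr := Z.mod_pos_bound i H ltac:(lia)). assert (E := Z.div_mod i H ltac:(lia)).
  set (q := (i / H)%Z) in *. set (r := (i mod H)%Z) in *.
  assert (Hh' : 0 < INR h) by (apply lt_0_INR; auto).
  set (t := PI * (IZR r + / 2) / INR h).
  assert (EH : INR h = IZR H) by apply INR_IZR_INZ.
  assert (Et : PI * (IZR i + / 2) / INR h = t + IZR q * PI).
  { unfold t. rewrite E, plus_IZR, mult_IZR, <- EH. field. lra. }
  assert (P := PI_RGT_0).
  assert (St : 0 < sin t).
  { apply sin_gt_0; unfold t.
    - apply Rdiv_lt_0_compat; auto. apply Rmult_lt_0_compat; auto. assert (0 <= IZR r) by (apply IZR_le; lia). lra.
    - apply Rmult_lt_reg_r with (INR h); auto. unfold Rdiv. rewrite Rmult_assoc, Rinv_l, Rmult_1_r by lra.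
      apply Rmult_lt_compat_l; auto. assert (IZR r <= IZR H - 1) by (rewrite <- minus_IZR; apply IZR_le; lia). lra. }
  rewrite Et. destruct (Z.even q) eqn:Ev.
  - apply Z.even_spec in Ev. destruct Ev as [m Em].
    assert (Es : sin (t + IZR q * PI) = sin t) by (rewrite Em, mult_IZR; apply sin_period_Z).
    destruct Rlt_dec; auto. lra.
  - assert (Z.odd q = true) by (rewrite <- Z.negb_even, Ev; auto). apply Z.odd_spec in H0. destruct H0 as [m Em].
    assert (Es : sin (t + IZR q * PI) = - sin t).
    { rewrite Em, plus_IZR, mult_IZR. replace (t + (2 * IZR m + 1) * PI) with (t + PI + 2 * IZR m * PI) by ring.
      rewrite sin_period_Z. apply neg_sin. }
    destruct Rlt_dec; auto. lra.
Qed.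

Lemma stp_block h q k : (0 < h)%nat -> (0 <= k < Z.of_nat h)%Z -> stp h (Z.of_nat h * q + k) = Z.even q.
Proof.
  intros Hh Hk. unfold stp. f_equal. symmetry. apply (Z.div_unique _ _ _ k); [left; lia|lia].
Qed.

Lemma stp_shift h i : (0 < h)%nat -> stp h (i + Z.of_nat h) = negb (stp h i).
Proof.
  intros Hh. unfold stp. replace (i + Z.of_nat h)%Z with (i + 1 * Z.of_nat h)%Z by lia.
  rewrite Z.div_add by lia. rewrite Z.add_1_r, Z.even_succ, <- Z.negb_even. auto.
Qed.

Lemma stp_reflect h i : (0 < h)%nat -> stp h (-1 - i) = negb (stp h i).
Proof.
  intros Hh. unfold stp. set (H := Z.of_nat h).
  assert (Hr := Z.mod_pos_bound i H ltac:(lia)). assert (E := Z.div_mod i H ltac:(lia)).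
  replace ((-1 - i) / H)%Z with (- (i / H) - 1)%Z.
  - rewrite Z.sub_1_r, Z.even_pred, Z.odd_opp, <- Z.negb_even. auto.
  - apply (Z.div_unique _ _ _ (H - 1 - i mod H)); [left; lia|lia].
Qed.

Lemma stp_is_run h q : (0 < h)%nat -> is_run (stp h) (Z.of_nat h * q) h.
Proof.
  intros Hh. assert (E0 : stp h (Z.of_nat h * q) = Z.even q).
  { rewrite <- (Z.add_0_r (Z.of_nat h * q)). apply stp_block; lia. }
  repeat split; auto.
  - intros k Hk. rewrite stp_block, E0; auto.
  - rewrite E0. replace (Z.of_nat h * q - 1)%Z with (Z.of_nat h * (q - 1) + (Z.of_nat h - 1))%Z by ring.
    rewrite stp_block by lia. rewrite Z.sub_1_r, Z.even_pred, <- Z.negb_even. destruct (Z.even q); discriminate.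
  - rewrite stp_shift by auto. destruct (stp h _); discriminate.
Qed.

Lemma stp_in_run h i : (0 < h)%nat ->
  exists q, is_run (stp h) (Z.of_nat h * q) h /\ (Z.of_nat h * q <= i < Z.of_nat h * q + Z.of_nat h)%Z.
Proof.
  intros Hh. exists (i / Z.of_nat h)%Z. split; [apply stp_is_run; auto|].
  assert (Hr := Z.mod_pos_bound i (Z.of_nat h) ltac:(lia)). assert (E := Z.div_mod i (Z.of_nat h) ltac:(lia)). lia.
Qed.

Lemma stp_rseq h q j : (0 < h)%nat -> rseq (stp h) (Z.of_nat h * q) j = sp (Z.even q) * altseq h j.
Proof.
  intros Hh. unfold rseq, altseq.
  assert (E := Nat.div_mod j h ltac:(lia)). assert (L := Nat.mod_upper_bound j h ltac:(lia)).
  set (a := (j / h)%nat) in *. set (r := (j mod h)%nat) in *.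
  replace (Z.of_nat h * q + Z.of_nat j)%Z with (Z.of_nat h * (q + Z.of_nat a) + Z.of_nat r)%Z by lia.
  rewrite stp_block by lia. rewrite Z.even_add.
  replace (Z.even (Z.of_nat a)) with (Nat.even a).
  - destruct (Z.even q), (Nat.even a); simpl; ring.
  - clear. induction a; auto. rewrite Nat.even_succ, <- Nat.negb_even, IHa.
    rewrite Nat2Z.inj_succ, Z.even_succ, <- Z.negb_even. auto.
Qed.

Lemma stp_run_Phi p h q : 3 < p -> (0 < h)%nat ->
  lsumlist (fun k => Phi p (stp h) (Z.of_nat h * q + Z.of_nat k)) (seq 0 h) = self_energy p h.
Proof.
  intros Hp Hh. destruct (stp_is_run h q Hh) as [_ [H1 _]].
  rewrite run_Phi; auto. unfold self_energy. apply B_ext; auto. intros j.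
  replace (Z.of_nat h * q + Z.of_nat h)%Z with (Z.of_nat h * (q + 1))%Z by ring.
  rewrite stp_rseq by auto. replace (stp h (Z.of_nat h * q)) with (Z.even q).
  - rewrite Z.even_add. destruct (Z.even q); simpl; ring.
  - rewrite <- (Z.add_0_r (Z.of_nat h * q)). symmetry. apply stp_block; lia.
Qed.

Lemma e1_mult p J h : (0 < h)%nat -> INR h * e1 p J h = 2 * J - self_energy p h.
Proof. intros. unfold e1. field. apply not_0_INR. lia. Qed.

Lemma e1_zero p J : e1 p J 0 = 0.
Proof. unfold e1. simpl. rewrite Rinv_0. ring. Qed.

Lemma stp_run_energy p J h q : 3 < p -> (0 < h)%nat ->
  lsumlist (fun k => site_energy p J (stp h) (Z.of_nat h * q + Z.of_nat k)) (seq 0 h) = INR h * e1 p J h.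
Proof.
  intros Hp Hh. destruct (stp_is_run h q Hh) as [_ [H1 [_ H2]]].
  unfold site_energy. rewrite lsl_minus, (run_kink J (stp h) (Z.of_nat h * q) h) by auto.
  rewrite stp_run_Phi, e1_mult by auto. auto.
Qed.

Lemma stp_window_energy p J h q m : 3 < p -> (0 < h)%nat ->
  lsumlist (fun k => site_energy p J (stp h) (Z.of_nat h * q + Z.of_nat k)) (seq 0 (m * h)) = INR (m * h) * e1 p J h.
Proof.
  intros Hp Hh. revert q. induction m; intros q.
  - simpl. unfold lsumlist; simpl. ring.
  - change (S m * h)%nat with (h + m * h)%nat. rewrite lsl_seq_plus, stp_run_energy by auto.
    rewrite (lsl_ext _ (fun k => site_energy p J (stp h) (Z.of_nat h * (q + 1) + Z.of_nat k))).
    + rewrite IHm, !plus_INR. ring.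
    + intros k _. f_equal. lia.
Qed.

(** * Boundary terms *)

(** The difference of the two squares is [B (q - s v) (q + s v)] with [q] the field from [b]. The
    first argument vanishes below [L], both are at most [2], whence [4] times a corner tail. *)
Lemma nrm_close p tau b v s L : 3 < p -> (0 < L)%nat -> s * s = 1 -> (forall j, Rabs (v j) <= 1) ->
  (forall j, (j < L)%nat -> rseq tau b j = s * v j) ->
  Rabs (nrm p tau b - B p v v) <= 4 * (tail_const p * Rpower (INR L) (3 - p)).
Proof.
  intros Hp HL Hs Hv H.
  assert (Bv : bdd v) by (exists 1; auto). assert (Bsv : bdd (fun j => s * v j)) by (apply bdd_scal; auto).
  assert (Bq := bdd_rseq tau b). assert (Bco : bdd (shiftn L one_seq)) by (apply bdd_shiftn, bdd_one).
  eapply Rle_trans; [|apply Rmult_le_compat_l; [lra|apply B_corner_tail; auto]].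
  assert (SS := B_summable p _ _ Hp (bdd_minus _ _ Bq Bsv) (bdd_plus _ _ Bq Bsv)).
  replace (nrm p tau b - B p v v) with (B p (fun j => rseq tau b j - s * v j) (fun j => rseq tau b j + s * v j)).
  - unfold B at 1. eapply Rle_trans.
    + apply tsum_abs, SS.
    + unfold B. rewrite <- tsum_scal by (apply B_summable; auto using bdd_one).
      assert (A1 : forall j, Rabs (s * v j) <= 1).
      { intros j. rewrite Rabs_mult. assert (Rabs s = 1).
        { rewrite <- (Rabs_pos_eq 1) by lra. apply Rsqr_eq_abs_0. unfold Rsqr. lra. }
        rewrite H0. specialize (Hv j). lra. }
      assert (A2 : forall j, Rabs (rseq tau b j) <= 1) by (intros; unfold rseq; rewrite sp_abs; lra).
      apply tsum_le.
      * apply summable_abs, SS.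
      * apply summable_scal, B_summable; auto using bdd_one.
      * intros [i j]; simpl. rewrite !Rabs_mult, (Rabs_pos_eq (K p _)) by (apply K_nonneg; lra).
        rewrite <- Rmult_assoc. apply Rmult_le_compat_r; [apply K_nonneg; lra|].
        rewrite shiftn_spec. unfold one_seq.
        assert (Rabs (rseq tau b j + s * v j) <= 2) by (eapply Rle_trans; [apply Rabs_triang|specialize (A1 j); specialize (A2 j); lra]).
        destruct (Nat.ltb_spec i L) as [LL|LL].
        -- rewrite H by auto. rewrite Rminus_diag, Rabs_R0. lra.
        -- assert (Rabs (rseq tau b i - s * v i) <= 2).
           { unfold Rminus. eapply Rle_trans; [apply Rabs_triang|]. rewrite Rabs_Ropp. specialize (A1 i); specialize (A2 i); lra. }
           replace (4 * (1 * 1)) with (2 * 2) by ring. apply Rmult_le_compat; auto using Rabs_pos.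
  - rewrite B_minus_l, !B_plus_r by auto using bdd_plus. unfold nrm.
    rewrite (B_scal2 p s v v) by auto. rewrite (B_sym p (rseq tau b) (fun j => s * v j)) by auto. rewrite Hs. ring.
Qed.

Lemma Rpower_small a C e : a < 0 -> 0 < C -> 0 < e -> exists L0, (0 < L0)%nat /\ forall L, (L0 <= L)%nat -> C * Rpower (INR L) a < e.
Proof.
  intros Ha HC He. set (X := Rpower (e / C) (/ a)).
  destruct (INR_unbounded X) as [n Hn]. exists (S n). split; [lia|]. intros L HL.
  assert (P : 0 < X) by apply Rpower_pos.
  assert (X < INR L) by (eapply Rlt_le_trans; [apply Hn|]; apply le_INR; lia).
  assert (E : Rpower X a = e / C).
  { unfold X. rewrite Rpower_mult, Rinv_l, Rpower_1; [auto|apply Rdiv_lt_0_compat; auto|lra]. }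
  assert (Rpower (INR L) a < Rpower X a).
  { unfold Rpower. apply exp_increasing. assert (ln X < ln (INR L)) by (apply ln_increasing; auto). nra. }
  rewrite E in H0. apply Rmult_lt_reg_r with (/ C); [apply Rinv_0_lt_compat; auto|].
  replace (C * Rpower (INR L) a * / C) with (Rpower (INR L) a) by (field; lra). auto.
Qed.

Definition win (a : Z) (n : nat) : list Z := map (fun k => (a + Z.of_nat k)%Z) (seq 0 n).

Lemma in_win a n z : In z (win a n) <-> (a <= z < a + Z.of_nat n)%Z.
Proof.
  unfold win. rewrite in_map_iff. split.
  - intros [k [<- Hk]]. apply in_seq in Hk. lia.
  - intros Hz. exists (Z.to_nat (z - a)). rewrite in_seq. lia.
Qed.

Lemma NoDup_win a n : NoDup (win a n).
Proof. apply lsl_map_inj; [intros; lia|apply seq_NoDup]. Qed.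

Lemma lsl_win (f : Z -> R) a n : lsumlist f (win a n) = lsumlist (fun k => f (a + Z.of_nat k)%Z) (seq 0 n).
Proof. apply lsl_map. Qed.

(** Allows windows adapted to the kinks, provided that they exhaust the line. *)
Lemma tsum_win_lb (F : Z -> R) S : summable F ->
  (forall e, 0 < e -> exists m0, forall m, (m0 <= m)%nat -> exists a n,
     (forall z, (Z.abs z <= Z.of_nat m)%Z -> (a <= z < a + Z.of_nat n)%Z) /\ S - e <= lsumlist F (win a n)) ->
  S <= tsum F.
Proof.
  intros Hs H. apply le_epsilon. intros e He.
  destruct (summable_has_sum F Hs (e/2)) as [L HL]; [lra|].
  destruct (H (e/2)) as [m0 Hm]; [lra|]. destruct (zr_exhausts L) as [N HN].
  destruct (Hm (N + m0)%nat ltac:(lia)) as [a [n [I Hl]]].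
  specialize (HL (win a n) (NoDup_win a n)).
  assert (Rabs (lsumlist F (win a n) - tsum F) < e / 2).
  { apply HL. intros z Hz. apply in_win, I. apply (HN N) in Hz; auto. apply in_zr in Hz. lia. }
  apply Rabs_def2 in H0. lra.
Qed.

Lemma stp_far_run h tau (M : nat) i : (0 < h)%nat ->
  (forall j, (Z.of_nat M <= Z.abs j)%Z -> tau j = stp h j) ->
  (Z.of_nat (M + 2 * h) < Z.abs i)%Z -> runlen tau i = h.
Proof.
  intros Hh H Hi. destruct (stp_in_run h i Hh) as [q [[R1 [R2 [R3 R4]]] I]].
  apply runlen_eq. exists (Z.of_nat h * q)%Z. split; auto.
  assert (E : forall j, (Z.of_nat h * q - 1 <= j <= Z.of_nat h * q + Z.of_nat h)%Z -> tau j = stp h j) by (intros; apply H; lia).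
  repeat split; auto.
  - intros k Hk. rewrite !E by lia. auto.
  - rewrite !E by lia. auto.
  - rewrite !E by lia. auto.
Qed.

Lemma row_energy_lb p J h tau (M : nat) : 3 < p -> (0 < h)%nat ->
  (forall i, (Z.of_nat M <= Z.abs i)%Z -> tau i = stp h i) ->
  summable (fun i => site_energy p J tau i - site_energy p J (stp h) i) ->
  forall N, (M + 2 * h <= N)%nat ->
  lsumlist (fun i => e1 p J (runlen tau i) - e1 p J h) (zr N) <=
  tsum (fun i => site_energy p J tau i - site_energy p J (stp h) i).
Proof.
  intros Hp Hh Ht Hs N HN. apply tsum_win_lb; auto. intros e He.
  set (C := 4 * (tail_const p)).
  assert (HC : 0 < C).
  { unfold C. assert (T := tail_const_pos p Hp). lra. }
  destruct (Rpower_small (3 - p) C e) as [L0 [HL0 HL]]; auto; [lra|].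
  exists (L0 + M + N + 1)%nat. intros m Hm.
  (* The window consists of [2 m + 1] runs of the periodic state, so that its ends are kinks of
     [tau] as well. *)
  exists (Z.of_nat h * - Z.of_nat m)%Z, ((2 * m) * h + h)%nat. split; [intros; nia|].
  set (b := (Z.of_nat h * - Z.of_nat m)%Z).
  assert (Eb : (b + Z.of_nat (2 * m * h + h) = Z.of_nat h * (Z.of_nat m + 1))%Z) by (unfold b; lia).
  assert (Hbig : (Z.of_nat m <= Z.of_nat h * Z.of_nat m)%Z) by nia.
  destruct (stp_is_run h (- Z.of_nat m) Hh) as [_ [_ [K1 _]]]. fold b in K1.
  destruct (stp_is_run h (Z.of_nat m + 1) Hh) as [_ [_ [K2 _]]]. rewrite <- Eb in K2.
  assert (W := window_energy_lb p J tau (2 * m * h + h) Hp b).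
  rewrite lsl_win, (lsl_minus (fun k => site_energy p J tau (b + Z.of_nat k)) (fun k => site_energy p J (stp h) (b + Z.of_nat k))).
  assert (W2 := stp_window_energy p J h (- Z.of_nat m) (S (2 * m)) Hp Hh).
  replace (S (2 * m) * h)%nat with (2 * m * h + h)%nat in W2 by lia. fold b in W2. rewrite W2.
  assert (W3 : lsumlist (fun k => e1 p J (runlen tau (b + Z.of_nat k))) (seq 0 (2 * m * h + h)) +
       / 2 * (nrm p tau b - nrm p tau (b + Z.of_nat (2 * m * h + h))) <=
       lsumlist (fun k => site_energy p J tau (b + Z.of_nat k)) (seq 0 (2 * m * h + h))).
  { apply W.
    - rewrite !Ht by (unfold b; lia). auto.
    - rewrite Eb in *. rewrite !Ht by lia. intros E. apply K2. auto. }
  assert (E : lsumlist (fun i => e1 p J (runlen tau i) - e1 p J h) (zr N) =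
     lsumlist (fun k => e1 p J (runlen tau (b + Z.of_nat k))) (seq 0 (2 * m * h + h)) - INR (2 * m * h + h) * e1 p J h).
  { rewrite <- (length_seq (2 * m * h + h) 0) at 2. rewrite <- lsl_const, <- lsl_minus.
    rewrite <- (lsl_win (fun i => e1 p J (runlen tau i) - e1 p J h)).
    apply lsl_incl_eq; [apply NoDup_zr|apply NoDup_win| |].
    - intros z Hz. apply in_zr in Hz. apply in_win. rewrite Eb. unfold b. nia.
    - intros z Hz Nz. rewrite in_zr in Nz. rewrite (stp_far_run h tau M); auto; [ring|]. lia. }
  assert (Hv : forall j, Rabs (altseq h j) <= 1).
  { intros j. destruct (altseq_cases h j) as [-> | ->]; unfold Rabs; destruct Rcase_abs; lra. }
  (* Seen from the left end, the field agrees with the stripes only until the perturbed zone, at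
     least [L0] sites away; seen from the right end it agrees forever, and [N2] is exact. *)
  assert (N1 : Rabs (nrm p tau b - B p (altseq h) (altseq h)) <= e).
  { left. eapply Rle_lt_trans; [apply (nrm_close p tau b _ (sp (Z.even (- Z.of_nat m))) L0); auto using sp_sq|].
    - intros j Hj. rewrite <- stp_rseq by auto. unfold rseq. fold b. f_equal. apply Ht. unfold b. lia.
    - specialize (HL L0 ltac:(lia)). unfold C in HL. lra. }
  assert (N2 : nrm p tau (b + Z.of_nat (2 * m * h + h)) = B p (altseq h) (altseq h)).
  { unfold nrm. rewrite Eb. set (s := sp (Z.even (Z.of_nat m + 1))).
    assert (X : forall j, rseq tau (Z.of_nat h * (Z.of_nat m + 1)) j = s * altseq h j).
    { intros j. unfold s. rewrite <- stp_rseq by auto. unfold rseq. f_equal. apply Ht. nia. }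
    rewrite (B_ext p _ (fun j => s * altseq h j) _ (fun j => s * altseq h j)) by auto.
    rewrite B_scal2 by auto using bdd_altseq. unfold s. rewrite sp_sq. ring. }
  rewrite E, N2 in *. apply Rabs_le_between in N1. lra.
Qed.

Lemma Z_least (P : Z -> Prop) m : (exists z, P z) -> (forall z, P z -> (m <= z)%Z) ->
  exists z, P z /\ forall y, P y -> (z <= y)%Z.
Proof.
  intros [z Hz] Hm. destruct (nat_least (fun n => P (m + Z.of_nat n)%Z)) as [n [H1 H2]].
  - exists (Z.to_nat (z - m)). replace (m + Z.of_nat (Z.to_nat (z - m)))%Z with z; auto. specialize (Hm z Hz). lia.
  - exists (m + Z.of_nat n)%Z. split; auto. intros y Hy. apply Z.nlt_ge. intros L.
    apply (H2 (Z.to_nat (y - m))); [specialize (Hm y Hy); lia|].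
    replace (m + Z.of_nat (Z.to_nat (y - m)))%Z with y; auto. specialize (Hm y Hy). lia.
Qed.

Lemma runlen_left_infinite tau c i : (forall j, (j <= i)%Z -> tau j = c) -> runlen tau i = 0%nat.
Proof.
  intros H. destruct (Nat.eq_dec (runlen tau i) 0) as [E|E]; auto. exfalso.
  destruct (runlen_pos tau i ltac:(lia)) as [a [[_ [_ [R _]]] I]]. apply R. rewrite !H by lia. auto.
Qed.

Lemma runlen_right_infinite tau c i : (forall j, (i <= j)%Z -> tau j = c) -> runlen tau i = 0%nat.
Proof.
  intros H. destruct (Nat.eq_dec (runlen tau i) 0) as [E|E]; auto. exfalso.
  destruct (runlen_pos tau i ltac:(lia)) as [a [[_ [R1 [_ R]]] I]]. apply R.
  rewrite <- (R1 (i - a)%Z) by lia. rewrite !H by lia. auto.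
Qed.

Lemma Phi_right_const p tau c i : (forall j, (i <= j)%Z -> tau j = c) -> Phi p tau i = 0.
Proof.
  intros H. unfold Phi. rewrite (tsum_finite _ []); auto; [constructor|].
  intros n _. rewrite !H by lia. rewrite sp_sq. ring.
Qed.

(** Pairs being attributed to their left ends, the constant half line on the right has no energy.
    The one on the left is cut at [- m] and treated as a run of width [n1], for which
    [2 J - self_energy p n1 >= - 2 (Jc p - J)] uniformly in [m]. In a constant column everything
    vanishes. *)
Lemma col_energy_lb p J tau (M : nat) c : 3 < p -> J <= Jc p ->
  (forall i, (Z.of_nat M <= Z.abs i)%Z -> tau i = c) -> summable (site_energy p J tau) ->
  forall N, (M <= N)%nat ->
  lsumlist (fun i => e1 p J (runlen tau i)) (zr N) -
   2 * (Jc p - J) * Defs.ind (exists i, tau i <> c) <= tsum (site_energy p J tau).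
Proof.
  intros Hp HJ Ht Hs N HN. unfold Defs.ind. destruct excluded_middle_informative as [Hk|Hk].
  2: { assert (Hc : forall i, tau i = c) by (intros i; apply NNPP; intros E; apply Hk; eauto).
    rewrite lsl_zero, (tsum_finite _ []); auto; [unfold lsumlist; simpl; lra|constructor| |].
    - intros i _. unfold site_energy. rewrite (Phi_right_const p tau c) by auto. rewrite !Hc, sp_sq. ring.
    - intros i _. rewrite (runlen_left_infinite tau c) by auto. apply e1_zero. }
  rewrite Rmult_1_r.
  destruct (Z_least (fun i => tau i <> c) (- Z.of_nat M)) as [a [Ha1 Ha2]]; auto.
  { intros z Hz. apply Z.nlt_ge. intros L. apply Hz, Ht. lia. }
  destruct (Z_least (fun i => tau (- i)%Z <> c) (- Z.of_nat M)) as [b' [Hb1 Hb2]].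
  { destruct Hk as [i Hi]. exists (- i)%Z. rewrite Z.opp_involutive. auto. }
  { intros z Hz. apply Z.nlt_ge. intros L. apply Hz, Ht. lia. }
  set (b := (- b' + 1)%Z).
  assert (Hleft : forall j, (j < a)%Z -> tau j = c).
  { intros j Hj. apply NNPP. intros E. specialize (Ha2 j E). lia. }
  assert (Hright : forall j, (b <= j)%Z -> tau j = c).
  { intros j Hj. apply NNPP. intros E. specialize (Hb2 (- j)%Z). rewrite Z.opp_involutive in Hb2. specialize (Hb2 E). lia. }
  assert (Hab : (a < b)%Z). { specialize (Ha2 (- b')%Z Hb1). lia. }
  assert (HaM : (- Z.of_nat M < a)%Z). { apply Z.nle_gt. intros L. apply Ha1, Ht. lia. }
  assert (HbM : (b <= Z.of_nat M)%Z). { apply Z.nlt_ge. intros L. apply Hb1, Ht. lia. }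
  apply tsum_win_lb; auto. intros e He.
  set (C := 4 * (tail_const p)).
  assert (HC : 0 < C).
  { unfold C. assert (T := tail_const_pos p Hp). lra. }
  destruct (Rpower_small (3 - p) C e) as [L0 [HL0 HL]]; auto; [lra|].
  exists (L0 + M + N + 1)%nat. intros m Hm.
  set (n1 := Z.to_nat (a + Z.of_nat m)). set (n2 := Z.to_nat (b - a)).
  exists (- Z.of_nat m)%Z, (n1 + (n2 + (m + 2 * M + 1)))%nat. split; [intros; lia|].
  rewrite lsl_win, (lsl_seq_plus _ n1), (lsl_seq_plus _ n2).
  rewrite (lsl_zero _ (seq 0 (m + 2 * M + 1))).
  2: { intros k _. unfold site_energy. rewrite (Phi_right_const p tau c) by (intros; apply Hright; lia).
       rewrite !Hright by lia. rewrite sp_sq. ring. }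
  assert (R := run_energy_lb p J tau (- Z.of_nat m) n1 Hp ltac:(lia)).
  replace (- Z.of_nat m + Z.of_nat n1)%Z with a in R by lia.
  specialize (R ltac:(intros; rewrite !Hleft by lia; auto) ltac:(rewrite (Hleft (- Z.of_nat m)%Z) by lia; auto)).
  assert (W := window_energy_lb p J tau n2 Hp a).
  replace (a + Z.of_nat n2)%Z with b in W by lia.
  specialize (W ltac:(rewrite (Hleft (a - 1)%Z) by lia; auto)).
  specialize (W ltac:(rewrite (Hright b) by lia; replace (b - 1)%Z with (- b')%Z by lia; auto)).
  rewrite (lsl_ext (fun k => site_energy p J tau (- Z.of_nat m + Z.of_nat (n1 + k))) (fun k => site_energy p J tau (a + Z.of_nat k))).
  2: { intros k _. f_equal. lia. }
  assert (E : lsumlist (fun i => e1 p J (runlen tau i)) (zr N) = lsumlist (fun k => e1 p J (runlen tau (a + Z.of_nat k))) (seq 0 n2)).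
  { rewrite <- (lsl_win (fun i => e1 p J (runlen tau i))). symmetry. apply lsl_incl_eq; [apply NoDup_win|apply NoDup_zr| |].
    - intros z Hz. apply in_win in Hz. apply in_zr. lia.
    - intros z _ Nz. rewrite in_win in Nz. destruct (Z.lt_ge_cases z a) as [L|L].
      + rewrite (runlen_left_infinite tau c); [apply e1_zero|intros; apply Hleft; lia].
      + rewrite (runlen_right_infinite tau c); [apply e1_zero|intros; apply Hright; lia]. }
  assert (N1 : Rabs (nrm p tau (- Z.of_nat m) - B p one_seq one_seq) <= e).
  { left. eapply Rle_lt_trans; [apply (nrm_close p tau _ _ (sp c) L0); auto using sp_sq|].
    - intros; unfold one_seq; rewrite Rabs_R1; lra.
    - intros j Hj. unfold rseq, one_seq. rewrite Ht by lia. ring.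
    - specialize (HL L0 ltac:(lia)). unfold C in HL. lra. }
  assert (N2 : nrm p tau b = B p one_seq one_seq).
  { unfold nrm. assert (X : forall j, rseq tau b j = sp c * one_seq j).
    { intros j. unfold rseq, one_seq. rewrite Hright by lia. ring. }
    rewrite (B_ext p _ (fun j => sp c * one_seq j) _ (fun j => sp c * one_seq j)) by auto.
    rewrite B_scal2 by auto using bdd_one. rewrite sp_sq. ring. }
  assert (SU := self_energy_upper p n1 Hp).
  rewrite E. rewrite N2 in W. apply Rabs_le_between in N1. lra.
Qed.

(** * The specific energy of the definition *)

Lemma Phi_reflect p h i : (0 < h)%nat ->
  tsum (fun n => K p n * (1 - sp (stp h i) * sp (stp h (i - Z.of_nat n)))) = Phi p (stp h) (-1 - i).
Proof.
  intros Hh. unfold Phi. apply tsum_ext. intros n.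
  rewrite (stp_reflect h i Hh). replace (-1 - i + Z.of_nat n)%Z with (-1 - (i - Z.of_nat n))%Z by ring.
  rewrite stp_reflect by auto. destruct (stp h i), (stp h (i - Z.of_nat n)); simpl; ring.
Qed.

Lemma w_distp p x y : x <> y -> w p (fst y - fst x, snd y - snd x)%Z = / distp p x y.
Proof.
  intros H. unfold w. destruct site_eqb eqn:E.
  - apply site_eqb_spec in E. inversion E. exfalso. apply H. destruct x, y; simpl in *; f_equal; lia.
  - unfold distp, dist2. cbn [fst snd]. do 3 f_equal. ring.
Qed.

Lemma summable_nat_shift (f : nat -> R) : summable (fun n => f (S n)) -> summable f.
Proof.
  intros H. set (g := fun n => match n with O => 0 | S _ => f n end).
  apply summable_ext with (fun n => g n + (if Nat.eqb n 0 then f O else 0)).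
  - intros [|n]; simpl; ring.
  - apply summable_plus.
    + apply (summable_inj_conv S); auto. intros [|n] Hn; auto. exfalso; apply (Hn n); auto.
    + apply (summable_finite _ [O]); [constructor; [intros []|constructor]|].
      intros [|n] Hn; auto. exfalso. apply Hn. left; auto.
Qed.

Lemma summable_w p : 3 < p -> summable (w p).
Proof.
  intros Hp. apply summable_sigma.
  - intros a. apply (summable_w_row p a). lra.
  - assert (E : forall a, tsum (fun b => w p (a, b)) = tsum (fun b => Rabs (w p (a, b)))).
    { intros a. apply tsum_ext. intros; symmetry; apply Rabs_pos_eq, w_nonneg. }
    eapply summable_ext; [apply E|].
    apply sum_Z_split.
    + apply summable_nat_shift. apply (summable_K_from p 0); auto.
    + apply summable_ext with (fun n => K p (S (0 + n))); [|apply summable_K_from; auto].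
      intros n. apply tsum_ext. intros b. symmetry. apply w_opp_l.
Qed.

Lemma tsum_nat_shift (f : nat -> R) : f O = 0 -> summable f -> tsum (fun n => f (S n)) = tsum f.
Proof.
  intros H0 H. apply tsum_inj; auto. intros [|n] Hn; auto. exfalso; apply (Hn n); auto.
Qed.

(** A function of the horizontal displacement alone sees only the column sums of [w]. The
    displacement [0] appears in both sums on the right, harmlessly because [f 0 = 0]. *)
Lemma column_sum p (f : Z -> R) C : 3 < p -> (forall n, Rabs (f n) <= C) -> f 0%Z = 0 ->
  summable (fun d : site => w p d * f (fst d)) /\
  tsum (fun d : site => w p d * f (fst d)) =
   tsum (fun n => K p n * f (Z.of_nat n)) + tsum (fun n => K p n * f (- Z.of_nat n)%Z).
Proof.
  intros Hp Hf H0.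
  assert (S0 : summable (fun d : site => w p d * f (fst d))).
  { apply summable_le with (fun d => C * w p d); [|apply summable_scal, summable_w; auto].
    intros d. rewrite !Rabs_mult, Rmult_comm. apply Rmult_le_compat_r; [apply Rabs_pos|].
    eapply Rle_trans; [apply Hf|apply Rle_abs]. }
  split; auto.
  destruct (tsum_fubini (A := Z) (B := Z) _ S0) as [S1 [S2 E]]. cbn [fst] in S1, S2, E.
  etransitivity; [exact E|]. clear E.
  assert (X : forall a, tsum (fun b => w p (a, b) * f a) = f a * tsum (fun b => w p (a, b))).
  { intros a. rewrite <- tsum_scal by (apply summable_w_row; lra). apply tsum_ext; intros; ring. }
  assert (X1 : forall n, tsum (fun b => w p (Z.of_nat n, b) * f (Z.of_nat n)) = K p n * f (Z.of_nat n)).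
  { intros. rewrite X. apply Rmult_comm. }
  assert (X2 : forall n, tsum (fun b => w p (- Z.of_nat (S n), b)%Z * f (- Z.of_nat (S n))%Z) = K p (S n) * f (- Z.of_nat (S n))%Z).
  { intros. rewrite X, Rmult_comm. reflexivity. }
  assert (I1 : forall a b, Z.of_nat a = Z.of_nat b -> a = b) by (intros; lia).
  assert (I2 : forall a b, (- Z.of_nat (S a) = - Z.of_nat (S b))%Z -> a = b) by (intros; lia).
  assert (T1 := summable_inj Z.of_nat _ I1 S2).
  assert (T2 := summable_inj (fun n => - Z.of_nat (S n))%Z _ I2 S2).
  cbn beta in T1, T2.
  rewrite (proj2 (sum_Z_split _ T1 T2)). rewrite (tsum_ext _ _ X1), (tsum_ext _ _ X2). f_equal.
  apply (tsum_nat_shift (fun n => K p n * f (- Z.of_nat n)%Z)).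
  - simpl. rewrite H0. ring.
  - apply summable_nat_shift. apply (summable_ext _ _ X2). auto.
Qed.

Lemma spp_bound a b : Rabs (sp a * sp b - 1) <= 2.
Proof. destruct a, b; simpl; unfold Rabs; destruct Rcase_abs; lra. Qed.

(** [es] also counts interactions to the left. By [stp_reflect] those of [x] are the interactions of
    [-1 - x] to the right, so [es] averages [site_energy] over two windows of two whole runs
    each. *)
Lemma es_eq p J h : 3 < p -> (0 < h)%nat -> es p J h = e1 p J h.
Proof.
  intros Hp Hh. unfold es.
  set (s := stp h).
  assert (Lr : forall x1, lsum (fun y => if site_eqb y (x1, 0%Z) then 0 else (sp (sigma_h h (x1, 0%Z)) * sp (sigma_h h y) - 1) / distp p (x1, 0%Z) y) =
     - Phi p s x1 - Phi p s (-1 - x1)).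
  { intros x1.
    destruct (column_sum p (fun n => sp (s x1) * sp (s (x1 + n)%Z) - 1) 2 Hp) as [S0 E].
    - intros; apply spp_bound.
    - rewrite Z.add_0_r, sp_sq. ring.
    - set (f := fun y => if site_eqb y (x1, 0%Z) then 0 else (sp (sigma_h h (x1, 0%Z)) * sp (sigma_h h y) - 1) / distp p (x1, 0%Z) y).
      assert (EF : forall d, w p d * (sp (s x1) * sp (s (x1 + fst d)%Z) - 1) = f (x1 + fst d, snd d)%Z).
      { intros [n m]. unfold f. cbn [fst snd]. rewrite !sigma_h_stp by auto. cbn [fst].
        destruct site_eqb eqn:E'.
        - apply site_eqb_spec in E'. assert (N0 : n = 0%Z) by (injection E'; lia).
          rewrite N0, Z.add_0_r, sp_sq. ring.
        - apply site_eqb_neq in E'. rewrite <- Rmult_comm. unfold Rdiv. rewrite <- (w_distp p); [|congruence].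
          cbn [fst snd]. fold s. f_equal. f_equal. f_equal; lia. }
      assert (SF : summable f).
      { apply (summable_bij (fun d : site => (x1 + fst d, snd d)%Z) (fun y : site => (fst y - x1, snd y)%Z)).
        - intros []; simpl; f_equal; lia.
        - intros []; simpl; f_equal; lia.
        - eapply summable_ext; [apply EF|]. auto. }
      rewrite lsum_tsum by auto.
      etransitivity; [symmetry; apply (tsum_bij (fun d : site => (x1 + fst d, snd d)%Z) (fun y : site => (fst y - x1, snd y)%Z) f)|]; auto.
      + intros []; simpl; f_equal; lia.
      + intros []; simpl; f_equal; lia.
      + rewrite <- (tsum_ext _ _ EF), E.
        assert (SK : forall g : Z -> R, (forall n, Rabs (g n) <= 2) -> g 0%Z = 0 -> summable (fun n => K p n * g (Z.of_nat n))).
        { intros g Hg H0. apply summable_nat_shift. apply summable_le with (fun n => 2 * K p (S (0 + n))); [|apply summable_scal, summable_K_from; auto].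
          intros n. rewrite !Rabs_mult, Rmult_comm. apply Rmult_le_compat_r; [apply Rabs_pos|]. rewrite (Rabs_pos_eq 2) by lra. apply Hg. }
        assert (PR := Phi_reflect p h x1 Hh). fold s in PR. rewrite <- PR. unfold Phi.
        rewrite (tsum_ext (fun n => K p n * (sp (s x1) * sp (s (x1 + Z.of_nat n)%Z) - 1)) (fun n => (-1) * (K p n * (1 - sp (s x1) * sp (s (x1 + Z.of_nat n)%Z))))) by (intros; ring).
        rewrite (tsum_ext (fun n => K p n * (sp (s x1) * sp (s (x1 + - Z.of_nat n)%Z) - 1)) (fun n => (-1) * (K p n * (1 - sp (s x1) * sp (s (x1 - Z.of_nat n)%Z))))) by (intros; unfold Z.sub; ring).
        rewrite !tsum_scal; [ring| |].
        * apply (SK (fun n => 1 - sp (s x1) * sp (s (x1 - n)%Z))).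
          -- intros; rewrite Rabs_minus_sym; apply spp_bound.
          -- rewrite Z.sub_0_r, sp_sq. ring.
        * apply (SK (fun n => 1 - sp (s x1) * sp (s (x1 + n)%Z))).
          -- intros; rewrite Rabs_minus_sym; apply spp_bound.
          -- rewrite Z.add_0_r, sp_sq. ring. }
  assert (Nn : forall x1, lsumlist (fun y => sp (sigma_h h (x1, 0%Z)) * sp (sigma_h h y) - 1) (nbrs (x1, 0%Z)) =
     - (1 - sp (s x1) * sp (s (x1 + 1)%Z)) - (1 - sp (s (-1 - x1)%Z) * sp (s (-1 - x1 + 1)%Z))).
  { intros x1. unfold nbrs, lsumlist. cbn [fold_right fst snd]. rewrite !sigma_h_stp by auto. cbn [fst]. fold s. rewrite sp_sq.
    replace (-1 - x1 + 1)%Z with (-1 - (x1 - 1))%Z by ring. unfold s. rewrite !stp_reflect by auto.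
    destruct (stp h x1), (stp h (x1 - 1)); simpl; ring. }
  cbv zeta. rewrite lsl_map.
  rewrite (lsl_ext _ (fun k => / 2 * (site_energy p J s (0 + Z.of_nat k) + site_energy p J s (-1 - Z.of_nat k)))).
  2: { intros k _. rewrite Lr, Nn. unfold site_energy. rewrite Z.add_0_l. field. }
  rewrite lsl_scal, lsl_plus.
  assert (E1 := stp_window_energy p J h 0 2 Hp Hh). rewrite Z.mul_0_r in E1. fold s in E1. rewrite E1.
  assert (E2 := stp_window_energy p J h (-2) 2 Hp Hh). fold s in E2.
  rewrite lsl_seq_rev in E2.
  rewrite (lsl_ext _ (fun k => site_energy p J s (-1 - Z.of_nat k))) in E2.
  2: { intros k Hk. apply in_seq in Hk. f_equal. lia. }
  rewrite E2, mult_INR. simpl INR. field. apply not_0_INR; lia.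
Qed.

(** * Decomposition into rows, columns and corners *)

Definition padd (x d : site) : site := (fst x + fst d, snd x + snd d)%Z.
Definition psub (x d : site) : site := (fst x - fst d, snd x - snd d)%Z.
Definition horiz (d : site) : site := (fst d, 0%Z).
Definition vert (d : site) : site := (0%Z, snd d).
Definition trp (x : site) : site := (snd x, fst x).

Definition nn_ind (d : site) : R := if Z.eqb (fst d * fst d + snd d * snd d) 1 then 1 else 0.
Definition kap (p J : R) (d : site) : R := w p d - J * nn_ind d.

(** Relative to a reference that differs from [S] only on a finite set, pairs away from this set
    drop out; this makes the sums over all ordered pairs absolutely convergent. *)
Definition dP (S T : config) (x y : site) : R := sp (S x) * sp (S y) - sp (T x) * sp (T y).

Lemma padd_0 x : padd x (0, 0)%Z = x.
Proof. destruct x. unfold padd; simpl. f_equal; lia. Qed.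

Lemma padd_sub x d : psub (padd x d) d = x.
Proof. destruct x, d. unfold psub, padd; simpl. f_equal; lia. Qed.

Lemma psub_add x d : padd (psub x d) d = x.
Proof. destruct x, d. unfold psub, padd; simpl. f_equal; lia. Qed.

Lemma trp_trp x : trp (trp x) = x.
Proof. destruct x; auto. Qed.

Lemma dP_bound S T x y : Rabs (dP S T x y) <= 2.
Proof.
  unfold dP. destruct (S x), (S y), (T x), (T y); simpl; unfold Rabs; destruct Rcase_abs; lra.
Qed.

Lemma dP_diag S T x : dP S T x x = 0.
Proof. unfold dP. rewrite !sp_sq. ring. Qed.

Lemma dP_sym S T x y : dP S T x y = dP S T y x.
Proof. unfold dP. ring. Qed.

Lemma inX_spec X x : inX X x = true <-> In x X.
Proof.
  unfold inX. rewrite existsb_exists. split.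
  - intros [y [Hy E]]. apply site_eqb_spec in E. congruence.
  - intros H. exists x. split; auto. apply site_eqb_spec; auto.
Qed.

Definition chi (X : list site) (x : site) : R := if inX X x then 1 else 0.

Lemma summable_chi X : NoDup X -> summable (chi X).
Proof.
  intros HX. apply (summable_finite _ X HX). intros a Ha. unfold chi.
  destruct (inX X a) eqn:E; auto. apply inX_spec in E. tauto.
Qed.

Lemma dP_le_chi S T X x y : (forall z, ~ In z X -> S z = T z) ->
  Rabs (dP S T x y) <= 2 * (chi X x + chi X y).
Proof.
  intros H. assert (Bd := dP_bound S T x y). unfold chi.
  destruct (inX X x) eqn:E1; [destruct (inX X y); lra|]. destruct (inX X y) eqn:E2; [lra|].
  unfold dP. rewrite !H; [rewrite Rminus_diag, Rabs_R0; lra| |]; rewrite <- inX_spec; congruence.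
Qed.

Lemma summable_shift {D} (g : site -> R) (k : D -> R) (phi : D -> site) : summable g -> summable k ->
  summable (fun xd : site * D => g (padd (fst xd) (phi (snd xd))) * k (snd xd)).
Proof.
  intros Hg Hk.
  apply (summable_bij (fun xd : site * D => (psub (fst xd) (phi (snd xd)), snd xd))
                      (fun xd : site * D => (padd (fst xd) (phi (snd xd)), snd xd))).
  - intros [x d]; simpl. rewrite psub_add. auto.
  - intros [x d]; simpl. rewrite padd_sub. auto.
  - eapply summable_ext; [|apply (summable_prod g k Hg Hk)]. intros [x d]; simpl. rewrite psub_add. auto.
Qed.

Lemma unit_vector a b : (a * a + b * b = 1)%Z ->
  (a = 1 /\ b = 0 \/ a = -1 /\ b = 0 \/ a = 0 /\ b = 1 \/ a = 0 /\ b = -1)%Z.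
Proof. intros H. assert (-1 <= a <= 1)%Z by nia. assert (-1 <= b <= 1)%Z by nia. nia. Qed.

Lemma summable_nn : summable nn_ind.
Proof.
  apply (summable_finite _ (nbrs (0, 0)%Z)).
  - unfold nbrs; simpl. repeat constructor; simpl; intuition congruence.
  - intros [a b] Hab. unfold nn_ind. cbn [fst snd]. destruct (Z.eqb_spec (a * a + b * b) 1) as [E|E]; auto.
    exfalso. apply Hab. unfold nbrs; cbn [fst snd].
    destruct (unit_vector a b E) as [[-> ->]|[[-> ->]|[[-> ->]|[-> ->]]]]; simpl; auto.
Qed.

Lemma summable_kap p J : 3 < p -> summable (kap p J).
Proof.
  intros Hp. apply summable_minus; [apply summable_w; auto|]. apply summable_scal, summable_nn.
Qed.

Lemma summable_dP {D} (S T : config) X (k : D -> R) (phi psi : D -> site) : NoDup X ->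
  (forall z, ~ In z X -> S z = T z) -> summable k ->
  summable (fun xd : site * D => k (snd xd) * dP S T (padd (fst xd) (phi (snd xd))) (padd (fst xd) (psi (snd xd)))).
Proof.
  intros HX H Hk.
  apply summable_le with (fun xd : site * D => 2 * (chi X (padd (fst xd) (phi (snd xd))) * k (snd xd)) + 2 * (chi X (padd (fst xd) (psi (snd xd))) * k (snd xd))).
  - intros [x d]; simpl. rewrite Rabs_mult.
    replace (2 * (chi X (padd x (phi d)) * k d) + 2 * (chi X (padd x (psi d)) * k d)) with
      (k d * (2 * (chi X (padd x (phi d)) + chi X (padd x (psi d))))) by ring.
    rewrite Rabs_mult. apply Rmult_le_compat_l; [apply Rabs_pos|].
    eapply Rle_trans; [apply (dP_le_chi S T X _ _ H)|apply Rle_abs].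
  - apply summable_plus; apply summable_scal; apply summable_shift; auto using summable_chi.
Qed.

Definition k1 (p J : R) (n : nat) : R := K p n - J * (if Nat.eqb n 1 then 1 else 0).

Lemma summable_K p : 3 < p -> summable (K p).
Proof. intros. apply summable_nat_shift. apply (summable_K_from p 0); auto. Qed.

Lemma summable_kron c : summable (fun n : nat => c * (if Nat.eqb n 1 then 1 else 0)).
Proof.
  apply (summable_finite _ [1%nat]); [repeat constructor; auto|].
  intros n Hn. destruct (Nat.eqb_spec n 1); [|ring]. subst. exfalso; apply Hn; left; auto.
Qed.

Lemma summable_k1 p J : 3 < p -> summable (k1 p J).
Proof. intros. apply summable_minus; [apply summable_K; auto|apply summable_kron]. Qed.

Lemma tsum_kron (f : nat -> R) J : tsum (fun n => J * (if Nat.eqb n 1 then 1 else 0) * f n) = J * f 1%nat.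
Proof.
  rewrite (tsum_finite _ [1%nat]).
  - unfold lsumlist; simpl. ring.
  - repeat constructor; auto.
  - intros n Hn. destruct (Nat.eqb_spec n 1); [|ring]. subst. exfalso; apply Hn; left; auto.
Qed.

Lemma summable_mult_bdd {A} (k f : A -> R) C : summable k -> (forall a, Rabs (f a) <= C) -> summable (fun a => k a * f a).
Proof.
  intros Hk Hf. apply summable_le with (fun a => C * k a); [|apply summable_scal; auto].
  intros a. rewrite !Rabs_mult, Rmult_comm. apply Rmult_le_compat_r; [apply Rabs_pos|].
  eapply Rle_trans; [apply Hf|apply Rle_abs].
Qed.

Lemma tsum_k1 p J (f : nat -> R) C : 3 < p -> (forall n, Rabs (f n) <= C) ->
  tsum (fun n => k1 p J n * f n) = tsum (fun n => K p n * f n) - J * f 1%nat.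
Proof.
  intros Hp Hf. rewrite <- tsum_kron, <- tsum_minus.
  - apply tsum_ext. intros n. unfold k1. ring.
  - apply summable_mult_bdd with C; auto. apply summable_K; auto.
  - apply summable_mult_bdd with C; auto. apply summable_kron.
Qed.

Lemma column_sum_kap p J (f : Z -> R) C : 3 < p -> (forall n, Rabs (f n) <= C) -> f 0%Z = 0 ->
  tsum (fun d : site => kap p J d * f (fst d)) =
   tsum (fun n => k1 p J n * f (Z.of_nat n)) + tsum (fun n => k1 p J n * f (- Z.of_nat n)%Z).
Proof.
  intros Hp Hf H0. destruct (column_sum p f C Hp Hf H0) as [S1 E1].
  rewrite (tsum_k1 p J (fun n => f (Z.of_nat n)) C), (tsum_k1 p J (fun n => f (- Z.of_nat n)%Z) C) by auto.
  rewrite (tsum_ext _ (fun d => w p d * f (fst d) - J * (nn_ind d * f (fst d)))) by (intros; unfold kap; ring).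
  assert (S2 : summable (fun d : site => nn_ind d * f (fst d))).
  { apply (summable_mult_bdd nn_ind (fun d : site => f (fst d)) C); auto. apply summable_nn. }
  rewrite tsum_minus, E1, tsum_scal; auto; [|apply summable_scal; auto].
  assert (E2 : tsum (fun d : site => nn_ind d * f (fst d)) = f 1%Z + f (-1)%Z).
  { rewrite (tsum_finite _ (nbrs (0, 0)%Z)).
    - unfold nbrs, lsumlist, nn_ind; simpl. rewrite H0. ring.
    - unfold nbrs; simpl. repeat constructor; simpl; intuition congruence.
    - intros [a b] Hab. unfold nn_ind. cbn [fst snd]. destruct (Z.eqb_spec (a * a + b * b) 1) as [E|E]; [|ring].
      destruct (Z.eq_dec a 0) as [->|Ha]; [rewrite H0; ring|]. exfalso. apply Hab. unfold nbrs; cbn [fst snd].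
      assert (A : (a = 1 /\ b = 0 \/ a = -1 /\ b = 0)%Z).
      { destruct (unit_vector a b E) as [A|[A|[A|A]]]; lia. }
      destruct A as [[-> ->]|[-> ->]]; simpl; auto. }
  rewrite E2. simpl. ring.
Qed.

Definition row (s : config) (y : Z) : Z -> bool := fun i => s (i, y).
Definition col (s : config) (x : Z) : Z -> bool := fun i => s (x, i).

Definition nshift (n : nat) : site := (Z.of_nat n, 0%Z).

Lemma row_site_energy p J S T i y : 3 < p ->
  tsum (fun n => k1 p J n * dP S T (i, y) (padd (i, y) (nshift n))) =
  site_energy p J (row S y) i - site_energy p J (row T y) i.
Proof.
  intros Hp. rewrite (tsum_k1 p J (fun n => dP S T (i, y) (padd (i, y) (nshift n))) 2) by (auto using dP_bound).
  unfold site_energy, Phi, row, dP, padd, nshift. cbn [fst snd].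
  assert (B1 : forall (s : config), summable (fun n => K p n * (1 - sp (s (i, y)) * sp (s (i + Z.of_nat n, y)%Z)))).
  { intros s. apply summable_mult_bdd with 2; [apply summable_K; auto|].
    intros n. rewrite Rabs_minus_sym. apply spp_bound. }
  rewrite !Z.add_0_r.
  rewrite (tsum_ext _ (fun n => K p n * (1 - sp (T (i, y)) * sp (T (i + Z.of_nat n, y)%Z)) - K p n * (1 - sp (S (i, y)) * sp (S (i + Z.of_nat n, y)%Z)))) by (intros; ring).
  rewrite tsum_minus by auto. simpl Z.of_nat. ring.
Qed.

(** Summing over the vertical part of [d] turns [kap] into the one-dimensional kernel [k1]. Each
    horizontal pair is then seen from both ends; a translation ([Epm]) identifies the two halves,
    which cancels the factor [/ 2]. *)
Lemma half_row_sum p J S T X : 3 < p -> NoDup X -> (forall z, ~ In z X -> S z = T z) ->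
  let rho := fun y i => site_energy p J (row S y) i - site_energy p J (row T y) i in
  summable (fun xd : site * site => kap p J (snd xd) * dP S T (fst xd) (padd (fst xd) (horiz (snd xd)))) /\
  (forall y, summable (rho y)) /\ summable (fun y => tsum (rho y)) /\
  / 2 * tsum (fun xd : site * site => kap p J (snd xd) * dP S T (fst xd) (padd (fst xd) (horiz (snd xd)))) =
  tsum (fun y => tsum (rho y)).
Proof.
  intros Hp HX H rho.
  assert (S0 : summable (fun xd : site * site => kap p J (snd xd) * dP S T (fst xd) (padd (fst xd) (horiz (snd xd))))).
  { eapply summable_ext; [|apply (summable_dP S T X (kap p J) (fun _ => (0, 0)%Z) horiz HX H (summable_kap p J Hp))].
    intros [x d]; cbn [fst snd]. rewrite padd_0. auto. }
  assert (Sp : summable (fun xn : site * nat => k1 p J (snd xn) * dP S T (fst xn) (padd (fst xn) (nshift (snd xn))))).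
  { eapply summable_ext; [|apply (summable_dP S T X (k1 p J) (fun _ => (0, 0)%Z) nshift HX H (summable_k1 p J Hp))].
    intros [x d]; cbn [fst snd]. rewrite padd_0. auto. }
  assert (Sm : summable (fun xn : site * nat => k1 p J (snd xn) * dP S T (fst xn) (psub (fst xn) (nshift (snd xn))))).
  { eapply summable_ext; [|apply (summable_dP S T X (k1 p J) (fun _ => (0, 0)%Z) (fun n => psub (0, 0)%Z (nshift n)) HX H (summable_k1 p J Hp))].
    intros [x d]; cbn [fst snd]. rewrite padd_0. do 2 f_equal; unfold padd, psub; cbn [fst snd]; f_equal; lia. }
  destruct (tsum_fubini _ S0) as [_ [S1 E1]]. destruct (tsum_fubini _ Sp) as [_ [Sp1 Ep1]].
  destruct (tsum_fubini _ Sm) as [_ [Sm1 Em1]]. cbn [fst snd] in *.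
  assert (Epm : tsum (fun xn : site * nat => k1 p J (snd xn) * dP S T (fst xn) (psub (fst xn) (nshift (snd xn)))) =
     tsum (fun xn : site * nat => k1 p J (snd xn) * dP S T (fst xn) (padd (fst xn) (nshift (snd xn))))).
  { rewrite <- (tsum_bij (fun xd : site * nat => (psub (fst xd) (nshift (snd xd)), snd xd))
                      (fun xd : site * nat => (padd (fst xd) (nshift (snd xd)), snd xd))
                      (fun xn : site * nat => k1 p J (snd xn) * dP S T (fst xn) (padd (fst xn) (nshift (snd xn))))); auto.
    - apply tsum_ext. intros [x n]; cbn [fst snd]. rewrite psub_add, dP_sym. auto.
    - intros [x n]; cbn [fst snd]. rewrite psub_add; auto.
    - intros [x n]; cbn [fst snd]. rewrite padd_sub; auto. }
  assert (EI : forall x, tsum (fun d => kap p J d * dP S T x (padd x (horiz d))) =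
     tsum (fun n => k1 p J n * dP S T x (padd x (nshift n))) + tsum (fun n => k1 p J n * dP S T x (psub x (nshift n)))).
  { intros x. rewrite (tsum_ext (fun n => k1 p J n * dP S T x (psub x (nshift n))) (fun n => k1 p J n * dP S T x (padd x (- Z.of_nat n, 0)%Z))).
    - apply (column_sum_kap p J (fun n => dP S T x (padd x (n, 0%Z))) 2); auto using dP_bound.
      rewrite padd_0. apply dP_diag.
    - intros n. reflexivity. }
  assert (ER : forall x, tsum (fun n => k1 p J n * dP S T x (padd x (nshift n))) = rho (snd x) (fst x)).
  { intros [i y]. apply row_site_energy; auto. }
  assert (Sr : summable (fun x : site => rho (snd x) (fst x))).
  { apply (summable_ext _ _ ER); auto. }
  assert (Sr' : summable (fun yi : Z * Z => rho (fst yi) (snd yi))).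
  { apply (summable_inj (fun yi : Z * Z => ((snd yi, fst yi) : site)) (fun x : site => rho (snd x) (fst x))); auto.
    intros [] []; simpl; congruence. }
  destruct (tsum_fubini _ Sr') as [T1 [T2 T3]]. cbn [fst snd] in *.
  split; [auto|split; [auto|split; [auto|]]].
  rewrite E1, (tsum_ext _ _ EI), tsum_plus by auto. rewrite <- Em1, Epm, Ep1, (tsum_ext _ _ ER).
  assert (E5 : tsum (fun x : site => rho (snd x) (fst x)) = tsum (fun yi : Z * Z => rho (fst yi) (snd yi))).
  { symmetry. apply (tsum_bij (fun yi : Z * Z => ((snd yi, fst yi) : site)) (fun x : site => (snd x, fst x)) (fun x : site => rho (snd x) (fst x))); auto.
    - intros []; auto.
    - intros []; auto. }
  rewrite E5, T3.
  match goal with |- / 2 * (?a + _) = ?b => change b with a end. field.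
Qed.

Lemma kap_trp p J d : kap p J (trp d) = kap p J d.
Proof.
  destruct d as [a b]. unfold kap, trp, nn_ind. cbn [fst snd]. rewrite w_swap. do 3 f_equal.
  rewrite Z.add_comm. auto.
Qed.

Lemma half_col_sum p J S T X : 3 < p -> NoDup X -> (forall z, ~ In z X -> S z = T z) ->
  let rho := fun x i => site_energy p J (col S x) i - site_energy p J (col T x) i in
  summable (fun xd : site * site => kap p J (snd xd) * dP S T (fst xd) (padd (fst xd) (vert (snd xd)))) /\
  (forall y, summable (rho y)) /\ summable (fun y => tsum (rho y)) /\
  / 2 * tsum (fun xd : site * site => kap p J (snd xd) * dP S T (fst xd) (padd (fst xd) (vert (snd xd)))) =
  tsum (fun y => tsum (rho y)).
Proof.
  intros Hp HX H rho.
  destruct (half_row_sum p J (fun x => S (trp x)) (fun x => T (trp x)) (map trp X) Hp) as [A1 [A2 [A3 A4]]].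
  - apply lsl_map_inj; auto. intros a b E. rewrite <- (trp_trp a), E, trp_trp. auto.
  - intros z Hz. apply H. intros Hi. apply Hz. rewrite <- (trp_trp z). apply in_map; auto.
  - set (tt := fun xd : site * site => (trp (fst xd), trp (snd xd))).
    assert (TT : forall xd, tt (tt xd) = xd) by (intros [x d]; unfold tt; simpl; rewrite !trp_trp; auto).
    assert (E : forall xd : site * site, kap p J (snd xd) * dP (fun x => S (trp x)) (fun x => T (trp x)) (fst xd) (padd (fst xd) (horiz (snd xd))) =
       (fun xd : site * site => kap p J (snd xd) * dP S T (fst xd) (padd (fst xd) (vert (snd xd)))) (tt xd)).
    { intros [x d]. unfold tt; cbn [fst snd]. rewrite kap_trp. f_equal. }
    assert (S1 : summable (fun xd : site * site => kap p J (snd xd) * dP S T (fst xd) (padd (fst xd) (vert (snd xd))))).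
    { apply (summable_bij tt tt); auto. apply (summable_ext _ _ E). auto. }
    split; auto. split; [|split]; auto.
    rewrite (tsum_ext _ _ E) in A4. rewrite (tsum_bij tt tt _ TT TT S1) in A4. exact A4.
Qed.

Lemma kap_pair p J x y : x <> y ->
  kap p J (psub y x) = / distp p x y - J * (if nnb x y then 1 else 0).
Proof.
  intros H. unfold kap. unfold psub at 1. rewrite w_distp by auto. do 2 f_equal.
  unfold nn_ind, psub, nnb, dist2. cbn [fst snd].
  replace ((fst y - fst x) * (fst y - fst x) + (snd y - snd x) * (snd y - snd x))%Z with
    ((fst x - fst y) * (fst x - fst y) + (snd x - snd y) * (snd x - snd y))%Z by ring. auto.
Qed.

Lemma lexltb_irrefl x : lexltb x x = false.
Proof. unfold lexltb. rewrite !Z.ltb_irrefl. rewrite Bool.andb_false_r. auto. Qed.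

Lemma lexltb_total x y : x <> y -> lexltb y x = negb (lexltb x y).
Proof.
  destruct x as [a b], y as [c d]. unfold lexltb; cbn [fst snd]. intros H.
  destruct (Z.ltb_spec a c), (Z.ltb_spec c a), (Z.eqb_spec a c), (Z.eqb_spec c a), (Z.ltb_spec b d), (Z.ltb_spec d b); simpl; auto; try lia.
  exfalso. apply H. f_equal; lia.
Qed.

Lemma nbrs_nnb x y : In y (nbrs x) <-> nnb x y = true.
Proof.
  destruct x as [a b], y as [c d]. unfold nbrs, nnb, dist2. cbn [fst snd]. rewrite Z.eqb_eq. split.
  - intros [E|[E|[E|[E|[]]]]]; inversion E; ring.
  - intros E.
    assert (A : (c = a + 1 /\ d = b \/ c = a - 1 /\ d = b \/ c = a /\ d = b + 1 \/ c = a /\ d = b - 1)%Z).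
    { destruct (unit_vector _ _ E) as [A|[A|[A|A]]]; lia. }
    destruct A as [[-> ->]|[[-> ->]|[[-> ->]|[-> ->]]]]; simpl; auto.
Qed.

Lemma NoDup_nbrs x : NoDup (nbrs x).
Proof.
  unfold nbrs. repeat constructor; cbn [In]; intros A;
  repeat (destruct A as [A|A]; [apply pair_equal_spec in A; lia|]); auto.
Qed.

Lemma H_difference p J X s t : 3 < p -> NoDup X ->
  let S := glue X s t in
  H p J X s t - H p J X t t =
  lsumlist (fun x => lsumlist (fun y => if lexltb x y then kap p J (psub y x) * dP S t x y else 0) X) X +
  lsumlist (fun x => tsum (fun y => if inX X y then 0 else kap p J (psub y x) * dP S t x y)) X.
Proof.
  intros Hp HX S.
  assert (SX : forall x, In x X -> S x = s x) by (intros x Hx; unfold S, glue; apply inX_spec in Hx; rewrite Hx; auto).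
  assert (SY : forall x, inX X x = false -> S x = t x) by (intros x Hx; unfold S, glue; rewrite Hx; auto).
  assert (Sw : forall x, summable (fun y => w p (psub y x))).
  { intros x. apply (summable_inj (fun y => psub y x) (w p)); [|apply summable_w; auto].
    intros a b E. rewrite <- (psub_add a x), E, psub_add; auto. }
  assert (LS : forall (s' : config) x, summable (fun y => if inX X y then 0 else (sp (s' x) * sp (t y) - 1) / distp p x y) ->
     lsum (fun y => if inX X y then 0 else (sp (s' x) * sp (t y) - 1) / distp p x y) =
     tsum (fun y => if inX X y then 0 else (sp (s' x) * sp (t y) - 1) / distp p x y)) by (intros; apply lsum_tsum; auto).
  assert (SL : forall (s' : config) x, In x X -> summable (fun y => if inX X y then 0 else (sp (s' x) * sp (t y) - 1) / distp p x y)).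
  { intros s' x Hx. apply summable_le with (fun y => 2 * w p (psub y x)); [|apply summable_scal; auto].
    intros y. destruct (inX X y) eqn:E; [rewrite Rabs_R0; apply Rabs_pos|].
    assert (N : x <> y) by (intros ->; apply inX_spec in Hx; congruence).
    unfold Rdiv. rewrite <- (w_distp p x y N), !Rabs_mult. apply Rmult_le_compat_r; [apply Rabs_pos|].
    eapply Rle_trans; [apply spp_bound|apply Rle_abs]. }
  assert (E1 : forall x y, lexltb x y = true -> x <> y) by (intros x y E ->; rewrite lexltb_irrefl in E; discriminate).
  unfold H.
  match goal with |- (- J * ?a1 + ?b1 - J * ?c1 + ?d1) - (- J * ?a2 + ?b2 - J * ?c2 + ?d2) = _ =>
    transitivity ((- J * (a1 - a2) + (b1 - b2)) + ((- J) * (c1 - c2) + (d1 - d2))); [ring|] end.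
  f_equal.
  - rewrite <- !lsl_minus, <- lsl_scal, <- lsl_plus. apply lsl_ext. intros x Hx.
    rewrite <- !lsl_minus, <- lsl_scal, <- lsl_plus. apply lsl_ext. intros y Hy.
    destruct (lexltb x y) eqn:E; simpl; [|ring].
    rewrite kap_pair by auto. unfold dP. rewrite !SX by auto. destruct (nnb x y); unfold Rdiv; ring.
  - rewrite <- !lsl_minus, <- lsl_scal, <- lsl_plus. apply lsl_ext. intros x Hx.
    rewrite !LS by auto. rewrite <- tsum_minus by auto.
    rewrite <- lsl_minus.
    assert (Nb : lsumlist (fun y => (if inX X y then 0 else sp (s x) * sp (t y) - 1) - (if inX X y then 0 else sp (t x) * sp (t y) - 1)) (nbrs x) =
       tsum (fun y => if nnb x y then ((if inX X y then 0 else sp (s x) * sp (t y) - 1) - (if inX X y then 0 else sp (t x) * sp (t y) - 1)) else 0)).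
    { rewrite (tsum_finite _ (nbrs x)).
      - apply lsl_ext. intros y Hy. apply nbrs_nnb in Hy. rewrite Hy. auto.
      - apply NoDup_nbrs.
      - intros y Hy. destruct (nnb x y) eqn:E; auto. apply nbrs_nnb in E. tauto. }
    rewrite Nb. clear Nb.
    assert (Sn : summable (fun y => if nnb x y then ((if inX X y then 0 else sp (s x) * sp (t y) - 1) - (if inX X y then 0 else sp (t x) * sp (t y) - 1)) else 0)).
    { apply (summable_finite _ (nbrs x)); [apply NoDup_nbrs|]. intros y Hy. destruct (nnb x y) eqn:E; auto. apply nbrs_nnb in E. tauto. }
    rewrite <- tsum_scal by auto. rewrite <- tsum_plus; [|apply summable_scal; auto|apply summable_minus; auto].
    apply tsum_ext. intros y. destruct (inX X y) eqn:E.
    + destruct (nnb x y); ring.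
    + assert (N : x <> y) by (intros ->; apply inX_spec in Hx; congruence).
      rewrite kap_pair by auto. unfold dP. rewrite SX, SY by auto. destruct (nnb x y); unfold Rdiv; ring.
Qed.

Lemma kap_opp p J x y : kap p J (psub y x) = kap p J (psub x y).
Proof.
  unfold kap, psub. f_equal.
  - replace (fst y - fst x)%Z with (- (fst x - fst y))%Z by ring. rewrite w_opp_l.
    replace (snd y - snd x)%Z with (- (snd x - snd y))%Z by ring. rewrite w_opp_r. auto.
  - unfold nn_ind. cbn [fst snd]. f_equal.
    replace ((fst y - fst x) * (fst y - fst x) + (snd y - snd x) * (snd y - snd x))%Z with
    ((fst x - fst y) * (fst x - fst y) + (snd x - snd y) * (snd x - snd y))%Z by ring. auto.
Qed.

(** Among ordered pairs, those inside [X] occur twice, those joining [X] to its complement once in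
    each order, and the others contribute nothing. *)
Lemma half_pair_sum p J X S T : 3 < p -> NoDup X -> (forall z, ~ In z X -> S z = T z) ->
  lsumlist (fun x => lsumlist (fun y => if lexltb x y then kap p J (psub y x) * dP S T x y else 0) X) X +
  lsumlist (fun x => tsum (fun y => if inX X y then 0 else kap p J (psub y x) * dP S T x y)) X =
  / 2 * tsum (fun xd : site * site => kap p J (snd xd) * dP S T (fst xd) (padd (fst xd) (snd xd))).
Proof.
  intros Hp HX HST.
  set (U := fun xy : site * site => kap p J (psub (snd xy) (fst xy)) * dP S T (fst xy) (snd xy)).
  assert (SV : summable (fun xd : site * site => kap p J (snd xd) * dP S T (fst xd) (padd (fst xd) (snd xd)))).
  { eapply summable_ext; [|apply (summable_dP S T X (kap p J) (fun _ => (0, 0)%Z) (fun d => d) HX HST (summable_kap p J Hp))].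
    intros [x d]; cbn [fst snd]. rewrite padd_0. auto. }
  set (g := fun xd : site * site => (fst xd, padd (fst xd) (snd xd))).
  set (g' := fun xy : site * site => (fst xy, psub (snd xy) (fst xy))).
  assert (G1 : forall xd, g' (g xd) = xd).
  { intros [[a b] [c d]]. unfold g, g', padd, psub; cbn [fst snd]. repeat f_equal; lia. }
  assert (G2 : forall xy, g (g' xy) = xy).
  { intros [[a b] [c d]]. unfold g, g', padd, psub; cbn [fst snd]. repeat f_equal; lia. }
  assert (EU : forall xd, kap p J (snd xd) * dP S T (fst xd) (padd (fst xd) (snd xd)) = U (g xd)).
  { intros [x d]. unfold U, g; cbn [fst snd]. do 2 f_equal. destruct x, d; unfold padd, psub; cbn [fst snd]; f_equal; lia. }
  assert (SU : summable U).
  { apply (summable_bij g g'); auto. apply (summable_ext _ _ EU). auto. }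
  rewrite (tsum_ext _ _ EU), (tsum_bij g g' U G1 G2 SU).
  assert (Usym : forall x y, U (x, y) = U (y, x)).
  { intros x y. unfold U; cbn [fst snd]. rewrite kap_opp, dP_sym. auto. }
  set (U1 := fun xy : site * site => if inX X (fst xy) then (if inX X (snd xy) then U xy else 0) else 0).
  set (U2 := fun xy : site * site => if inX X (fst xy) then (if inX X (snd xy) then 0 else U xy) else 0).
  set (U3 := fun xy : site * site => if inX X (fst xy) then 0 else (if inX X (snd xy) then U xy else 0)).
  assert (R : forall V, (forall xy, V xy = U xy \/ V xy = 0) -> summable V).
  { intros V HV. apply summable_le with U; auto. intros xy. destruct (HV xy) as [-> | ->]; [lra|]. rewrite Rabs_R0. apply Rabs_pos. }
  assert (S1 : summable U1) by (apply R; intros xy; unfold U1; destruct (inX X (fst xy)), (inX X (snd xy)); auto).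
  assert (S2 : summable U2) by (apply R; intros xy; unfold U2; destruct (inX X (fst xy)), (inX X (snd xy)); auto).
  assert (S3 : summable U3) by (apply R; intros xy; unfold U3; destruct (inX X (fst xy)), (inX X (snd xy)); auto).
  assert (E : forall xy, U xy = U1 xy + (U2 xy + U3 xy)).
  { intros [x y]. unfold U1, U2, U3; cbn [fst snd]. destruct (inX X x) eqn:Ex, (inX X y) eqn:Ey; try ring.
    unfold U; cbn [fst snd]. unfold dP. rewrite !HST; [ring| |]; rewrite <- inX_spec; congruence. }
  rewrite (tsum_ext _ _ E), tsum_plus, tsum_plus; auto; [|apply summable_plus; auto].
  assert (E3 : tsum U3 = tsum U2).
  { rewrite <- (tsum_bij (fun xy : site * site => (snd xy, fst xy)) (fun xy : site * site => (snd xy, fst xy)) U2); auto.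
    - apply tsum_ext. intros [x y]. unfold U2, U3; cbn [fst snd]. rewrite (Usym y x). destruct (inX X x), (inX X y); auto.
    - intros []; auto.
    - intros []; auto. }
  assert (E2 : tsum U2 = lsumlist (fun x => tsum (fun y => if inX X y then 0 else kap p J (psub y x) * dP S T x y)) X).
  { destruct (tsum_fubini U2 S2) as [_ [_ ->]]. rewrite (tsum_finite _ X HX).
    - apply lsl_ext. intros x Hx. apply tsum_ext. intros y. unfold U2; cbn [fst snd]. apply inX_spec in Hx. rewrite Hx. auto.
    - intros x Hx. rewrite (tsum_finite _ []); auto; [constructor|]. intros y _. unfold U2; cbn [fst snd].
      destruct (inX X x) eqn:Ex; auto. apply inX_spec in Ex. tauto. }
  assert (E1 : tsum U1 = 2 * lsumlist (fun x => lsumlist (fun y => if lexltb x y then kap p J (psub y x) * dP S T x y else 0) X) X).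
  { rewrite (tsum_finite _ (list_prod X X)).
    - rewrite lsl_prod, <- Rplus_diag. rewrite (lsl_swap (fun x y => if lexltb x y then kap p J (psub y x) * dP S T x y else 0)) at 2.
      rewrite <- lsl_plus. apply lsl_ext. intros x Hx. rewrite <- lsl_plus. apply lsl_ext. intros y Hy.
      unfold U1; cbn [fst snd]. apply inX_spec in Hx, Hy. rewrite Hx, Hy.
      rewrite (kap_opp p J y x), (dP_sym S T y x). unfold U; cbn [fst snd].
      destruct (eqd x y) as [<-|N]; [rewrite dP_diag; destruct lexltb; ring|].
      rewrite (lexltb_total x y N). destruct (lexltb x y); simpl; ring.
    - apply NoDup_list_prod; auto.
    - intros [x y] Hxy. unfold U1; cbn [fst snd]. destruct (inX X x) eqn:Ex, (inX X y) eqn:Ey; auto.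
      exfalso. apply Hxy. apply in_prod; apply inX_spec; auto. }
  rewrite E1, E3, E2.
  match goal with |- ?a + ?b = / 2 * (2 * ?a' + (?b' + _)) => change a' with a; change b' with b end. field.
Qed.

Lemma energy_decomposition p J X s t : 3 < p -> NoDup X ->
  (forall x y y', t (x, y) = t (x, y')) ->
  let S := glue X s t in
  let C := fun xd : site * site =>
     (1 - sp (S (fst xd)) * sp (S (padd (fst xd) (horiz (snd xd))))) *
     (1 - sp (S (padd (fst xd) (horiz (snd xd)))) * sp (S (padd (fst xd) (snd xd)))) in
  summable (fun xd => w p (snd xd) * C xd) /\
  H p J X s t - H p J X t t =
   tsum (fun y => tsum (fun i => site_energy p J (row S y) i - site_energy p J (row t y) i)) +
   tsum (fun x => tsum (fun i => site_energy p J (col S x) i - site_energy p J (col t x) i)) +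
   / 2 * tsum (fun xd => w p (snd xd) * C xd).
Proof.
  intros Hp HX Ht S C.
  assert (HST : forall z, ~ In z X -> S z = t z).
  { intros z Hz. unfold S, glue. destruct (inX X z) eqn:E; auto. apply inX_spec in E. tauto. }
  rewrite (H_difference p J X s t Hp HX). fold S. rewrite half_pair_sum by auto.
  destruct (half_row_sum p J S t X Hp HX HST) as [R1 [_ [_ <-]]].
  destruct (half_col_sum p J S t X Hp HX HST) as [C1 [_ [_ <-]]].
  (* The vertical leg of the path begins at the corner [z] and not at [x]; a translation by
     [horiz d] aligns the column sum with it. *)
  set (hs := fun xd : site * site => (padd (fst xd) (horiz (snd xd)), snd xd)).
  set (hs' := fun xd : site * site => (psub (fst xd) (horiz (snd xd)), snd xd)).
  assert (G1 : forall xd, hs' (hs xd) = xd) by (intros [x d]; unfold hs, hs'; cbn [fst snd]; rewrite padd_sub; auto).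
  assert (G2 : forall xd, hs (hs' xd) = xd) by (intros [x d]; unfold hs, hs'; cbn [fst snd]; rewrite psub_add; auto).
  rewrite <- (tsum_bij hs hs' _ G1 G2 C1).
  assert (C2 : summable (fun xd => kap p J (snd (hs xd)) * dP S t (fst (hs xd)) (padd (fst (hs xd)) (vert (snd (hs xd)))))).
  { apply (summable_bij hs' hs); auto. eapply summable_ext; [|apply C1]. intros xd. cbv beta. rewrite G2. auto. }
  assert (SV : summable (fun xd : site * site => kap p J (snd xd) * dP S t (fst xd) (padd (fst xd) (snd xd)))).
  { eapply summable_ext; [|apply (summable_dP S t X (kap p J) (fun _ => (0, 0)%Z) (fun d => d) HX HST (summable_kap p J Hp))].
    intros [x d]; cbn [fst snd]. rewrite padd_0. auto. }
  assert (EC : forall xd, w p (snd xd) * C xd =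
     kap p J (snd xd) * dP S t (fst xd) (padd (fst xd) (snd xd))
     - kap p J (snd xd) * dP S t (fst xd) (padd (fst xd) (horiz (snd xd)))
     - kap p J (snd (hs xd)) * dP S t (fst (hs xd)) (padd (fst (hs xd)) (vert (snd (hs xd))))).
  { intros [x d]. unfold hs, C; cbn [fst snd]. set (z := padd x (horiz d)).
    replace (padd z (vert d)) with (padd x d).
    2: { unfold z, padd, horiz, vert. destruct x, d; cbn [fst snd]. f_equal; lia. }
    set (y := padd x d).
    (* [z] and [y] lie in one column, where the reference is constant: the reference has no rest,
       and only that of [S] survives. *)
    assert (Ez : t z = t y) by (unfold z, y, padd, horiz; destruct x, d; cbn [fst snd]; rewrite (Ht _ _ (z1 + z3)%Z); f_equal; f_equal; lia).
    assert (ED : dP S t x y - dP S t x z - dP S t z y = (1 - sp (S x) * sp (S z)) * (1 - sp (S z) * sp (S y))).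
    { unfold dP. rewrite Ez, sp_sq.
      replace (1 - sp (t y) * sp (t y)) with 0 by (rewrite sp_sq; ring).
      transitivity (1 - sp (S x) * sp (S z) - sp (S z) * sp (S y) + sp (S x) * sp (S y) * (sp (S z) * sp (S z))); [rewrite sp_sq; ring|ring]. }
    rewrite <- !Rmult_minus_distr_l, ED. unfold kap, nn_ind.
    destruct (Z.eqb_spec (fst d * fst d + snd d * snd d) 1) as [E|E]; [|ring].
    (* A nearest-neighbour displacement is parallel to an axis, so one leg of the path is trivial
       and [C] vanishes: [J] does not enter the rest. *)
    assert (A : (fst d = 0 \/ snd d = 0)%Z).
    { destruct (unit_vector _ _ E) as [A|[A|[A|A]]]; lia. }
    destruct A as [A|A].
    - replace z with x; [rewrite sp_sq; ring|]. unfold z, padd, horiz. rewrite A. destruct x; cbn [fst snd]; f_equal; lia.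
    - replace y with z; [rewrite sp_sq; ring|]. unfold z, y, padd, horiz. rewrite A. auto. }
  split.
  - apply (summable_ext _ _ (fun xd => eq_sym (EC xd))). repeat apply summable_minus; auto.
  - rewrite (tsum_ext _ _ EC), !tsum_minus; auto; [ring|apply summable_minus; auto].
Qed.

(** * Corners *)

Lemma lsl_support_le {A} (f : A -> R) L M : NoDup L -> NoDup M ->
  (forall a, 0 <= f a) -> (forall a, ~ In a L -> f a = 0) -> lsumlist f M <= lsumlist f L.
Proof.
  intros HL HM H0 Hf. destruct (nodup_ext_list L M) as [P [P1 [P2 P3]]].
  rewrite (lsl_incl_eq f L P) by auto. apply lsl_incl_le; auto.
Qed.

Lemma lsl_ge_term {A} (f : A -> R) L a : (forall b, 0 <= f b) -> In a L -> f a <= lsumlist f L.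
Proof.
  intros H0. induction L as [|b L IH]; intros Ha; [destruct Ha|].
  change (f a <= f b + lsumlist f L). assert (0 <= lsumlist f L) by (apply lsl_nonneg; auto).
  destruct Ha as [->|Ha]; [lra|]. specialize (IH Ha). specialize (H0 b). lra.
Qed.

Definition flat (s00 s10 s01 s11 : bool) : Prop := (s00 = s10 /\ s01 = s11) \/ (s00 = s01 /\ s10 = s11).

Lemma corners_flat sg a b : corners sg (a, b) = 0%nat ->
  flat (sg (a, b)) (sg (a + 1, b)%Z) (sg (a, b + 1)%Z) (sg (a + 1, b + 1)%Z).
Proof.
  unfold corners, flat. cbn [fst snd].
  destruct (sg (a, b)), (sg (a + 1, b)%Z), (sg (a, b + 1)%Z), (sg (a + 1, b + 1)%Z); simpl; intros; auto; discriminate.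
Qed.

Lemma corners_trp sg v : corners (fun x => sg (trp x)) v = corners sg (trp v).
Proof.
  destruct v as [a b]. unfold corners, trp. cbn [fst snd].
  destruct (sg (b, a)), (sg (b + 1, a)%Z), (sg (b, a + 1)%Z), (sg (b + 1, a + 1)%Z); reflexivity.
Qed.

(** Position, in the unit square around a vertex, of the site from which the diagonal [d] crosses
    the square. *)
Definition off (d : site) : site := ((1 - fst d) / 2, (1 - snd d) / 2)%Z.
Definition diags : list site := [(1, 1); (-1, 1); (1, -1); (-1, -1)]%Z.

Lemma w_diag p d : In d diags -> w p d = Rpower 2 (- (p / 2)).
Proof. intros [<-|[<-|[<-|[<-|[]]]]]; unfold w; simpl; rewrite Rpower_Ropp; auto. Qed.

(** Of the rest, only the L-shaped paths across unit squares are kept. In each square every site is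
    the corner [z] of exactly one of the four paths, and a path contributes [4] when both of its
    steps flip the spin. A simple corner has one such site, a chopped vertex has four. *)
Lemma corner_term p (S : config) V : NoDup V ->
  let C := fun xd : site * site =>
     (1 - sp (S (fst xd)) * sp (S (padd (fst xd) (horiz (snd xd))))) *
     (1 - sp (S (padd (fst xd) (horiz (snd xd)))) * sp (S (padd (fst xd) (snd xd)))) in
  summable (fun xd => w p (snd xd) * C xd) ->
  2 * Rpower 2 (- (p / 2)) * lsumlist (fun v => INR (corners S v)) V <= / 2 * tsum (fun xd => w p (snd xd) * C xd).
Proof.
  intros HV C Hs.
  assert (C0 : forall xd, 0 <= C xd).
  { intros [x d]. unfold C. apply Rmult_le_pos.
    - destruct (S (fst (x, d))), (S (padd (fst (x, d)) (horiz (snd (x, d))))); simpl; lra.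
    - destruct (S (padd (fst (x, d)) (horiz (snd (x, d))))), (S (padd (fst (x, d)) (snd (x, d)))); simpl; lra. }
  set (g := fun vd : site * site => (padd (fst vd) (off (snd vd)), snd vd)).
  assert (L1 : lsumlist (fun xd => w p (snd xd) * C xd) (map g (list_prod V diags)) <= tsum (fun xd => w p (snd xd) * C xd)).
  { apply tsum_ge_finite; auto.
    - apply lsl_map_inj.
      + intros [v d] [v' d']. unfold g; cbn [fst snd]. intros E. injection E. intros; subst.
        f_equal. rewrite <- (padd_sub v (off d')), <- (padd_sub v' (off d')). congruence || (f_equal; unfold padd; cbn [fst snd]; f_equal; auto).
      + apply NoDup_list_prod; auto. unfold diags. repeat constructor; simpl; intuition congruence.
    - intros a _. apply Rmult_le_pos; auto using w_nonneg. }
  rewrite lsl_map, lsl_prod in L1.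
  assert (L2 : lsumlist (fun v => 4 * Rpower 2 (- (p / 2)) * INR (corners S v)) V <=
      lsumlist (fun a => lsumlist (fun b => w p (snd (g (a, b))) * C (g (a, b))) diags) V).
  { apply lsl_le. intros [a b] _.
    rewrite (lsl_ext _ (fun d => Rpower 2 (- (p / 2)) * C (g ((a, b), d)))).
    2: { intros d Hd. unfold g; cbn [fst snd]. rewrite w_diag by auto. auto. }
    rewrite lsl_scal. rewrite (Rmult_comm 4), Rmult_assoc. apply Rmult_le_compat_l; [left; apply Rpower_pos|].
    unfold diags, lsumlist, fold_right, C, g, off, padd, horiz; cbn [fst snd].
    change ((1 - 1) / 2)%Z with 0%Z. change ((1 - -1) / 2)%Z with 1%Z.
    replace (a + 1 + -1)%Z with a by ring. replace (b + 1 + -1)%Z with b by ring.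
    rewrite !Z.add_0_r. unfold corners; cbn [fst snd].
    destruct (S (a, b)), (S (a + 1, b)%Z), (S (a, b + 1)%Z), (S (a + 1, b + 1)%Z); simpl; lra. }
  rewrite lsl_scal in L2. lra.
Qed.

(** * Charging runs to corners *)

Definition hr (sg : config) (x : site) : nat := runlen (row sg (snd x)) (fst x).
Definition hc (sg : config) (x : site) : nat := runlen (col sg (fst x)) (snd x).

(* The run of row [y] containing [x] starts [k] sites to the left of [x]. *)
Definition offs (sg : config) (k : nat) (x y : Z) : Prop :=
  sg (x - Z.of_nat k - 1, y)%Z <> sg (x, y) /\
  forall j, (x - Z.of_nat k <= j <= x)%Z -> sg (j, y) = sg (x, y).

(* Going up from [x], the pattern [offs sg k] persists up to the row of the corner [v], where it breaks. *)
Definition charge (sg : config) (k : nat) (x v : site) : Prop :=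
  (0 < corners sg v)%nat /\ (snd x <= snd v)%Z /\
  (forall y, (snd x <= y <= snd v)%Z -> sg (fst x, y) = sg (fst x, snd v)) /\
  offs sg k (fst x) (snd v) /\ (fst x - Z.of_nat k - 1 <= fst v <= fst x - 1)%Z.

(** In a flat square a kink on the lower side reappears unchanged on the upper side, and equality of
    lower and upper spin spreads sideways. Starting from the kink at the left end, the row is copied
    up to column [x]. *)
Lemma flat_pattern_persists sg k x y : offs sg k x y ->
  (forall j, (x - Z.of_nat k - 1 <= j <= x - 1)%Z -> corners sg (j, y) = 0%nat) ->
  offs sg k x (y + 1) /\ sg (x, y + 1)%Z = sg (x, y).
Proof.
  intros [H1 H2] Hc.
  set (a := (x - Z.of_nat k)%Z) in *.
  assert (P : forall n, (n <= k)%nat -> sg (a - 1, y + 1)%Z = sg (a - 1, y)%Z /\ sg (a + Z.of_nat n, y + 1)%Z = sg (a + Z.of_nat n, y)%Z).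
  { induction n; intros Hn.
    - rewrite Z.add_0_r. assert (F := corners_flat sg (a - 1) y (Hc (a - 1)%Z ltac:(unfold a; lia))).
      replace (a - 1 + 1)%Z with a in F by ring. rewrite (H2 a) in F by (unfold a; lia). rewrite (H2 a) by (unfold a; lia).
      destruct F as [[F1 F2]|[F1 F2]]; [congruence|]. split; congruence.
    - destruct (IHn ltac:(lia)) as [I1 I2]. split; auto.
      assert (F := corners_flat sg (a + Z.of_nat n) y (Hc (a + Z.of_nat n)%Z ltac:(unfold a; lia))).
      replace (a + Z.of_nat n + 1)%Z with (a + Z.of_nat (S n))%Z in F by lia.
      assert (E1 := H2 (a + Z.of_nat n)%Z ltac:(unfold a; lia)). assert (E2 := H2 (a + Z.of_nat (S n))%Z ltac:(unfold a; lia)).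
      destruct F as [[F1 F2]|[F1 F2]]; congruence. }
  assert (Q : forall j, (a <= j <= x)%Z -> sg (j, y + 1)%Z = sg (x, y)).
  { intros j Hj. destruct (P (Z.to_nat (j - a)) ltac:(unfold a in *; lia)) as [_ E].
    replace (a + Z.of_nat (Z.to_nat (j - a)))%Z with j in E by lia. rewrite E. apply H2. auto. }
  assert (E0 : sg (x, y + 1)%Z = sg (x, y)) by (apply Q; unfold a; lia).
  split; auto. split.
  - fold a. rewrite (proj1 (P 0%nat ltac:(lia))), E0. auto.
  - intros j Hj. rewrite E0. apply Q; auto.
Qed.

(** The pattern must break by row [y2]. The vertex is found in the last row where it holds, since
    without a corner there [flat_pattern_persists] would carry it one row further. *)
Lemma charge_exists sg k x y y2 : offs sg k x y -> (y < y2)%Z -> sg (x, y2) <> sg (x, y) ->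
  exists v, charge sg k (x, y) v.
Proof.
  intros Ho Hy Hd.
  destruct (nat_least (fun n => ~ (offs sg k x (y + Z.of_nat n) /\ sg (x, y + Z.of_nat n)%Z = sg (x, y)))) as [n [N1 N2]].
  { exists (Z.to_nat (y2 - y)). replace (y + Z.of_nat (Z.to_nat (y2 - y)))%Z with y2 by lia. tauto. }
  destruct n as [|n]. { exfalso. apply N1. rewrite Z.add_0_r. auto. }
  assert (G : forall m, (m <= n)%nat -> offs sg k x (y + Z.of_nat m) /\ sg (x, y + Z.of_nat m)%Z = sg (x, y)).
  { intros m Hm. apply NNPP. apply N2. lia. }
  set (y' := (y + Z.of_nat n)%Z).
  destruct (classic (forall j, (x - Z.of_nat k - 1 <= j <= x - 1)%Z -> corners sg (j, y') = 0%nat)) as [HA|HA].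
  - exfalso. apply N1. replace (y + Z.of_nat (S n))%Z with (y' + 1)%Z by (unfold y'; lia).
    destruct (G n ltac:(lia)) as [G1 G2]. fold y' in G1, G2.
    destruct (flat_pattern_persists sg k x y' G1 HA) as [A1 A2]. split; auto. congruence.
  - apply not_all_ex_not in HA. destruct HA as [j Hj]. apply imply_to_and in Hj. destruct Hj as [Hj Hcj].
    exists (j, y'). unfold charge. cbn [fst snd]. split; [lia|]. split; [unfold y'; lia|]. split; [|split; auto].
    + intros z Hz. destruct (G (Z.to_nat (z - y)) ltac:(unfold y' in *; lia)) as [_ E].
      replace (y + Z.of_nat (Z.to_nat (z - y)))%Z with z in E by lia. rewrite E. symmetry. apply (G n). lia.
    + apply (G n). lia.
Qed.

(** The stretches of [x] and [x'] both reach the column of [v]. If they were different, the kink at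
    the left end of one would lie inside the constant stretch of the other. *)
Lemma charge_column sg k x x' v : charge sg k x v -> charge sg k x' v -> fst x = fst x'.
Proof.
  intros [_ [_ [_ [[A1 A2] A3]]]] [_ [_ [_ [[B1 B2] B3]]]].
  destruct (Z.lt_trichotomy (fst x) (fst x')) as [L|[L|L]]; auto; exfalso.
  - apply B1. rewrite (A2 (fst x' - Z.of_nat k - 1)%Z) by lia. rewrite <- (A2 (fst x' - Z.of_nat k)%Z) by lia. apply B2. lia.
  - apply A1. rewrite (B2 (fst x - Z.of_nat k - 1)%Z) by lia. rewrite <- (B2 (fst x - Z.of_nat k)%Z) by lia. apply A2. lia.
Qed.

Lemma run_connected tau a h i i' : is_run tau a h -> (a <= i < a + Z.of_nat h)%Z ->
  (forall j, (Z.min i i' <= j <= Z.max i i')%Z -> tau j = tau i) -> (a <= i' < a + Z.of_nat h)%Z.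
Proof.
  intros [H1 [H2 [H3 H4]]] Hi Hc.
  assert (Ei : tau i = tau a) by (replace i with (a + (i - a))%Z by lia; apply H2; lia).
  split.
  - apply Z.nlt_ge. intros L. apply H3. rewrite <- Ei. apply Hc. lia.
  - apply Z.nle_gt. intros L. apply H4. rewrite <- Ei. apply Hc. lia.
Qed.

Lemma inv_INR_nonneg n : 0 <= / INR n.
Proof.
  destruct n; [simpl; rewrite Rinv_0; lra|]. left. apply Rinv_0_lt_compat, lt_0_INR. lia.
Qed.

(** The sites charging [v] with the same [k] lie in one column and in one run of it, because the
    column is constant between them and the row of [v]. There are at most [h] of them, each paying
    [/ INR h]. *)
Lemma charge_vertex_bound sg k v L : NoDup L ->
  lsumlist (fun x => Defs.ind (charge sg k x v) * / INR (hc sg x)) L <= INR (corners sg v).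
Proof.
  intros HL.
  assert (T0 : forall x, 0 <= Defs.ind (charge sg k x v) * / INR (hc sg x)).
  { intros x. apply Rmult_le_pos; [unfold Defs.ind; destruct excluded_middle_informative; lra|apply inv_INR_nonneg]. }
  destruct (classic (exists x, charge sg k x v /\ (0 < hc sg x)%nat)) as [[x0 [C0 P0]]|N].
  - destruct (runlen_pos _ _ P0) as [a [Ra Ia]]. fold (hc sg x0) in Ra, Ia. set (h := hc sg x0) in *.
    assert (Q : forall x, charge sg k x v -> fst x = fst x0 /\ hc sg x = h /\ (a <= snd x < a + Z.of_nat h)%Z).
    { intros x Cx. assert (E := charge_column _ _ _ _ _ Cx C0).
      assert (I : (a <= snd x < a + Z.of_nat h)%Z).
      { apply (run_connected (col sg (fst x0)) a h (snd x0) (snd x)); auto.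
        destruct C0 as [_ [O1 [O2 _]]], Cx as [_ [D1 [D2 _]]]. unfold col. rewrite E in D2.
        assert (E0 : sg (fst x0, snd x0) = sg (fst x0, snd v)) by (apply O2; lia).
        intros j Hj. rewrite E0. destruct (Z.le_ge_cases (snd x) (snd x0)); [apply D2|apply O2]; lia. }
      split; auto. split; auto. unfold hc. rewrite E. apply runlen_eq. exists a. split; auto. }
    apply Rle_trans with (lsumlist (fun x => Defs.ind (charge sg k x v) * / INR (hc sg x)) (map (fun y => (fst x0, y)) (win a h))).
    + apply lsl_support_le; auto.
      * apply lsl_map_inj; [congruence|apply NoDup_win].
      * intros x Hx. unfold Defs.ind. destruct excluded_middle_informative as [Cx|]; [|ring].
        exfalso. apply Hx. destruct (Q x Cx) as [E1 [_ E2]]. apply in_map_iff. exists (snd x).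
        split; [destruct x; cbn [fst snd] in *; congruence|]. apply in_win; auto.
    + rewrite lsl_map. apply Rle_trans with (lsumlist (fun _ => / INR h) (win a h)).
      * apply lsl_le. intros y _. unfold Defs.ind. destruct excluded_middle_informative as [Cx|].
        -- destruct (Q _ Cx) as [_ [-> _]]. lra.
        -- rewrite Rmult_0_l. apply inv_INR_nonneg.
      * rewrite lsl_const. unfold win. rewrite length_map, length_seq. rewrite Rinv_r by (apply not_0_INR; lia).
        destruct C0 as [C0 _]. apply (le_INR 1). lia.
  - rewrite lsl_zero; [apply pos_INR|]. intros x _. unfold Defs.ind. destruct excluded_middle_informative as [Cx|]; [|ring].
    assert (E : hc sg x = 0%nat) by (destruct (Nat.eq_dec (hc sg x) 0); auto; exfalso; apply N; exists x; split; auto; lia).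
    rewrite E. simpl. rewrite Rinv_0. ring.
Qed.

Lemma ind_nonneg P : 0 <= Defs.ind P.
Proof. unfold Defs.ind. destruct excluded_middle_informative; lra. Qed.

Lemma ind_true (P : Prop) : P -> Defs.ind P = 1.
Proof. intros H. unfold Defs.ind. destruct excluded_middle_informative; tauto. Qed.

Lemma ind_false (P : Prop) : ~ P -> Defs.ind P = 0.
Proof. intros H. unfold Defs.ind. destruct excluded_middle_informative; tauto. Qed.

Lemma row_run_offset sg x : (0 < hr sg x)%nat -> exists k, (k < hr sg x)%nat /\ offs sg k (fst x) (snd x).
Proof.
  intros P. destruct (runlen_pos _ _ P) as [a [[R1 [R2 [R3 R4]]] I]]. fold (hr sg x) in *.
  exists (Z.to_nat (fst x - a)). split; [lia|].
  assert (E : forall j, (a <= j < a + Z.of_nat (hr sg x))%Z -> sg (j, snd x) = sg (a, snd x)).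
  { intros j Hj. replace j with (a + (j - a))%Z by lia. apply R2. lia. }
  split.
  - replace (fst x - Z.of_nat (Z.to_nat (fst x - a)) - 1)%Z with (a - 1)%Z by lia. rewrite (E (fst x)) by lia. auto.
  - intros j Hj. rewrite (E j), (E (fst x)) by lia. auto.
Qed.

Lemma col_run_flips sg x : (0 < hc sg x)%nat -> exists y2, (snd x < y2)%Z /\ sg (fst x, y2) <> sg (fst x, snd x).
Proof.
  intros P. destruct (runlen_pos _ _ P) as [a [[R1 [R2 [R3 R4]]] I]]. fold (hc sg x) in *.
  exists (a + Z.of_nat (hc sg x))%Z. split; [lia|]. unfold col in *.
  replace (snd x) with (a + (snd x - a))%Z by lia. rewrite (R2 (snd x - a)%Z) by lia. auto.
Qed.

(** A site in a row run shorter than [m] has one of [m] offsets, and each offset gives at most one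
    unit per corner. Infinite column runs have weight [/ 0 = 0] and charge nothing. *)
Lemma charge_rows sg m L V : NoDup L -> (forall v, (0 < corners sg v)%nat -> In v V) ->
  lsumlist (fun x => Defs.ind (0 < hr sg x < m)%nat * / INR (hc sg x)) L <=
  INR m * lsumlist (fun v => INR (corners sg v)) V.
Proof.
  intros HL HV.
  apply Rle_trans with (lsumlist (fun x => lsumlist (fun k => lsumlist (fun v => Defs.ind (charge sg k x v) * / INR (hc sg x)) V) (seq 0 m)) L).
  - apply lsl_le. intros x _.
    assert (NN : forall k, 0 <= lsumlist (fun v => Defs.ind (charge sg k x v) * / INR (hc sg x)) V).
    { intros k. apply lsl_nonneg. intros v _. apply Rmult_le_pos; [apply ind_nonneg|apply inv_INR_nonneg]. }
    destruct (classic ((0 < hr sg x < m)%nat /\ (0 < hc sg x)%nat)) as [[C1 C2]|N].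
    + rewrite ind_true by auto. destruct (row_run_offset sg x ltac:(lia)) as [k [Hk Ho]].
      destruct (col_run_flips sg x C2) as [y2 [Hy Hd]].
      destruct (charge_exists sg k (fst x) (snd x) y2 Ho Hy Hd) as [v Hv].
      replace (fst x, snd x) with x in Hv by (destruct x; auto).
      eapply Rle_trans; [|apply (lsl_ge_term (fun k => lsumlist (fun v => Defs.ind (charge sg k x v) * / INR (hc sg x)) V) _ k); auto; apply in_seq; lia].
      eapply Rle_trans; [|apply (lsl_ge_term (fun v => Defs.ind (charge sg k x v) * / INR (hc sg x)) V v)].
      * rewrite ind_true by auto. lra.
      * intros; apply Rmult_le_pos; [apply ind_nonneg|apply inv_INR_nonneg].
      * apply HV. apply Hv.
    + replace (Defs.ind (0 < hr sg x < m)%nat * / INR (hc sg x)) with 0; [apply lsl_nonneg; auto|].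
      destruct (classic (0 < hr sg x < m)%nat).
      * assert (E : hc sg x = 0%nat) by (destruct (hc sg x); auto; exfalso; apply N; split; auto; lia).
        rewrite E. simpl. rewrite Rinv_0. ring.
      * rewrite ind_false by auto. ring.
  - rewrite lsl_swap. rewrite <- (length_seq m 0) at 2. rewrite <- lsl_const. apply lsl_le. intros k _.
    rewrite lsl_swap. apply lsl_le. intros v _. apply charge_vertex_bound; auto.
Qed.

Lemma charge_cols sg m L V : NoDup L -> (forall v, (0 < corners sg v)%nat -> In v V) ->
  lsumlist (fun x => Defs.ind (0 < hc sg x < m)%nat * / INR (hr sg x)) L <=
  INR m * lsumlist (fun v => INR (corners sg v)) V.
Proof.
  intros HL HV.
  assert (I : forall a b, trp a = trp b -> a = b) by (intros a b E; rewrite <- (trp_trp a), E, trp_trp; auto).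
  assert (T := charge_rows (fun x => sg (trp x)) m (map trp L) (map trp V) (lsl_map_inj trp L I HL)).
  rewrite !lsl_map in T.
  rewrite (lsl_ext (fun a => INR (corners (fun x => sg (trp x)) (trp a))) (fun v => INR (corners sg v))) in T.
  2: { intros v _. rewrite corners_trp, trp_trp. auto. }
  apply T. intros v Hv. rewrite corners_trp in Hv. rewrite <- (trp_trp v). apply in_map. auto.
Qed.

(* Going up from the row [y0], where the stripes are unperturbed, the stripe containing a nonconstant
   column meets a corner. *)
Lemma nonconst_columns sg h y0 L V : (0 < h)%nat -> NoDup L -> (forall v, (0 < corners sg v)%nat -> In v V) ->
  (forall x y, (y <= y0)%Z -> sg (x, y) = stp h x) ->
  lsumlist (fun x => Defs.ind (exists i, col sg x i <> stp h x)) L <= INR h * lsumlist (fun v => INR (corners sg v)) V.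
Proof.
  intros Hh HL HV Hfar.
  apply Rle_trans with (lsumlist (fun x => lsumlist (fun k => lsumlist (fun v => Defs.ind (charge sg k (x, y0) v)) V) (seq 0 h)) L).
  - apply lsl_le. intros x _.
    assert (NN : forall k, 0 <= lsumlist (fun v => Defs.ind (charge sg k (x, y0) v)) V).
    { intros k. apply lsl_nonneg. intros v _. apply ind_nonneg. }
    destruct (classic (exists i, col sg x i <> stp h x)) as [[y2 Hi]|N].
    + rewrite ind_true by eauto.
      assert (Hy : (y0 < y2)%Z) by (apply Z.nle_gt; intros Hle; apply Hi; unfold col; apply Hfar; auto).
      assert (Hd : sg (x, y2) <> sg (x, y0)) by (rewrite (Hfar x y0) by lia; auto).
      destruct (stp_in_run h x Hh) as [q [[R1 [R2 [R3 R4]]] I]]. set (a := (Z.of_nat h * q)%Z) in *.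
      assert (E : forall j, (a <= j < a + Z.of_nat h)%Z -> sg (j, y0) = stp h a).
      { intros j Hj. rewrite Hfar by lia. replace j with (a + (j - a))%Z by lia. apply R2. lia. }
      assert (Ho : offs sg (Z.to_nat (x - a)) x y0).
      { split.
        - replace (x - Z.of_nat (Z.to_nat (x - a)) - 1)%Z with (a - 1)%Z by lia. rewrite (E x) by lia. rewrite Hfar by lia. auto.
        - intros j Hj. rewrite !E by lia. auto. }
      destruct (charge_exists sg _ x y0 y2 Ho Hy Hd) as [v Hv].
      eapply Rle_trans; [|apply (lsl_ge_term (fun k => lsumlist (fun v => Defs.ind (charge sg k (x, y0) v)) V) _ (Z.to_nat (x - a))); auto; apply in_seq; lia].
      eapply Rle_trans; [|apply (lsl_ge_term (fun v => Defs.ind (charge sg (Z.to_nat (x - a)) (x, y0) v)) V v)].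
      * rewrite ind_true by auto. lra.
      * intros; apply ind_nonneg.
      * apply HV. apply Hv.
    + rewrite ind_false by auto. apply lsl_nonneg; auto.
  - rewrite lsl_swap. rewrite <- (length_seq h 0) at 2. rewrite <- lsl_const. apply lsl_le. intros k _.
    rewrite lsl_swap. apply lsl_le. intros v _.
    destruct (classic (exists x, charge sg k (x, y0) v)) as [[x0 C0]|N].
    + apply Rle_trans with (lsumlist (fun x => Defs.ind (charge sg k (x, y0) v)) [x0]).
      * apply lsl_support_le; auto; [repeat constructor; auto|intros; apply ind_nonneg|].
        intros x Hx. apply ind_false. intros Cx. apply Hx. left.
        apply (charge_column _ _ _ _ _ C0 Cx).
      * unfold lsumlist; simpl. rewrite ind_true by auto. destruct C0 as [C0 _]. rewrite Rplus_0_r. apply (le_INR 1). lia.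
    + rewrite lsl_zero; [apply pos_INR|]. intros x _. apply ind_false. eauto.
Qed.

(** * Good regions *)

(** The kink at [e] must continue vertically, so column [e] is constant; in a flat square with one
    constant vertical side the other one is constant too, and constancy spreads over the
    rectangle. *)
Lemma flat_rectangle (f : Z -> Z -> bool) i0 i1 j0 j1 e y :
  (forall i j, (i0 <= i < i1)%Z -> (j0 <= j < j1)%Z -> flat (f i j) (f (i + 1)%Z j) (f i (j + 1)%Z) (f (i + 1)%Z (j + 1)%Z)) ->
  (i0 <= e < i1)%Z -> (j0 <= y <= j1)%Z -> f e y <> f (e + 1)%Z y ->
  forall i j, (i0 <= i <= i1)%Z -> (j0 <= j <= j1)%Z -> f i j = f i y.
Proof.
  intros HF He Hy Hd.
  assert (Up : forall n, (y + Z.of_nat n <= j1)%Z -> f e (y + Z.of_nat n)%Z = f e y /\ f (e + 1)%Z (y + Z.of_nat n)%Z = f (e + 1)%Z y).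
  { induction n; intros Hn; [rewrite Z.add_0_r; auto|]. destruct (IHn ltac:(lia)) as [I1 I2].
    assert (F := HF e (y + Z.of_nat n)%Z He ltac:(lia)).
    replace (y + Z.of_nat n + 1)%Z with (y + Z.of_nat (S n))%Z in F by lia.
    destruct F as [[F1 F2]|[F1 F2]]; [congruence|]. split; congruence. }
  assert (Dn : forall n, (j0 <= y - Z.of_nat n)%Z -> f e (y - Z.of_nat n)%Z = f e y /\ f (e + 1)%Z (y - Z.of_nat n)%Z = f (e + 1)%Z y).
  { induction n; intros Hn; [rewrite Z.sub_0_r; auto|]. destruct (IHn ltac:(lia)) as [I1 I2].
    assert (F := HF e (y - Z.of_nat (S n))%Z He ltac:(lia)).
    replace (y - Z.of_nat (S n) + 1)%Z with (y - Z.of_nat n)%Z in F by lia.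
    destruct F as [[F1 F2]|[F1 F2]]; [congruence|]. split; congruence. }
  assert (Ce : forall j, (j0 <= j <= j1)%Z -> f e j = f e y).
  { intros j Hj. destruct (Z.le_ge_cases y j).
    - destruct (Up (Z.to_nat (j - y)) ltac:(lia)) as [E _]. replace (y + Z.of_nat (Z.to_nat (j - y)))%Z with j in E by lia. auto.
    - destruct (Dn (Z.to_nat (y - j)) ltac:(lia)) as [E _]. replace (y - Z.of_nat (Z.to_nat (y - j)))%Z with j in E by lia. auto. }
  assert (V : forall j, (j0 <= j < j1)%Z -> forall i, (i0 <= i <= i1)%Z -> f i j = f i (j + 1)%Z).
  { intros j Hj. assert (E0 : f e j = f e (j + 1)%Z) by (rewrite (Ce j), (Ce (j + 1)%Z) by lia; auto).
    assert (Rt : forall n, (e + Z.of_nat n <= i1)%Z -> f (e + Z.of_nat n)%Z j = f (e + Z.of_nat n)%Z (j + 1)%Z).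
    { induction n; intros Hn; [rewrite Z.add_0_r; auto|].
      assert (F := HF (e + Z.of_nat n)%Z j ltac:(lia) Hj). replace (e + Z.of_nat n + 1)%Z with (e + Z.of_nat (S n))%Z in F by lia.
      specialize (IHn ltac:(lia)). destruct F as [[F1 F2]|[F1 F2]]; congruence. }
    assert (Lf : forall n, (i0 <= e - Z.of_nat n)%Z -> f (e - Z.of_nat n)%Z j = f (e - Z.of_nat n)%Z (j + 1)%Z).
    { induction n; intros Hn; [rewrite Z.sub_0_r; auto|].
      assert (F := HF (e - Z.of_nat (S n))%Z j ltac:(lia) Hj). replace (e - Z.of_nat (S n) + 1)%Z with (e - Z.of_nat n)%Z in F by lia.
      specialize (IHn ltac:(lia)). destruct F as [[F1 F2]|[F1 F2]]; congruence. }
    intros i Hi. destruct (Z.le_ge_cases e i).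
    - specialize (Rt (Z.to_nat (i - e)) ltac:(lia)). replace (e + Z.of_nat (Z.to_nat (i - e)))%Z with i in Rt by lia. auto.
    - specialize (Lf (Z.to_nat (e - i)) ltac:(lia)). replace (e - Z.of_nat (Z.to_nat (e - i)))%Z with i in Lf by lia. auto. }
  intros i j Hi Hj.
  assert (W : forall n, (j0 + Z.of_nat n <= j1)%Z -> f i (j0 + Z.of_nat n)%Z = f i j0).
  { induction n; intros Hn; [rewrite Z.add_0_r; auto|]. rewrite <- IHn by lia.
    replace (j0 + Z.of_nat (S n))%Z with (j0 + Z.of_nat n + 1)%Z by lia. symmetry. apply V; lia. }
  assert (E1 := W (Z.to_nat (j - j0)) ltac:(lia)). assert (E2 := W (Z.to_nat (y - j0)) ltac:(lia)).
  replace (j0 + Z.of_nat (Z.to_nat (j - j0)))%Z with j in E1 by lia. replace (j0 + Z.of_nat (Z.to_nat (y - j0)))%Z with y in E2 by lia. congruence.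
Qed.

Lemma in_tile_sites l x : (0 < l)%nat -> In x (tile_sites l (tile_of l x)).
Proof.
  intros Hl. destruct x as [a b]. unfold tile_sites, tile_of; cbn [fst snd].
  assert (G : forall c, In c (map (fun k => (c / Z.of_nat l * Z.of_nat l + Z.of_nat k)%Z) (seq 0 l))).
  { intros c. apply in_map_iff. exists (Z.to_nat (c mod Z.of_nat l)).
    assert (Hr := Z.mod_pos_bound c (Z.of_nat l) ltac:(lia)). assert (E := Z.div_mod c (Z.of_nat l) ltac:(lia)).
    rewrite in_seq. lia. }
  apply in_prod; apply G.
Qed.

Lemma n_c_pos sg l x y v : (0 < l)%nat -> sg x = false -> sg y = true -> In y (nbrs x) ->
  In v (bond_ends x y) -> (0 < corners sg v)%nat -> 0 < n_c sg l (tile_of l x).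
Proof.
  intros Hl Hx Hy Hn Hv Hc. unfold n_c.
  assert (N1 : forall x y, 0 <= lsumlist (fun v => if Nat.ltb 0 (corners sg v) then / 2 else 0) (bond_ends x y)).
  { intros. apply lsl_nonneg. intros a _. destruct Nat.ltb; lra. }
  assert (N2 : forall x y, 0 <= (if (negb (sg x) && sg y)%bool then lsumlist (fun v => if Nat.ltb 0 (corners sg v) then / 2 else 0) (bond_ends x y) else 0)).
  { intros. destruct (negb _ && _)%bool; [apply N1|lra]. }
  apply Rlt_le_trans with (/ 2); [lra|].
  eapply Rle_trans; [|apply (lsl_ge_term _ (tile_sites l (tile_of l x)) x)].
  - cbv beta. eapply Rle_trans; [|apply (lsl_ge_term _ (nbrs x) y)]; auto.
    cbv beta. rewrite Hx, Hy. simpl andb.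
    eapply Rle_trans; [|apply (lsl_ge_term _ (bond_ends x y) v)]; auto.
    + cbv beta. destruct (Nat.ltb_spec 0 (corners sg v)); [lra|lia].
    + intros b. destruct Nat.ltb; lra.
  - intros b. apply lsl_nonneg. auto.
  - apply in_tile_sites; auto.
Qed.

(** A corner in the middle of the square is an endpoint of some bond between a minus and a plus site
    of the square, and the tile of the minus site would have [n_c > 0]. *)
Lemma good_flat sg l a b : (0 < l)%nat -> good_site sg l (a, b) -> good_site sg l (a + 1, b)%Z ->
  good_site sg l (a, b + 1)%Z -> good_site sg l (a + 1, b + 1)%Z ->
  flat (sg (a, b)) (sg (a + 1, b)%Z) (sg (a, b + 1)%Z) (sg (a + 1, b + 1)%Z).
Proof.
  intros Hl G00 G10 G01 G11. apply corners_flat.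
  destruct (Nat.eq_dec (corners sg (a, b)) 0) as [E|E]; auto. exfalso.
  assert (Hc : (0 < corners sg (a, b))%nat) by lia.
  assert (Bd : forall x y, good_site sg l x -> sg x = false -> sg y = true -> In y (nbrs x) -> In (a, b) (bond_ends x y) -> False).
  { intros x y G Hx Hy Hn Hv. apply G. left. apply Rlt_gt. apply n_c_pos with y (a, b); auto. }
  assert (B1 : sg (a, b) = false -> sg (a + 1, b)%Z = true -> False).
  { intros. apply (Bd (a, b) (a + 1, b)%Z); auto; [left; auto|].
    unfold bond_ends; cbn [fst snd]. rewrite Z.eqb_refl. right; left; auto. }
  assert (B2 : sg (a, b) = false -> sg (a, b + 1)%Z = true -> False).
  { intros. apply (Bd (a, b) (a, b + 1)%Z); auto; [right; right; left; auto|].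
    unfold bond_ends; cbn [fst snd]. destruct (Z.eqb_spec a (a + 1)), (Z.eqb_spec a (a - 1)); try lia. rewrite Z.eqb_refl. right; left; auto. }
  assert (B3 : sg (a + 1, b)%Z = false -> sg (a, b) = true -> False).
  { intros. apply (Bd (a + 1, b)%Z (a, b)); auto; [right; left; cbn [fst snd]; f_equal; lia|].
    unfold bond_ends; cbn [fst snd]. destruct (Z.eqb_spec a (a + 1 + 1)), (Z.eqb_spec a (a + 1 - 1)); try lia. right; left; f_equal; lia. }
  assert (B4 : sg (a + 1, b)%Z = false -> sg (a + 1, b + 1)%Z = true -> False).
  { intros. apply (Bd (a + 1, b)%Z (a + 1, b + 1)%Z); auto; [right; right; left; auto|].
    unfold bond_ends; cbn [fst snd]. destruct (Z.eqb_spec (a + 1) (a + 1 + 1)), (Z.eqb_spec (a + 1) (a + 1 - 1)); try lia. rewrite Z.eqb_refl. left; f_equal; lia. }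
  assert (B5 : sg (a, b + 1)%Z = false -> sg (a, b) = true -> False).
  { intros. apply (Bd (a, b + 1)%Z (a, b)); auto; [right; right; right; left; cbn [fst snd]; f_equal; lia|].
    unfold bond_ends; cbn [fst snd]. destruct (Z.eqb_spec a (a + 1)), (Z.eqb_spec a (a - 1)), (Z.eqb_spec b (b + 1 + 1)); try lia. right; left; f_equal; lia. }
  assert (B6 : sg (a, b + 1)%Z = false -> sg (a + 1, b + 1)%Z = true -> False).
  { intros. apply (Bd (a, b + 1)%Z (a + 1, b + 1)%Z); auto; [left; auto|].
    unfold bond_ends; cbn [fst snd]. rewrite Z.eqb_refl. left; f_equal; lia. }
  assert (B7 : sg (a + 1, b + 1)%Z = false -> sg (a + 1, b)%Z = true -> False).
  { intros. apply (Bd (a + 1, b + 1)%Z (a + 1, b)%Z); auto; [right; right; right; left; cbn [fst snd]; f_equal; lia|].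
    unfold bond_ends; cbn [fst snd]. destruct (Z.eqb_spec (a + 1) (a + 1 + 1)), (Z.eqb_spec (a + 1) (a + 1 - 1)), (Z.eqb_spec b (b + 1 + 1)); try lia. left; f_equal; lia. }
  clear Bd G00 G10 G01 G11. revert Hc B1 B2 B3 B4 B5 B6 B7. unfold corners; cbn [fst snd].
  destruct (sg (a, b)), (sg (a + 1, b)%Z), (sg (a, b + 1)%Z), (sg (a + 1, b + 1)%Z); simpl; intros; try lia; auto.
Qed.

Lemma same_good_good sg l x y : same_good sg l x y -> good_site sg l x /\ good_site sg l y.
Proof.
  intros [G C]. split; auto. apply clos_rt_rtn1_iff in C. destruct C as [|y z S _]; auto. apply S.
Qed.

Lemma good_tile sg l x y : good_site sg l x -> tile_of l x = tile_of l y -> good_site sg l y.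
Proof. unfold good_site. intros H <-. auto. Qed.

Lemma div_unique_Z l q c : (0 < l)%nat -> (q * Z.of_nat l <= c < (q + 1) * Z.of_nat l)%Z -> (c / Z.of_nat l)%Z = q.
Proof. intros. symmetry. apply (Z.div_unique _ _ _ (c - q * Z.of_nat l)); [left|]; lia. Qed.

Lemma tile_of_spec l c : (0 < l)%nat -> (c / Z.of_nat l * Z.of_nat l <= c < (c / Z.of_nat l + 1) * Z.of_nat l)%Z.
Proof.
  intros. assert (Hr := Z.mod_pos_bound c (Z.of_nat l) ltac:(lia)). assert (E := Z.div_mod c (Z.of_nat l) ltac:(lia)). lia.
Qed.

(* Stated for [f i j = sg (i, j)] and for [f i j = sg (j, i)] at once. *)
Lemma long_good_run_hole (f : Z -> Z -> bool) (good : Z -> Z -> Prop) l a h y : (0 < l)%nat ->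
  (forall i j i' j', good i j -> (i / Z.of_nat l = i' / Z.of_nat l)%Z -> (j / Z.of_nat l = j' / Z.of_nat l)%Z -> good i' j') ->
  (forall i j, good i j -> good (i + 1)%Z j -> good i (j + 1)%Z -> good (i + 1)%Z (j + 1)%Z ->
     flat (f i j) (f (i + 1)%Z j) (f i (j + 1)%Z) (f (i + 1)%Z (j + 1)%Z)) ->
  (2 * Z.of_nat l <= h)%Z -> (forall i, (a <= i <= a + h)%Z -> good i y) ->
  (forall i, (a <= i < a + h)%Z -> f i y = f a y) -> f (a + h)%Z y <> f a y ->
  exists q r, good (q * Z.of_nat l)%Z (r * Z.of_nat l)%Z /\
    forall i j, (q * Z.of_nat l <= i < (q + 1) * Z.of_nat l)%Z -> (r * Z.of_nat l <= j < (r + 1) * Z.of_nat l)%Z -> f i j = f a y.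
Proof.
  intros Hl Hg Hf Hh Hgood Hc Hd.
  (* Tile [q] contains the far end of the run, so row [y] of tile [q - 1] lies in the run, whose
     length is at least [2 l]. On the union of the two tiles the kink at the far end makes all rows
     equal, hence tile [q - 1] is constant. *)
  set (q := ((a + h) / Z.of_nat l)%Z). set (r := (y / Z.of_nat l)%Z).
  assert (Tq := tile_of_spec l (a + h)%Z Hl). fold q in Tq. assert (Tr := tile_of_spec l y Hl). fold r in Tr.
  assert (G : forall i j, ((q - 1) * Z.of_nat l <= i < (q + 1) * Z.of_nat l)%Z -> (r * Z.of_nat l <= j < (r + 1) * Z.of_nat l)%Z -> good i j).
  { intros i j Hi Hj. destruct (Z.lt_ge_cases i (q * Z.of_nat l)).
    - apply (Hg (q * Z.of_nat l - 1)%Z y).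
      + apply Hgood. lia.
      + rewrite !(div_unique_Z l (q - 1)); lia.
      + rewrite (div_unique_Z l r j); auto.
    - apply (Hg (a + h)%Z y).
      + apply Hgood. lia.
      + rewrite (div_unique_Z l q i); [auto|auto|lia].
      + rewrite (div_unique_Z l r j); auto. }
  assert (Fr := flat_rectangle f ((q - 1) * Z.of_nat l) ((q + 1) * Z.of_nat l - 1) (r * Z.of_nat l) ((r + 1) * Z.of_nat l - 1) (a + h - 1) y).
  exists (q - 1)%Z, r. split; [apply G; lia|].
  intros i j Hi Hj. rewrite Fr; try lia.
  - apply Hc. lia.
  - intros i' j' Hi' Hj'. apply Hf; apply G; lia.
  - replace (a + h - 1 + 1)%Z with (a + h)%Z by ring. rewrite (Hc (a + h - 1)%Z) by lia. auto.
Qed.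

Lemma full_tile_bad sg l q r c : (0 < l)%nat ->
  (forall i j, (q * Z.of_nat l <= i < (q + 1) * Z.of_nat l)%Z -> (r * Z.of_nat l <= j < (r + 1) * Z.of_nat l)%Z -> sg (i, j) = c) ->
  ~ good_site sg l (q * Z.of_nat l, r * Z.of_nat l)%Z.
Proof.
  intros Hl H G. apply G. right. exists (q * Z.of_nat l)%Z, (r * Z.of_nat l)%Z, l. split; [lia|].
  intros u v Hu Hv. split.
  - unfold tile_of; cbn [fst snd].
    f_equal; [transitivity q|transitivity r]; [|symmetry| |symmetry]; apply div_unique_Z; lia.
  - rewrite !H; auto; lia.
Qed.

(** A wider stripe would fill a whole good tile with one spin, which is a hole. Thus every counted
    vertical stripe consists of short row runs, for which the gain is controlled by
    [gain_ge_row]. *)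
Lemma in_stripeV_hr sg l h z : (0 < l)%nat -> in_stripeV sg l h z -> hr sg z = h /\ (0 < h < 2 * l)%nat.
Proof.
  intros Hl [a [b [c [Hbc [Ha [Hb [Hm Hw]]]]]]]. destruct (Hw (snd z) Hb) as [W1 [W2 [W3 W4]]].
  assert (M : forall i, (a <= i < a + Z.of_nat h)%Z -> sg (i, snd z) = sg z) by (intros i Hi; apply (Hm (i, snd z)); auto).
  assert (R : is_run (row sg (snd z)) a h).
  { unfold row. repeat split; [lia| | |].
    - intros k Hk. rewrite !M by lia. auto.
    - auto.
    - rewrite (M a) by lia. rewrite (M (a + Z.of_nat h - 1)%Z) in W2 by lia. auto. }
  split; [apply runlen_eq; exists a; auto|]. split; [lia|]. apply Nat.nle_gt. intros Hh.
  destruct (long_good_run_hole (fun i j => sg (i, j)) (fun i j => good_site sg l (i, j)) l a (Z.of_nat h) (snd z) Hl) as [q [r [G H]]].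
  - intros i j i' j' G E1 E2. apply (good_tile sg l (i, j)); auto. unfold tile_of; cbn [fst snd]. congruence.
  - intros i j. apply good_flat; auto.
  - lia.
  - intros i Hi. destruct (Z.eq_dec i (a + Z.of_nat h)) as [->|N]; [apply (same_good_good _ _ _ _ W4)|].
    apply (same_good_good sg l z). apply Hm; cbn [fst snd]; lia.
  - intros i Hi. rewrite !M by lia. auto.
  - apply R.
  - apply (full_tile_bad sg l q r _ Hl H G).
Qed.

Lemma in_stripeH_hc sg l h z : (0 < l)%nat -> in_stripeH sg l h z -> hc sg z = h /\ (0 < h < 2 * l)%nat.
Proof.
  intros Hl [a [b [c [Hbc [Ha [Hb [Hm Hw]]]]]]]. destruct (Hw (fst z) Hb) as [W1 [W2 [W3 W4]]].
  assert (M : forall i, (a <= i < a + Z.of_nat h)%Z -> sg (fst z, i) = sg z) by (intros i Hi; apply (Hm (fst z, i)); auto).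
  assert (R : is_run (col sg (fst z)) a h).
  { unfold col. repeat split; [lia| | |].
    - intros k Hk. rewrite !M by lia. auto.
    - auto.
    - rewrite (M a) by lia. rewrite (M (a + Z.of_nat h - 1)%Z) in W2 by lia. auto. }
  split; [apply runlen_eq; exists a; auto|]. split; [lia|]. apply Nat.nle_gt. intros Hh.
  destruct (long_good_run_hole (fun i j => sg (j, i)) (fun i j => good_site sg l (j, i)) l a (Z.of_nat h) (fst z) Hl) as [q [r [G H]]].
  - intros i j i' j' G E1 E2. apply (good_tile sg l (j, i)); auto. unfold tile_of; cbn [fst snd]. congruence.
  - intros i j G1 G2 G3 G4. assert (F := good_flat sg l j i Hl G1 G3 G2 G4). unfold flat in *. tauto.
  - lia.
  - intros i Hi. destruct (Z.eq_dec i (a + Z.of_nat h)) as [->|N]; [apply (same_good_good _ _ _ _ W4)|].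
    apply (same_good_good sg l z). apply Hm; cbn [fst snd]; lia.
  - intros i Hi. rewrite !M by lia. auto.
  - apply R.
  - apply (full_tile_bad sg l r q (sg (fst z, a)) Hl); auto.
Qed.

Lemma in_stripe_good sg l h z : in_stripe sg l h z -> good_site sg l z.
Proof.
  intros [[a [b [c [_ [Ha [Hb [Hm _]]]]]]]|[a [b [c [_ [Ha [Hb [Hm _]]]]]]]];
  apply (same_good_good sg l z z); apply Hm; lia.
Qed.

(** * Asymptotics of the specific energy *)

Lemma e1_lower p J h : 3 < p -> J <= Jc p -> - (2 * (Jc p - J)) * / INR h <= e1 p J h.
Proof.
  intros Hp HJ. destruct h as [|h].
  - rewrite e1_zero. simpl. rewrite Rinv_0. lra.
  - unfold e1. rewrite Rmult_comm. apply Rmult_le_compat_l; [apply inv_INR_nonneg|].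
    assert (U := self_energy_upper p (S h) Hp). lra.
Qed.

Lemma Rpower_inv_neg x a : 0 < x -> a <> 0 -> Rpower (Rpower x (- / a)) (- a) = x.
Proof.
  intros Hx Ha. rewrite Rpower_mult. replace (- / a * - a) with 1 by (field; auto). apply Rpower_1; auto.
Qed.

(** With [d = Jc p - J] and [h] of order [d^(-1/(p-3))] the tail in [self_energy_lower] is at most
    [d], so that [h e1 <= - 2 d + d]. Dividing by [h] gives the exponent [1 + 1/(p-3)]. *)
Lemma min_energy_upper p : 3 < p -> exists c, 0 < c /\ forall J, 0 < Jc p - J -> Jc p - J <= 1 ->
  exists h, (0 < h)%nat /\ e1 p J h <= - c * Rpower (Jc p - J) ((p - 2) / (p - 3)).
Proof.
  intros Hp. set (a := p - 3). assert (Ha : 0 < a) by (unfold a; lra).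
  set (Cu := 4 * (tail_const p)).
  assert (HC : 0 < Cu).
  { unfold Cu. assert (T := tail_const_pos p Hp). lra. }
  (* The [+ 1] absorbs the rounding of [X] to an integer, as [d^(-1/a) >= 1] for [d <= 1]. *)
  set (Bc := Rpower (/ Cu) (- / a) + 1).
  assert (HB : 0 < Bc) by (unfold Bc; assert (P := Rpower_pos (/ Cu) (- / a)); lra).
  exists (/ Bc). split; [apply Rinv_0_lt_compat; auto|]. intros J Hd Hd1. set (d := Jc p - J) in *.
  set (X := Rpower (d / Cu) (- / a)).
  assert (HX : 0 < X) by apply Rpower_pos.
  assert (EX : X = Rpower (/ Cu) (- / a) * Rpower d (- / a)).
  { unfold X, Rdiv. rewrite Rmult_comm, Rpower_mult_distr; auto. apply Rinv_0_lt_compat; auto. }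
  assert (Hd2 : 1 <= Rpower d (- / a)).
  { rewrite <- (Rpower_O d) by auto. destruct (Req_dec d 1) as [-> | N]; [rewrite !Rpower_O; try lra; unfold Rpower; rewrite ln_1, Rmult_0_r, exp_0; lra|].
    unfold Rpower. left. apply exp_increasing.
    assert (ln d < 0) by (rewrite <- ln_1; apply ln_increasing; lra). assert (0 < / a) by (apply Rinv_0_lt_compat; auto). nra. }
  destruct (archimed X) as [A1 A2]. set (h := Z.to_nat (up X)).
  assert (Hup : (0 < up X)%Z) by (apply lt_IZR; lra).
  assert (Eh : INR h = IZR (up X)) by (unfold h; rewrite INR_IZR_INZ; f_equal; lia).
  assert (Hh : (0 < h)%nat) by (unfold h; lia).
  exists h. split; auto.
  assert (Hh' : 0 < INR h) by (apply lt_0_INR; auto).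
  assert (L := self_energy_lower p h Hp Hh).
  assert (T : Cu * Rpower (INR h) (3 - p) <= d).
  { replace (3 - p) with (- a) by (unfold a; ring).
    apply Rle_trans with (Cu * Rpower X (- a)).
    - apply Rmult_le_compat_l; [lra|]. apply Rpower_opp_le; lra.
    - unfold X. rewrite Rpower_inv_neg by (try apply Rdiv_lt_0_compat; lra). right. field. lra. }
  assert (M : INR h * e1 p J h <= - d).
  { rewrite e1_mult by auto. unfold d in *. unfold Cu in T. lra. }
  assert (Bh : INR h <= Bc * Rpower d (- / a)).
  { unfold Bc. rewrite Rmult_plus_distr_r, <- EX. lra. }
  assert (Pd := Rpower_pos d (- / a)).
  apply Rmult_le_reg_l with (INR h); auto. eapply Rle_trans; [apply M|].
  assert (Ed : Rpower d ((p - 2) / a) * Rpower d (- / a) = d).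
  { rewrite <- Rpower_plus. replace ((p - 2) / a + - / a) with 1 by (unfold a; field; lra). apply Rpower_1; auto. }
  set (Q := Rpower d ((p - 2) / a)) in *. assert (HQ : 0 < Q) by apply Rpower_pos.
  assert (INR h * (/ Bc * Q) <= d).
  { apply Rle_trans with (Bc * Rpower d (- / a) * (/ Bc * Q)).
    - apply Rmult_le_compat_r; auto. left. apply Rmult_lt_0_compat; auto. apply Rinv_0_lt_compat; auto.
    - right. rewrite <- Ed at 2. field. lra. }
  lra.
Qed.

(** Negative energy requires the deficit of [self_energy_upper_strict], of order [h^(3-p)], to be
    below [2 (Jc p - J)]. *)
Lemma minimizer_lower p : 3 < p -> exists c, 0 < c /\ forall J h, 0 < Jc p - J -> (0 < h)%nat -> e1 p J h < 0 ->
  c * Rpower (Jc p - J) (- / (p - 3)) <= INR h.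
Proof.
  intros Hp. set (a := p - 3). assert (Ha : 0 < a) by (unfold a; lra).
  set (cl := 2 * (Rpower 2 (- (p / 2)) * Rpower 3 (1 - p))).
  assert (Hc : 0 < cl).
  { unfold cl. assert (0 < Rpower 2 (- (p / 2)) * Rpower 3 (1 - p)) by (apply Rmult_lt_0_compat; apply Rpower_pos). lra. }
  exists (Rpower (2 / cl) (- / a)). split; [apply Rpower_pos|]. intros J h Hd Hh He. set (d := Jc p - J) in *.
  assert (Hh' : 0 < INR h) by (apply lt_0_INR; auto).
  assert (U := self_energy_upper_strict p h Hp Hh). fold cl in U.
  assert (M : INR h * e1 p J h < 0) by nra. rewrite e1_mult in M by auto.
  rewrite Rpower_mult_distr by (auto; apply Rdiv_lt_0_compat; lra).
  set (Y := 2 / cl * d). assert (HY : 0 < Y) by (unfold Y; apply Rmult_lt_0_compat; auto; apply Rdiv_lt_0_compat; lra).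
  apply Rnot_lt_le. intros L.
  assert (Rpower (Rpower Y (- / a)) (- a) <= Rpower (INR h) (- a)) by (apply Rpower_opp_le; lra).
  rewrite Rpower_inv_neg in H by (auto; lra). replace (- a) with (3 - p) in H by (unfold a; ring).
  assert (cl * Y = 2 * d) by (unfold Y; field; lra).
  assert (cl * Y <= cl * Rpower (INR h) (3 - p)) by (apply Rmult_le_compat_l; lra).
  unfold d in *. lra.
Qed.

(** * Localized lower bound *)

(* The last two terms are the amounts charged to the corners. An infinite run has width [0] and
   contributes nothing, since [e1 p J 0 = 0] and [/ 0 = 0]. *)
Definition gain (p J E : R) (l : nat) (sg : config) (z : site) : R :=
  e1 p J (hr sg z) + e1 p J (hc sg z) - E
  + Defs.ind (0 < hr sg z < 2 * l)%nat * (2 * (Jc p - J) * / INR (hc sg z))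
  + Defs.ind (0 < hc sg z < 2 * l)%nat * (2 * (Jc p - J) * / INR (hr sg z)).

(** The amount added for a short row run cancels the worst case of [e1_lower] for the column through
    [z]. *)
Lemma gain_ge_row p J E l sg z : 3 < p -> J <= Jc p -> (0 < hr sg z < 2 * l)%nat ->
  e1 p J (hr sg z) - E <= gain p J E l sg z.
Proof.
  intros Hp HJ Hs. unfold gain. rewrite (ind_true (0 < hr sg z < 2 * l)%nat) by auto.
  assert (L := e1_lower p J (hc sg z) Hp HJ). assert (N := ind_nonneg (0 < hc sg z < 2 * l)%nat).
  assert (0 <= 2 * (Jc p - J) * / INR (hr sg z)) by (apply Rmult_le_pos; [lra|apply inv_INR_nonneg]).
  assert (0 <= Defs.ind (0 < hc sg z < 2 * l)%nat * (2 * (Jc p - J) * / INR (hr sg z))) by (apply Rmult_le_pos; auto).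
  lra.
Qed.

Lemma gain_ge_col p J E l sg z : 3 < p -> J <= Jc p -> (0 < hc sg z < 2 * l)%nat ->
  e1 p J (hc sg z) - E <= gain p J E l sg z.
Proof.
  intros Hp HJ Hs. unfold gain. rewrite (ind_true (0 < hc sg z < 2 * l)%nat) by auto.
  assert (L := e1_lower p J (hr sg z) Hp HJ). assert (N := ind_nonneg (0 < hr sg z < 2 * l)%nat).
  assert (0 <= 2 * (Jc p - J) * / INR (hc sg z)) by (apply Rmult_le_pos; [lra|apply inv_INR_nonneg]).
  assert (0 <= Defs.ind (0 < hr sg z < 2 * l)%nat * (2 * (Jc p - J) * / INR (hc sg z))) by (apply Rmult_le_pos; auto).
  lra.
Qed.

Lemma e1_long p J h m : 3 < p -> J <= Jc p -> (0 < m)%nat -> (h = 0 \/ m <= h)%nat ->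
  - (2 * (Jc p - J)) * / INR m <= e1 p J h.
Proof.
  intros Hp HJ Hm Hh. eapply Rle_trans; [|apply e1_lower; auto].
  rewrite <- !Ropp_mult_distr_l. apply Ropp_le_contravar. apply Rmult_le_compat_l; [lra|].
  destruct Hh as [-> | Hh]; [simpl; rewrite Rinv_0; left; apply Rinv_0_lt_compat, lt_0_INR; auto|].
  apply Rinv_le_contravar; [apply lt_0_INR; auto|apply le_INR; auto].
Qed.

(** Row and column each contribute at least [- 2 (Jc p - J) / m], an infinite run contributing [0];
    together they consume at most half of [- E]. *)
Lemma gain_long p J E l m sg z : 3 < p -> J <= Jc p -> (0 < m <= 2 * l)%nat ->
  (hr sg z = 0 \/ m <= hr sg z)%nat -> (hc sg z = 0 \/ m <= hc sg z)%nat ->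
  4 * (Jc p - J) * / INR m <= - E / 2 -> - E / 2 <= gain p J E l sg z.
Proof.
  intros Hp HJ Hm Hr Hc HE.
  assert (Lr := e1_long p J _ m Hp HJ ltac:(lia) Hr). assert (Lc := e1_long p J _ m Hp HJ ltac:(lia) Hc).
  assert (0 <= (Jc p - J) * / INR m) by (apply Rmult_le_pos; [lra|apply inv_INR_nonneg]).
  unfold gain.
  assert (0 <= Defs.ind (0 < hr sg z < 2 * l)%nat * (2 * (Jc p - J) * / INR (hc sg z))).
  { repeat apply Rmult_le_pos; try lra; auto using ind_nonneg, inv_INR_nonneg. }
  assert (0 <= Defs.ind (0 < hc sg z < 2 * l)%nat * (2 * (Jc p - J) * / INR (hr sg z))).
  { repeat apply Rmult_le_pos; try lra; auto using ind_nonneg, inv_INR_nonneg. }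
  lra.
Qed.

Lemma gain_nonneg p J hs l sg z : 3 < p -> J <= Jc p -> (0 < l)%nat -> (0 < hs)%nat ->
  (forall h, (0 < h)%nat -> e1 p J hs <= e1 p J h) ->
  4 * (Jc p - J) * / INR l <= - e1 p J hs / 2 -> 0 <= gain p J (e1 p J hs) l sg z.
Proof.
  intros Hp HJ Hl Hh Hmin HE.
  destruct (classic (0 < hr sg z < 2 * l)%nat) as [C1|C1].
  { eapply Rle_trans; [|apply gain_ge_row; auto]. specialize (Hmin (hr sg z) ltac:(lia)). lra. }
  destruct (classic (0 < hc sg z < 2 * l)%nat) as [C2|C2].
  { eapply Rle_trans; [|apply gain_ge_col; auto]. specialize (Hmin (hc sg z) ltac:(lia)). lra. }
  eapply Rle_trans; [|apply (gain_long p J _ l l); auto; lia].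
  assert (0 <= (Jc p - J) * / INR l) by (apply Rmult_le_pos; [lra|apply inv_INR_nonneg]). lra.
Qed.

Lemma lsl_box (f : site -> R) N : lsumlist f (box N) = lsumlist (fun x => lsumlist (fun y => f (x, y)) (zr N)) (zr N).
Proof. apply lsl_prod. Qed.

Lemma tsum_zr (f : Z -> R) N : (forall z, (Z.of_nat N < Z.abs z)%Z -> f z = 0) -> tsum f = lsumlist f (zr N).
Proof. intros H. apply tsum_finite; [apply NoDup_zr|]. intros z Hz. apply H. rewrite in_zr in Hz. lia. Qed.

Lemma gain_far p J hs l sg z : hr sg z = hs -> hc sg z = 0%nat -> gain p J (e1 p J hs) l sg z = 0.
Proof.
  intros H1 H2. unfold gain. rewrite H1, H2, e1_zero, (ind_false (0 < 0 < 2 * l)%nat) by lia.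
  simpl INR. rewrite Rinv_0. ring.
Qed.

(** In the coefficient of the corners, [2 * 2^(-p/2)] is the energy from [corner_term],
    [8 (Jc p - J) l] is the charge [2 (Jc p - J) * 2 l] in each of the two directions, and the last
    term is the loss at the ends of nonconstant columns. *)
Lemma energy_gain_bound p J hs l (s : config) X : 3 < p -> J < Jc p -> (0 < hs)%nat -> NoDup X ->
  let t := sigma_h hs in let sg := glue X s t in
  exists N, (forall v, (0 < corners sg v)%nat -> In v (box N)) /\
    (forall z, ~ In z (box N) -> hr sg z = hs /\ hc sg z = 0%nat) /\
    lsumlist (gain p J (e1 p J hs) l sg) (box N) +
     (2 * Rpower 2 (- (p / 2)) - 8 * (Jc p - J) * INR l - 2 * (Jc p - J) * INR hs)
      * lsumlist (fun v => INR (corners sg v)) (box N)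
    <= H p J X s t - H p J X t t.
Proof.
  intros Hp HJ Hh HX t sg.
  assert (Et : forall x y, t (x, y) = stp hs x) by (intros; apply sigma_h_stp; auto).
  destruct (box_exhausts X) as [M0 HM0]. specialize (HM0 M0 (le_n _)).
  set (M := S M0).
  assert (Far : forall x y, (Z.of_nat M <= Z.abs x \/ Z.of_nat M <= Z.abs y)%Z -> sg (x, y) = stp hs x).
  { intros x y Hxy. rewrite <- (Et x y). unfold sg, glue. destruct (inX X (x, y)) eqn:E; auto.
    apply inX_spec, HM0, in_box in E. cbn [fst snd] in E. lia. }
  assert (HST : forall z, ~ In z X -> sg z = t z).
  { intros z Hz. unfold sg, glue. destruct (inX X z) eqn:E; auto. apply inX_spec in E. tauto. }
  (* The margin [2 hs] keeps whole runs of the periodic state clear of the perturbed zone. *)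
  set (N := (M + 2 * hs + 1)%nat). exists N.
  assert (HN0 : forall z : Z, (Z.of_nat N < Z.abs z)%Z -> (Z.of_nat M + 1 < Z.abs z)%Z) by (intros; lia).
  assert (HV : forall v, (0 < corners sg v)%nat -> In v (box N)).
  { intros [a b] Hc. apply NNPP. intros Nv. rewrite in_box in Nv. cbn [fst snd] in Nv.
    assert (D : (Z.of_nat M + 1 < Z.abs a \/ Z.of_nat M + 1 < Z.abs b)%Z) by lia.
    revert Hc. unfold corners; cbn [fst snd]. rewrite !Far by lia.
    destruct (stp hs a), (stp hs (a + 1)); simpl; lia. }
  assert (HZ : forall z, ~ In z (box N) -> hr sg z = hs /\ hc sg z = 0%nat).
  { intros [x y] Nz. rewrite in_box in Nz. cbn [fst snd] in Nz.
    assert (D : (Z.of_nat N < Z.abs x \/ Z.of_nat N < Z.abs y)%Z) by lia. unfold hr, hc; cbn [fst snd]. split.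
    - destruct (Z.lt_ge_cases (Z.of_nat N) (Z.abs x)) as [L|L].
      + apply (stp_far_run hs _ M); auto; [|lia]. intros j Hj. apply Far. lia.
      + replace (row sg y) with (stp hs) by (extensionality i; symmetry; apply Far; lia).
        destruct (stp_in_run hs x Hh) as [q [R I]]. apply runlen_eq. exists (Z.of_nat hs * q)%Z. auto.
    - destruct (Z.lt_ge_cases (Z.of_nat N) (Z.abs x)) as [L|L].
      + apply (runlen_left_infinite _ (stp hs x)). intros j _. apply Far. lia.
      + destruct (Z.le_ge_cases 0 y).
        * apply (runlen_right_infinite _ (stp hs x)). intros j Hj. apply Far. lia.
        * apply (runlen_left_infinite _ (stp hs x)). intros j Hj. apply Far. lia. }
  split; [auto|split; [auto|]].
  destruct (energy_decomposition p J X s t Hp HX ltac:(intros; rewrite !Et; auto)) as [SC ED].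
  fold sg in SC, ED.
  destruct (half_row_sum p J sg t X Hp HX HST) as [_ [SR [_ _]]].
  destruct (half_col_sum p J sg t X Hp HX HST) as [_ [SCc [_ _]]].
  assert (CT := corner_term p sg (box N) (NoDup_box N) SC).
  cbv zeta in ED. rewrite ED. clear ED.
  set (E := e1 p J hs) in *.
  assert (Er : forall y, row t y = stp hs) by (intros y; extensionality i; unfold row; apply Et).
  assert (Ec0 : forall x i, site_energy p J (col t x) i = 0).
  { intros x i. unfold site_energy. rewrite (Phi_right_const p (col t x) (stp hs x)) by (intros; apply Et).
    unfold col. rewrite !Et, sp_sq. ring. }
  assert (RS : lsumlist (fun y => lsumlist (fun i => e1 p J (hr sg (i, y)) - E) (zr N)) (zr N) <=
     tsum (fun y => tsum (fun i => site_energy p J (row sg y) i - site_energy p J (row t y) i))).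
  { rewrite (tsum_zr _ N).
    - apply lsl_le. intros y _. specialize (SR y). cbv beta in SR. rewrite Er in *.
      apply (row_energy_lb p J hs (row sg y) M); auto; [|lia]. intros i Hi. apply Far. lia.
    - intros y Hy. rewrite (tsum_finite _ []); auto; [constructor|]. intros i _. rewrite Er.
      replace (row sg y) with (stp hs) by (extensionality j; symmetry; apply Far; lia). ring. }
  assert (CS : lsumlist (fun x => lsumlist (fun i => e1 p J (hc sg (x, i))) (zr N) - 2 * (Jc p - J) * Defs.ind (exists i, col sg x i <> stp hs x)) (zr N) <=
     tsum (fun x => tsum (fun i => site_energy p J (col sg x) i - site_energy p J (col t x) i))).
  { rewrite (tsum_zr _ N).
    - apply lsl_le. intros x _. specialize (SCc x). cbv beta in SCc.
      rewrite (tsum_ext _ (site_energy p J (col sg x))) by (intros; rewrite Ec0; ring).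
      apply (summable_ext _ (site_energy p J (col sg x))) in SCc; [|intros; rewrite Ec0; ring].
      apply (col_energy_lb p J (col sg x) M (stp hs x)); auto; [lra| |lia]. intros i Hi. apply Far. lia.
    - intros x Hx. rewrite (tsum_finite _ []); auto; [constructor|]. intros i _. rewrite Ec0.
      unfold site_energy. rewrite (Phi_right_const p (col sg x) (stp hs x)) by (intros; apply Far; lia).
      unfold col. rewrite !Far, sp_sq by lia. ring. }
  rewrite lsl_minus, lsl_scal in CS. rewrite lsl_swap in RS.
  rewrite <- (lsl_box (fun z => e1 p J (hr sg z) - E)) in RS.
  rewrite <- (lsl_box (fun z => e1 p J (hc sg z))) in CS.
  assert (NC := nonconst_columns sg hs (- Z.of_nat M)%Z (zr N) (box N) Hh (NoDup_zr N) HV ltac:(intros; apply Far; lia)).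
  assert (CR := charge_rows sg (2 * l) (box N) (box N) (NoDup_box N) HV).
  assert (CC := charge_cols sg (2 * l) (box N) (box N) (NoDup_box N) HV).
  assert (G : lsumlist (gain p J E l sg) (box N) =
    lsumlist (fun z => e1 p J (hr sg z) - E) (box N) + lsumlist (fun z => e1 p J (hc sg z)) (box N)
    + 2 * (Jc p - J) * lsumlist (fun x => Defs.ind (0 < hr sg x < 2 * l)%nat * / INR (hc sg x)) (box N)
    + 2 * (Jc p - J) * lsumlist (fun x => Defs.ind (0 < hc sg x < 2 * l)%nat * / INR (hr sg x)) (box N)).
  { rewrite <- !lsl_scal, <- !lsl_plus. apply lsl_ext. intros z _. unfold gain. ring. }
  rewrite G. clear G. rewrite mult_INR in CR, CC. simpl (INR 2) in CR, CC.
  set (nc := lsumlist (fun v => INR (corners sg v)) (box N)) in *.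
  set (D := Jc p - J) in *. assert (HD : 0 < D) by (unfold D; lra).
  assert (NC' := Rmult_le_compat_l (2 * D) _ _ ltac:(lra) NC).
  assert (CR' := Rmult_le_compat_l (2 * D) _ _ ltac:(lra) CR).
  assert (CC' := Rmult_le_compat_l (2 * D) _ _ ltac:(lra) CC).
  lra.
Qed.

(** * Holes and stripes *)

Lemma hole_runs sg a b k u v : (u < k)%nat -> (v < k)%nat ->
  (forall u v : nat, (u < k)%nat -> (v < k)%nat -> sg (a + Z.of_nat u, b + Z.of_nat v)%Z = sg (a, b)) ->
  (hr sg (a + Z.of_nat u, b + Z.of_nat v)%Z = 0 \/ k <= hr sg (a + Z.of_nat u, b + Z.of_nat v)%Z)%nat /\
  (hc sg (a + Z.of_nat u, b + Z.of_nat v)%Z = 0 \/ k <= hc sg (a + Z.of_nat u, b + Z.of_nat v)%Z)%nat.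
Proof.
  intros Hu Hv Hm.
  assert (M : forall i j, (a <= i < a + Z.of_nat k)%Z -> (b <= j < b + Z.of_nat k)%Z -> sg (i, j) = sg (a, b)).
  { intros i j Hi Hj. rewrite <- (Hm (Z.to_nat (i - a)) (Z.to_nat (j - b))) by lia. f_equal. f_equal; lia. }
  assert (G : forall tau c n, (n < k)%nat -> (forall i, (c <= i < c + Z.of_nat k)%Z -> tau i = sg (a, b)) ->
    (runlen tau (c + Z.of_nat n) = 0 \/ k <= runlen tau (c + Z.of_nat n))%nat).
  { intros tau c n Hn Ht. destruct (Nat.eq_dec (runlen tau (c + Z.of_nat n)) 0) as [E|E]; auto. right.
    destruct (runlen_pos tau (c + Z.of_nat n) ltac:(lia)) as [a' [R I]].
    assert (I1 := run_connected tau a' _ _ c R I). assert (I2 := run_connected tau a' _ _ (c + Z.of_nat k - 1)%Z R I).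
    specialize (I1 ltac:(intros j Hj; rewrite !Ht by lia; auto)). specialize (I2 ltac:(intros j Hj; rewrite !Ht by lia; auto)). lia. }
  unfold hr, hc; cbn [fst snd]. split; apply G; auto; intros i Hi; unfold row, col; apply M; lia.
Qed.

(** All sites of the hole have both runs infinite or of length at least [l / 5], so [gain_long]
    gives [- E / 2] at each of at least [(l / 5)^2] sites. The constant [20] is [4 * 5] for the same
    reason. *)
Lemma hole_gain p J hs l sg t : 3 < p -> J <= Jc p -> (0 < l)%nat -> (0 < hs)%nat ->
  (forall h, (0 < h)%nat -> e1 p J hs <= e1 p J h) ->
  20 * (Jc p - J) * / INR l <= - e1 p J hs / 2 -> hole sg l t ->
  forall V, NoDup V -> (forall z, tile_of l z = t -> In z V) ->
  INR l ^ 2 / 25 * (- e1 p J hs / 2) <=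
  lsumlist (fun z => if eqd (tile_of l z) t then gain p J (e1 p J hs) l sg z else 0) V.
Proof.
  intros Hp HJ Hl Hh Hmin HE [a [b [k [Hk Hsq]]]] V HV HIn.
  assert (Ln : 0 < INR l) by (apply lt_0_INR; auto).
  assert (Hk0 : (0 < k)%nat) by lia.
  assert (D0 : 0 <= (Jc p - J) * / INR l) by (apply Rmult_le_pos; [lra|apply inv_INR_nonneg]).
  assert (GN : forall z, 0 <= gain p J (e1 p J hs) l sg z).
  { intros z. apply gain_nonneg; auto. lra. }
  set (m := Nat.min k l).
  assert (Hm : (0 < m <= 2 * l)%nat /\ (l <= 5 * m)%nat /\ (m <= k)%nat) by (unfold m; lia).
  assert (Lm : 0 < INR m) by (apply lt_0_INR; lia).
  assert (L5 : INR l <= 5 * INR m).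
  { replace 5 with (INR 5) by (simpl; ring). rewrite <- mult_INR. apply le_INR. lia. }
  assert (I5 : / INR m <= 5 * / INR l).
  { apply Rmult_le_reg_r with (INR m); auto. rewrite Rinv_l by lra. apply Rmult_le_reg_r with (INR l); auto.
    field_simplify; lra. }
  set (g := fun uv : nat * nat => (a + Z.of_nat (fst uv), b + Z.of_nat (snd uv))%Z).
  set (Q := map g (list_prod (seq 0 m) (seq 0 m))).
  apply Rle_trans with (lsumlist (fun z => if eqd (tile_of l z) t then gain p J (e1 p J hs) l sg z else 0) Q).
  - unfold Q. rewrite lsl_map.
    apply Rle_trans with (lsumlist (fun _ => - e1 p J hs / 2) (list_prod (seq 0 m) (seq 0 m))).
    + rewrite lsl_const, length_prod, length_seq, mult_INR. apply Rmult_le_compat_r; [lra|]. nra.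
    + apply lsl_le. intros [u v] Huv. apply in_prod_iff in Huv. rewrite !in_seq in Huv.
      unfold g; cbn [fst snd]. destruct (Hsq u v ltac:(lia) ltac:(lia)) as [T1 _].
      destruct eqd as [_|C]; [|contradiction].
      destruct (hole_runs sg a b k u v ltac:(lia) ltac:(lia)) as [R1 R2].
      { intros u' v' Hu' Hv'. apply Hsq; auto. }
      apply (gain_long p J _ l m); auto; try lia.
      apply Rle_trans with (20 * ((Jc p - J) * / INR l)); [|lra].
      assert ((Jc p - J) * / INR m <= (Jc p - J) * (5 * / INR l)) by (apply Rmult_le_compat_l; lra). lra.
  - apply lsl_incl_le; auto.
    + apply lsl_map_inj.
      * intros [u v] [u' v']. unfold g; cbn [fst snd]. intros E. injection E. intros. f_equal; lia.
      * apply NoDup_list_prod; apply seq_NoDup.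
    + intros z Hz. apply in_map_iff in Hz. destruct Hz as [[u v] [<- Huv]]. apply in_prod_iff in Huv. rewrite !in_seq in Huv.
      apply HIn. unfold g; cbn [fst snd]. apply Hsq; lia.
    + intros z _. destruct eqd; [auto|lra].
Qed.

Lemma hole_sum p J hs l sg n N : 3 < p -> J <= Jc p -> (0 < l)%nat -> (0 < hs)%nat ->
  (forall h, (0 < h)%nat -> e1 p J hs <= e1 p J h) ->
  20 * (Jc p - J) * / INR l <= - e1 p J hs / 2 ->
  (forall z, ~ In z (box N) -> hr sg z = hs /\ hc sg z = 0%nat) ->
  INR l ^ 2 / 25 * (- e1 p J hs / 2) * bsum n (fun t => Defs.ind (bad sg l t /\ hole sg l t)) <=
  lsumlist (fun z => Defs.ind (hole sg l (tile_of l z)) * gain p J (e1 p J hs) l sg z) (box N).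
Proof.
  intros Hp HJ Hl Hh Hmin HE Hfar. unfold bsum.
  assert (D0 : 0 <= (Jc p - J) * / INR l) by (apply Rmult_le_pos; [lra|apply inv_INR_nonneg]).
  assert (GN : forall z, 0 <= gain p J (e1 p J hs) l sg z).
  { intros z. apply gain_nonneg; auto. lra. }
  (* This box contains all sites of the tiles with index in [box n]. *)
  set (V := box (S n * l)).
  set (g := gain p J (e1 p J hs) l sg) in *.
  rewrite <- lsl_scal.
  apply Rle_trans with (lsumlist (fun t => lsumlist (fun z => Defs.ind (hole sg l t) * (if eqd (tile_of l z) t then g z else 0)) V) (box n)).
  - apply lsl_le. intros t Ht. rewrite lsl_scal. destruct (classic (hole sg l t)) as [C|C].
    + rewrite (ind_true (hole sg l t)), ind_true by (unfold bad; tauto). rewrite Rmult_1_r, Rmult_1_l.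
      apply (hole_gain p J hs l sg t); auto; [apply NoDup_box|].
      intros [x y] <-. apply in_box. apply in_box in Ht. unfold tile_of in Ht. cbn [fst snd] in *.
      assert (T1 := tile_of_spec l x Hl). assert (T2 := tile_of_spec l y Hl). nia.
    + rewrite (ind_false (hole sg l t)), ind_false by tauto. lra.
  - rewrite lsl_swap. apply Rle_trans with (lsumlist (fun z => Defs.ind (hole sg l (tile_of l z)) * g z) V).
    + apply lsl_le. intros z _. eapply Rle_trans; [apply (lsl_support_le _ [tile_of l z])|].
      * repeat constructor; auto.
      * apply NoDup_box.
      * intros t. apply Rmult_le_pos; [apply ind_nonneg|]. destruct eqd; [auto|lra].
      * intros t Ht. destruct eqd as [E|]; [|ring]. exfalso. apply Ht. left; auto.
      * unfold lsumlist; simpl. destruct eqd as [_|C]; [lra|contradiction].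
    + apply lsl_support_le; try apply NoDup_box.
      * intros z. apply Rmult_le_pos; [apply ind_nonneg|auto].
      * intros z Hz. destruct (Hfar z Hz). unfold g. rewrite gain_far by auto. ring.
Qed.

(** For a given [z] only the widths [hr sg z] and [hc sg z] can contribute, and each contribution is
    at most the gain at [z]; the factor [2] covers both. *)
Lemma stripe_site p J hs l sg n z : 3 < p -> J <= Jc p -> (0 < l)%nat -> (0 < hs)%nat ->
  (forall h, (0 < h)%nat -> e1 p J hs <= e1 p J h) ->
  4 * (Jc p - J) * / INR l <= - e1 p J hs / 2 ->
  lsumlist (fun h => if Nat.eqb h hs then 0 else (e1 p J h - e1 p J hs) * Defs.ind (in_stripe sg l h z)) (seq 1 n) <=
  2 * (Defs.ind (good_site sg l z) * gain p J (e1 p J hs) l sg z).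
Proof.
  intros Hp HJ Hl Hh Hmin HE. set (E := e1 p J hs) in *.
  assert (GN := gain_nonneg p J hs l sg z Hp HJ Hl Hh Hmin HE). fold E in GN. set (g := gain p J E l sg z) in *.
  assert (Sd : forall h0 (P : Prop), (P -> (0 < h0 < 2 * l)%nat -> e1 p J h0 - E <= g) ->
    lsumlist (fun h => if Nat.eqb h h0 then Defs.ind (P /\ (0 < h0 < 2 * l)%nat) * (e1 p J h - E) else 0) (seq 1 n) <= Defs.ind P * g).
  { intros h0 P HP. destruct (classic (P /\ (0 < h0 < 2 * l)%nat)) as [[C1 C2]|C].
    - rewrite (ind_true P), Rmult_1_l by auto. eapply Rle_trans; [apply (lsl_support_le _ [h0])|].
      + repeat constructor; auto.
      + apply seq_NoDup.
      + intros h. destruct (Nat.eqb_spec h h0) as [->|]; [|lra]. apply Rmult_le_pos; [apply ind_nonneg|].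
        specialize (Hmin h0 ltac:(lia)). lra.
      + intros h Hn. destruct (Nat.eqb_spec h h0) as [->|]; auto. exfalso. apply Hn; left; auto.
      + unfold lsumlist; simpl. rewrite Nat.eqb_refl, ind_true by auto. specialize (HP C1 C2). lra.
    - rewrite lsl_zero; [apply Rmult_le_pos; [apply ind_nonneg|auto]|]. intros h _. destruct Nat.eqb; auto.
      rewrite ind_false by auto. ring. }
  assert (S1 := Sd (hr sg z) (good_site sg l z) ltac:(intros _ C; apply gain_ge_row; auto)).
  assert (S2 := Sd (hc sg z) (good_site sg l z) ltac:(intros _ C; apply gain_ge_col; auto)).
  apply Rle_trans with (lsumlist (fun h =>
    (if Nat.eqb h (hr sg z) then Defs.ind (good_site sg l z /\ (0 < hr sg z < 2 * l)%nat) * (e1 p J h - E) else 0) +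
    (if Nat.eqb h (hc sg z) then Defs.ind (good_site sg l z /\ (0 < hc sg z < 2 * l)%nat) * (e1 p J h - E) else 0)) (seq 1 n)).
  - apply lsl_le. intros h Hhs. apply in_seq in Hhs.
    assert (P : 0 <= e1 p J h - E) by (specialize (Hmin h ltac:(lia)); lra).
    assert (Q1 : 0 <= (if Nat.eqb h (hr sg z) then Defs.ind (good_site sg l z /\ (0 < hr sg z < 2 * l)%nat) * (e1 p J h - E) else 0)).
    { destruct (Nat.eqb h (hr sg z)); [apply Rmult_le_pos; auto using ind_nonneg|lra]. }
    assert (Q2 : 0 <= (if Nat.eqb h (hc sg z) then Defs.ind (good_site sg l z /\ (0 < hc sg z < 2 * l)%nat) * (e1 p J h - E) else 0)).
    { destruct (Nat.eqb h (hc sg z)); [apply Rmult_le_pos; auto using ind_nonneg|lra]. }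
    destruct (Nat.eqb h hs); [lra|].
    destruct (classic (in_stripe sg l h z)) as [C|C]; [|rewrite (ind_false (in_stripe sg l h z)) by auto; lra].
    rewrite (ind_true (in_stripe sg l h z)) by auto. assert (Gd := in_stripe_good _ _ _ _ C).
    destruct C as [C|C].
    + destruct (in_stripeV_hr _ _ _ _ Hl C) as [E1 E2]. rewrite E1, Nat.eqb_refl, (ind_true (good_site sg l z /\ (0 < h < 2 * l)%nat)) in * by auto. lra.
    + destruct (in_stripeH_hc _ _ _ _ Hl C) as [E1 E2]. rewrite E1, Nat.eqb_refl, (ind_true (good_site sg l z /\ (0 < h < 2 * l)%nat)) in * by auto. lra.
  - rewrite lsl_plus. lra.
Qed.

Lemma stripe_sum p J hs l sg n N : 3 < p -> J <= Jc p -> (0 < l)%nat -> (0 < hs)%nat ->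
  (forall h, (0 < h)%nat -> e1 p J hs <= e1 p J h) ->
  4 * (Jc p - J) * / INR l <= - e1 p J hs / 2 ->
  (forall z, ~ In z (box N) -> hr sg z = hs /\ hc sg z = 0%nat) ->
  lsumlist (fun h => if Nat.eqb h hs then 0
     else (es p J h - es p J hs) * bsum n (fun z => Defs.ind (in_stripe sg l h z))) (seq 1 n) <=
  2 * lsumlist (fun z => Defs.ind (good_site sg l z) * gain p J (e1 p J hs) l sg z) (box N).
Proof.
  intros Hp HJ Hl Hh Hmin HE Hfar.
  rewrite (lsl_ext _ (fun h => lsumlist (fun z => if Nat.eqb h hs then 0 else (e1 p J h - e1 p J hs) * Defs.ind (in_stripe sg l h z)) (box n))).
  2: { intros h Hs. apply in_seq in Hs. rewrite !es_eq by (auto; lia). unfold bsum. destruct (Nat.eqb h hs).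
       - rewrite lsl_zero; auto.
       - rewrite lsl_scal. auto. }
  rewrite lsl_swap. eapply Rle_trans; [apply lsl_le; intros z _; apply stripe_site; auto|].
  rewrite lsl_scal. apply Rmult_le_compat_l; [lra|]. apply lsl_support_le; try apply NoDup_box.
  - intros z. apply Rmult_le_pos; [apply ind_nonneg|apply gain_nonneg; auto].
  - intros z Hz. destruct (Hfar z Hz). rewrite gain_far by auto. ring.
Qed.

(** The limit cannot be [+oo]; were it [-oo], [real] would return [0], whence the hypothesis
    [0 <= C]. *)
Lemma lsum_le_bound (f : site -> R) C : 0 <= C -> (forall n, bsum n f <= C) -> lsum f <= C.
Proof.
  intros HC H. unfold lsum.
  assert (L : Rbar_le (Lim_seq (fun n => bsum n f)) (Lim_seq (fun _ => C))).
  { apply Lim_seq_le_loc. exists 0%nat. auto. }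
  rewrite Lim_seq_const in L. destruct (Lim_seq (fun n => bsum n f)); simpl in *; auto.
Qed.

Lemma good_or_hole sg l z : Defs.ind (good_site sg l z) + Defs.ind (hole sg l (tile_of l z)) <= 1.
Proof.
  destruct (classic (hole sg l (tile_of l z))) as [C|C].
  - rewrite (ind_true (hole sg l (tile_of l z))), ind_false; auto; [lra|]. intros G. apply G. right; auto.
  - rewrite (ind_false (hole sg l (tile_of l z))) by auto. unfold Defs.ind. destruct excluded_middle_informative; lra.
Qed.

(** * Choice of the constants and conclusion *)

Theorem theorem3 :
  forall p : R, 4 < p ->
  exists C0 C1 eps : R, 0 < C0 /\ 0 < C1 /\ 0 < eps /\
    forall (J : R) (hs l : nat),
      0 < J -> Jc p - eps < J -> J < Jc p ->
      is_min_es p J hs ->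
      C0 * INR hs <= INR l -> INR l <= / (C0 * (Jc p - J)) ->
      forall (s : config) (X : list site), NoDup X ->
      let sg := glue X s (sigma_h hs) in
      Rbar_le
        (Rbar_plus
           (Finite (H p J X (sigma_h hs) (sigma_h hs)
                    + C1 * (Nc sg + Rpower (Jc p - J) ((p - 2) / (p - 3))
                                     * (INR l) ^ 2 * NBhole sg l)))
           (Rbar_mult (Finite (1 / 2)) (stripe_term p J hs sg l)))
        (Finite (H p J X s (sigma_h hs))).
Proof.
  intros p Hp4. assert (Hp : 3 < p) by lra.
  destruct (min_energy_upper p Hp) as [c2 [Hc2 HU]]. destruct (minimizer_lower p Hp) as [c3 [Hc3 HLo]].
  set (c1 := 2 * Rpower 2 (- (p / 2))). assert (Hc1 : 0 < c1) by (unfold c1; assert (P := Rpower_pos 2 (- (p / 2))); lra).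
  (* With [d = Jc p - J]: the term [20 / c1] forces [d l <= c1 / 20], so that the charges
     [8 d l + 2 d hs] use at most half of the corner energy; [40 / (c2 * c3)] forces [20 d / l]
     below half of [- E]; the summand [1] gives [hs <= l]. *)
  set (C0 := 1 + 20 / c1 + 40 / (c2 * c3)).
  assert (H23 : 0 < c2 * c3) by (apply Rmult_lt_0_compat; auto).
  assert (A1 : 0 < 20 / c1) by (apply Rdiv_lt_0_compat; lra).
  assert (A2 : 0 < 40 / (c2 * c3)) by (apply Rdiv_lt_0_compat; lra).
  (* Half of the corner energy remains, and a hole gains [l^2 / 25 * (- E / 2)], at least [c2 / 50]
     times its weight in the statement. The value [1] for [eps] ensures [d <= 1], as
     [min_energy_upper] requires. *)
  exists C0, (Rmin (c1 / 2) (c2 / 50)), 1. split; [unfold C0; lra|]. split; [apply Rmin_pos; lra|]. split; [lra|].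
  intros J hs l _ HJ1 HJ2 [Hh Hmin] Hl1 Hl2 s X HX sg.
  set (d := Jc p - J) in *. assert (Hd : 0 < d) by (unfold d; lra). assert (Hd1 : d <= 1) by (unfold d; lra).
  assert (HC0 : 1 < C0) by (unfold C0; lra).
  assert (Hhs : 1 <= INR hs) by (apply (le_INR 1); auto).
  assert (Ll : 0 < INR l) by nra.
  assert (Hl : (0 < l)%nat) by (apply INR_lt; auto).
  assert (Hmin' : forall h, (0 < h)%nat -> e1 p J hs <= e1 p J h).
  { intros h H0. rewrite <- !es_eq by (auto; lia). apply Hmin. lia. }
  set (E := e1 p J hs) in *. set (P := Rpower d ((p - 2) / (p - 3))).
  assert (HP : 0 < P) by apply Rpower_pos.
  assert (HE : E <= - c2 * P).
  { destruct (HU J) as [h [H1 H2]]; auto. eapply Rle_trans; [apply (Hmin' h H1)|]. exact H2. }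
  assert (HE0 : E < 0) by nra.
  assert (Hlow := HLo J hs ltac:(unfold d in Hd; lra) ltac:(lia) HE0). fold d in Hlow.
  assert (Pd := Rpower_pos d (- / (p - 3))). set (Y := Rpower d (- / (p - 3))) in *.
  (* Energy scale times width scale is [d]: this converts a lower bound on [l] in units of the width
     [Y] into a comparison of [d / l] with [- E]. *)
  assert (EP : P * Y = d).
  { unfold P, Y. rewrite <- Rpower_plus. replace ((p - 2) / (p - 3) + - / (p - 3)) with 1 by (field; lra). apply Rpower_1; auto. }
  assert (HEl : 20 * d * / INR l <= - E / 2).
  { apply Rmult_le_reg_r with (INR l); auto. rewrite Rmult_assoc, Rinv_l, Rmult_1_r by lra.
    assert (40 / (c2 * c3) * INR hs <= INR l) by (unfold C0 in Hl1; nra).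
    assert (40 / c2 * Y <= INR l).
    { eapply Rle_trans; [|apply H]. replace (40 / c2 * Y) with (40 / (c2 * c3) * (c3 * Y)) by (field; lra).
      apply Rmult_le_compat_l; [lra|]. auto. }
    apply Rle_trans with (c2 * P / 2 * (40 / c2 * Y)).
    - right. rewrite <- EP. field. lra.
    - apply Rmult_le_compat; nra || (try apply Rmult_le_pos; try lra). left. apply Rdiv_lt_0_compat; lra. }
  assert (Dl : 0 <= d * / INR l) by (apply Rmult_le_pos; [lra|left; apply Rinv_0_lt_compat; auto]).
  destruct (energy_gain_bound p J hs l s X Hp HJ2 Hh HX) as [N [HV [Hfar HD]]].
  fold sg in HV, Hfar, HD. fold E in HD. fold d in HD. fold c1 in HD.
  set (nc := lsumlist (fun v => INR (corners sg v)) (box N)) in *.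
  assert (Enc : Nc sg = nc).
  { assert (Z0 : forall v, ~ In v (box N) -> INR (corners sg v) = 0).
    { intros v Hv. destruct (corners sg v) eqn:Ec; auto. exfalso. apply Hv, HV. lia. }
    unfold Nc. rewrite lsum_tsum.
    - apply tsum_finite; auto. apply NoDup_box.
    - apply (summable_finite _ (box N)); auto. apply NoDup_box. }
  assert (Hnc : 0 <= nc) by (apply lsl_nonneg; intros; apply pos_INR).
  assert (Hdl : d * INR l <= / C0).
  { apply Rle_trans with (d * / (C0 * d)); [apply Rmult_le_compat_l; lra|]. right. field. lra. }
  assert (HiC : / C0 <= c1 / 20).
  { replace (c1 / 20) with (/ (20 / c1)) by (field; lra). apply Rinv_le_contravar; auto. unfold C0; lra. }
  assert (Hcoef : c1 / 2 <= c1 - 8 * d * INR l - 2 * d * INR hs).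
  { assert (INR hs <= INR l) by nra. assert (d * INR hs <= d * INR l) by (apply Rmult_le_compat_l; lra). lra. }
  set (A := lsumlist (fun z => Defs.ind (good_site sg l z) * gain p J E l sg z) (box N)).
  set (Bh := lsumlist (fun z => Defs.ind (hole sg l (tile_of l z)) * gain p J E l sg z) (box N)).
  assert (GN : forall z, 0 <= gain p J E l sg z).
  { intros z. apply gain_nonneg; auto; [lra|]. fold d. fold E. lra. }
  (* Good sites pay for the stripes and sites of tiles with a hole pay for the holes; no site does
     both. *)
  assert (HAB : A + Bh <= lsumlist (gain p J E l sg) (box N)).
  { unfold A, Bh. rewrite <- lsl_plus. apply lsl_le. intros z _. assert (T := good_or_hole sg l z). specialize (GN z). nra. }
  assert (HBh : 0 <= Bh) by (apply lsl_nonneg; intros z _; apply Rmult_le_pos; auto using ind_nonneg).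
  assert (HA : forall n, lsumlist (fun h => if Nat.eqb h hs then 0
     else (es p J h - es p J hs) * bsum n (fun z => Defs.ind (in_stripe sg l h z))) (seq 1 n) <= 2 * A).
  { intros n. apply stripe_sum; auto; [lra|]. fold d. fold E. lra. }
  assert (HA0 : forall n, 0 <= lsumlist (fun h => if Nat.eqb h hs then 0
     else (es p J h - es p J hs) * bsum n (fun z => Defs.ind (in_stripe sg l h z))) (seq 1 n)).
  { intros n. apply lsl_nonneg. intros h Hs. apply in_seq in Hs. destruct Nat.eqb; [lra|].
    apply Rmult_le_pos; [specialize (Hmin h ltac:(lia)); lra|]. apply lsl_nonneg. intros; apply ind_nonneg. }
  assert (HNB : c2 / 50 * P * INR l ^ 2 * NBhole sg l <= Bh).
  { set (q := INR l ^ 2 / 25 * (- E / 2)).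
    assert (L2 : 0 < INR l ^ 2) by (apply pow_lt; auto).
    assert (Hq : c2 / 50 * P * INR l ^ 2 <= q) by (unfold q; nra).
    assert (Hq0 : 0 < c2 / 50 * P * INR l ^ 2) by (repeat apply Rmult_lt_0_compat; lra).
    assert (NBhole sg l <= Bh / q).
    { apply lsum_le_bound.
      - apply Rmult_le_pos; auto. left; apply Rinv_0_lt_compat; lra.
      - intros n. apply Rmult_le_reg_l with q; [lra|]. replace (q * (Bh / q)) with Bh by (field; lra).
        apply hole_sum; auto. lra. }
    apply Rle_trans with (c2 / 50 * P * INR l ^ 2 * (Bh / q)); [apply Rmult_le_compat_l; lra|].
    apply Rle_trans with (q * (Bh / q)); [|right; field; lra].
    apply Rmult_le_compat_r; auto. apply Rmult_le_pos; auto. left; apply Rinv_0_lt_compat; lra. }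
  assert (HC1 : Rmin (c1 / 2) (c2 / 50) * (Nc sg + P * INR l ^ 2 * NBhole sg l) <= c1 / 2 * nc + Bh).
  { set (m := Rmin (c1 / 2) (c2 / 50)).
    assert (M1 : m <= c1 / 2) by apply Rmin_l. assert (M2 : m <= c2 / 50) by apply Rmin_r.
    assert (M0 : 0 < m) by (apply Rmin_pos; lra).
    rewrite Enc. assert (T1 : m * nc <= c1 / 2 * nc) by (apply Rmult_le_compat_r; auto).
    (* No sign of [NBhole] is established beforehand; were the term negative, it would only help. *)
    destruct (Rle_dec 0 (P * INR l ^ 2 * NBhole sg l)) as [C|C].
    - assert (m * (P * INR l ^ 2 * NBhole sg l) <= c2 / 50 * (P * INR l ^ 2 * NBhole sg l)) by (apply Rmult_le_compat_r; auto). lra.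
    - assert (m * (P * INR l ^ 2 * NBhole sg l) <= 0) by nra. lra. }
  assert (HST : Rbar_le (stripe_term p J hs sg l) (2 * A) /\ Rbar_le 0 (stripe_term p J hs sg l)).
  { unfold stripe_term. split.
    - rewrite <- (Lim_seq_const (2 * A)). apply Lim_seq_le_loc. exists 0%nat. intros n _. apply HA.
    - rewrite <- (Lim_seq_const 0). apply Lim_seq_le_loc. exists 0%nat. intros n _. apply HA0. }
  (* Lying between [0] and [2 A], the stripe term is finite, and the inequality in [Rbar] becomes
     one between real numbers. *)
  fold P. destruct HST as [T1 T2]. destruct (stripe_term p J hs sg l) as [x| |]; simpl in T1, T2; try contradiction.
  simpl. assert ((c1 - 8 * d * INR l - 2 * d * INR hs) * nc >= c1 / 2 * nc) by (apply Rle_ge, Rmult_le_compat_r; auto). lra.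
Qed.
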